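(* $\left(Har_{\mathcal E}({\bf D}_{f,rad}^m),\rho\right)$ is a complete metric space.
   Context: Fix integers $n,m\ge1$ and a separable Hilbert space $\mathcal E$; $\mathcal H$ is an infinite-dimensional separable Hilbert space. $\mathbb F_n^+$ is the free monoid on generators $g_1,\dots,g_n$ with identity $g_0$; $|\alpha|$ is the word length ($|g_0|=0$). For operators (or indeterminates) and $\alpha=g_{i_1}\cdots g_{i_k}$ put $X_\alpha:=X_{i_1}\cdots X_{i_k}$, $X_{g_0}:=I$. $f=\sum_{\alpha}a_\alpha Z_\alpha$ is a fixed positive regular free holomorphic function: a formal power series in noncommuting indeterminates with $a_\alpha\ge0$, $a_{g_0}=0$, $a_{g_i}>0$ for $1\le i\le n$, and $\limsup_{k}\big(\sum_{|\alpha|=k}|a_\alpha|^2\big)^{1/2k}<\infty$. Put $b^{(m)}_{g_0}:=1$ and, for $|\alpha|\ge1$, $b^{(m)}_\alpha:=\sum_{j=1}^{|\alpha|}\sum_{\gamma_1\cdots\gamma_j=\alpha,\,|\gamma_i|\ge1}a_{\gamma_1}\cdots a_{\gamma_j}\binom{j+m-1}{m-1}$. Domain: for a Hilbert space $\mathcal K$ and $X\in B(\mathcal K)^n$, $\Phi_{f,X}(Y):=\sum_{|\alpha|\ge1}a_\alpha X_\alpha YX_\alpha^*$ (WOT convergence); ${\bf D}_f^m(\mathcal K):=\{X\in B(\mathcal K)^n:(id-\Phi_{f,X})^k(I)\ge0,\ 1\le k\le m\}$; ${\bf D}_{f,rad}^m(\mathcal K):=\bigcup_{0\le t<1}t{\bf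 D}_f^m(\mathcal K)$. $F^2(H_n)$ is the Hilbert space with orthonormal basis $\{e_\alpha\}_{\alpha\in\mathbb F_n^+}$; $W=(W_1,\dots,W_n)\in{\bf D}_f^m(F^2(H_n))$ is given by $W_ie_\alpha=\sqrt{b^{(m)}_\alpha/b^{(m)}_{g_i\alpha}}\,e_{g_i\alpha}$. $\otimes_{min}$ is the spatial tensor product. A formal power series $F=\sum_\alpha A_{(\alpha)}\otimes Z_\alpha$, $A_{(\alpha)}\in B(\mathcal E)$, is free holomorphic on ${\bf D}^m_{f,rad}$ if $F(X)=\sum_{k=0}^\infty\sum_{|\alpha|=k}A_{(\alpha)}\otimes X_\alpha$ converges in operator norm for every Hilbert space $\mathcal K$ and $X\in{\bf D}_{f,rad}^m(\mathcal K)$. A map $G:{\bf D}_{f,rad}^m(\mathcal H)\to B(\mathcal E)\otimes_{min}B(\mathcal H)$ is self-adjoint free pluriharmonic if $G=\Re F=\frac12(F+F^* )$ for a free holomorphic $F$; a free pluriharmonic function is a linear combination of self-adjoint ones. It has a unique norm-convergent representation $G(X)=\sum_{k\ge1}\sum_{|\alpha|=k}B_{(\alpha)}\otimes X_\alpha^*+\sum_{k\ge0}\sum_{|\alpha|=k}A_{(\alpha)}\otimes X_\alpha$, by which it is evaluated on ${\bf D}_{f,rad}^m(\mathcal K)$ for any $\mathcal K$; $G(rW)$ is its value at $rW$. $Har_{\mathcal E}({\bf D}_{f,rad}^m)$ is the set of all free pluriharmonic functions $F:{\bf D}_{f,rad}^m(\mathcal H)\to B(\mathcal E)\otimes_{min}B(\mathcal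 H)$. For $0<r<1$, $d_r(F,G):=\|F(rW)-G(rW)\|$. Fix an increasing sequence $\{r_k\}_{k\ge1}\subset(0,1)$ converging to $1$ and put $$\rho(F,G):=\sum_{k=1}^\infty\Big(\frac12\Big)^k\frac{d_{r_k}(F,G)}{1+d_{r_k}(F,G)}.$$ *)

(* Defs.v *)
From HB Require Import structures.
From mathcomp Require Import all_boot all_order all_algebra.
From mathcomp Require Import complex.
From mathcomp Require Import boolp classical_sets functions reals ereal.
From mathcomp Require Import topology normedtype sequences exp.
From mathcomp Require Import ring lra.
Set Implicit Arguments.
Unset Strict Implicit.
Unset Printing Implicit Defensive.
Import Order.TTheory GRing.Theory Num.Theory numFieldNormedType.Exports.
Import ComplexField Normc.
Local Open Scope classical_set_scope.
Local Open Scope complex_scope.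
Local Open Scope ring_scope.

Definition ipnorm (R : realType) (V : Type) (ip : V -> V -> R[i]) (x : V) : R :=
  Num.sqrt (complex.Re (ip x x)).

(* Complex Hilbert spaces.  [inner] is linear in the first variable, and the
   norm takes its values in R; completeness is sequential. *)
HB.mixin Record isHilbert (R : realType) V of GRing.Lmodule R[i] V := {
  inner : V -> V -> R[i];
  inner_linearl : forall a x y z, inner (a *: x + y) z = a * inner x z + inner y z;
  innerC : forall x y, inner y x = (inner x y)^*;
  inner_gt0 : forall x, x != 0 -> 0 < inner x x;
  hilbert_complete : forall u : nat -> V,
    (forall e : R, 0 < e -> exists N, forall i j,
       (N <= i)%N -> (N <= j)%N -> ipnorm inner (u i - u j) < e) ->
    exists l, ipnorm inner (u k - l) @[k --> \oo] --> (0 : R)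
}.

#[short(type="hilbertType")]
HB.structure Definition Hilbert (R : realType) :=
  {V of GRing.Lmodule R[i] V & isHilbert R V}.

Section null.
Context (R : realType).
Implicit Types x y : nat -> R.

Definition null x := forall e : R, 0 < e -> exists N, forall k, (N <= k)%N -> x k < e.

Lemma null_cvg x : (forall k, 0 <= x k) -> null x -> x k @[k --> \oo] --> (0 : R).
Proof.
move=> x0 nx; apply/cvgrPdist_lt => e /nx[N hN].
by exists N => // k Nk /=; rewrite sub0r normrN ger0_norm// hN.
Qed.

Lemma cvg_null x : x k @[k --> \oo] --> (0 : R) -> null x.
Proof.
move=> /cvgrPdist_lt cx e /cx[N _ hN]; exists N => k Nk.
by have /= := hN k Nk; rewrite sub0r normrN; apply: le_lt_trans; exact: ler_norm.
Qed.

Lemma null_le x y : (forall k, x k <= y k) -> null y -> null x.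
Proof.
by move=> xy ny e /ny[N hN]; exists N => k /hN; apply: le_lt_trans.
Qed.

Lemma nullD x y : null x -> null y -> null (fun k => x k + y k).
Proof.
move=> nx ny e e0; have e20 : 0 < e / 2 by lra.
have [N hN] := nx _ e20; have [M hM] := ny _ e20.
exists (maxn N M) => k; rewrite geq_max => /andP[/hN ? /hM ?]; lra.
Qed.

Lemma nullM c x : 0 <= c -> null x -> null (fun k => c * x k).
Proof.
rewrite le_eqVlt => /predU1P[<- _ e e0|c0 nx e e0].
  by exists 0%N => k _; rewrite mul0r.
have [|N hN] := nx (e / c); first by rewrite divr_gt0.
by exists N => k /hN; rewrite ltr_pdivlMr// mulrC.
Qed.

Lemma null0 : null (fun=> 0).
Proof. by move=> e e0; exists 0%N. Qed.

Lemma null_cst c : null (fun=> c) -> c <= 0.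
Proof.
move=> nc; rewrite leNgt; apply/negP => /nc[N /(_ N (leqnn _))].
by rewrite ltxx.
Qed.

Definition ccvg (z : nat -> R[i]) l := null (fun k => normc (z k - l)).

Lemma normc_ge0 (z : R[i]) : 0 <= normc z.
Proof. by case: z => a b; rewrite sqrtr_ge0. Qed.

Lemma normcB (x y : R[i]) : normc (x - y) = normc (y - x).
Proof. by rewrite -normcN opprB. Qed.

Lemma normc_conj (x : R[i]) : normc x^* = normc x.
Proof. by case: x => a b /=; rewrite sqrrN. Qed.

Lemma normcC (r : R) : normc r%:C = `|r|.
Proof. by rewrite /= expr0n /= addr0 sqrtr_sqr. Qed.

Lemma rcM (x y : R) : (x * y)%:C = x%:C * y%:C.
Proof. exact: rmorphM. Qed.

Lemma rcD (x y : R) : (x + y)%:C = x%:C + y%:C.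
Proof. exact: rmorphD. Qed.

Lemma Re_le_normc (z : R[i]) : `|complex.Re z| <= normc z.
Proof.
case: z => a b /=; rewrite -sqrtr_sqr ler_wsqrtr//.
by rewrite lerDl sqr_ge0.
Qed.

Lemma Im_le_normc (z : R[i]) : `|complex.Im z| <= normc z.
Proof.
case: z => a b /=; rewrite -sqrtr_sqr ler_wsqrtr//.
by rewrite lerDr sqr_ge0.
Qed.

Lemma normc_le_ReIm (z : R[i]) : normc z <= `|complex.Re z| + `|complex.Im z|.
Proof.
case: z => a b /=; rewrite -(@ger0_norm _ (`|a| + `|b|)) ?addr_ge0//.
rewrite -sqrtr_sqr ler_wsqrtr// sqrrD !real_normK ?num_real//.
by rewrite addrAC lerDl mulrn_wge0// mulr_ge0.
Qed.

Lemma ccvg_uniq z l l' : ccvg z l -> ccvg z l' -> l = l'.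
Proof.
move=> h h'; have := nullD h h'.
have /null_le/[apply] : forall k,
    normc (l - l') <= normc (z k - l) + normc (z k - l').
  move=> k; rewrite [normc (z k - l)]normcB.
  by apply: le_trans (le_normcD _ _); rewrite addrA subrK.
move=> /null_cst le0; apply/eqP; rewrite -subr_eq0; apply/eqP/eq0_normc.
by apply/eqP; rewrite eq_le le0 normc_ge0.
Qed.

Lemma ccvg_lin a z w l l' : ccvg z l -> ccvg w l' ->
  ccvg (fun k => a * z k + w k) (a * l + l').
Proof.
move=> hz hw; apply: null_le (nullD (nullM (normc_ge0 a) hz) hw) => k.
rewrite -normcM; apply: le_trans (le_normcD _ _).
by rewrite le_eqVlt; apply/orP; left; apply/eqP; congr normc; ring.
Qed.

Lemma ccvgJ z l : ccvg z l -> ccvg (fun k => (z k)^*) l^*.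
Proof.
by apply: null_le => k; rewrite -rmorphB normc_conj.
Qed.

Lemma ccvg_ge0 z l : ccvg z l -> (forall k, 0 <= z k) -> 0 <= l.
Proof.
move=> h z0; rewrite lecE /=; apply/andP; split.
- rewrite -normr_le0; apply: (@null_cst `|complex.Im l|).
  apply: null_le h => k.
  apply: le_trans (Im_le_normc _); have := z0 k; case: (z k) => a b.
  rewrite lecE/= => /andP[/eqP -> _].
  by case: (l) => c d /=; rewrite sub0r normrN.
- rewrite -oppr_le0; apply: (@null_cst (- complex.Re l)).
  apply: null_le h => k.
  apply: le_trans (Re_le_normc _); have := z0 k; case: (z k) => a b.
  rewrite lecE/= => /andP[_ ?].
  case: (l) => c d /=; apply: le_trans (ler_norm _); lra.
Qed.

Lemma rcauchy (x : nat -> R) :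
  (forall e : R, 0 < e -> exists N, forall i j,
       (N <= i)%N -> (N <= j)%N -> `|x i - x j| < e) ->
  exists l, null (fun k => `|x k - l|).
Proof.
move=> cx; have /cvg_ex[/= l hl] : cvgn x.
  apply: cauchy_cvg; apply/cauchy_ballP => e e0.
  have [N hN] := cx e e0.
  pose A : set R := [set y | exists2 k, (N <= k)%N & y = x k].
  exists (A, A) => /=; first by split; exists N => // k Nk; exists k.
  by move=> [_ _] /= [[i Ni ->] [j Nj ->]]; exact: hN.
exists l => e e0; move/cvgrPdist_lt : hl => /(_ e e0)[N _ hN].
by exists N => k Nk; rewrite distrC; exact: hN.
Qed.

Lemma ccauchy (z : nat -> R[i]) :
  (forall e : R, 0 < e -> exists N, forall i j,
       (N <= i)%N -> (N <= j)%N -> normc (z i - z j) < e) ->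
  exists l, ccvg z l.
Proof.
move=> cz.
have [a ha] : exists l, null (fun k => `|complex.Re (z k) - l|).
  apply: rcauchy => e /cz[N hN]; exists N => i j Ni Nj.
  apply: le_lt_trans (hN i j Ni Nj); apply: le_trans (Re_le_normc _).
  by case: (z i) => ? ?; case: (z j).
have [b hb] : exists l, null (fun k => `|complex.Im (z k) - l|).
  apply: rcauchy => e /cz[N hN]; exists N => i j Ni Nj.
  apply: le_lt_trans (hN i j Ni Nj); apply: le_trans (Im_le_normc _).
  by case: (z i) => ? ?; case: (z j).
exists (a +i* b); apply: null_le (nullD ha hb) => k.
apply: le_trans (normc_le_ReIm _) _.
by case: (z k).
Qed.

End null.

Section semi_inner.
Context (R : realType) (T : Type) (s : T -> T -> R[i]).
Context (add : T -> T -> T) (scl : R[i] -> T -> T).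
Hypothesis sD : forall u v w, s (add u v) w = s u w + s v w.
Hypothesis sZ : forall c u w, s (scl c u) w = c * s u w.
Hypothesis sC : forall u v, s v u = (s u v)^*.
Hypothesis s_ge0 : forall u, 0 <= s u u.

Let sDr u v w : s w (add u v) = s w u + s w v.
Proof. by rewrite sC sD rmorphD/= -!sC. Qed.

Let sZr c u w : s w (scl c u) = c^* * s w u.
Proof. by rewrite sC sZ rmorphM/= -!sC. Qed.

Let expand u v t : s (add u (scl t v)) (add u (scl t v)) =
  s u u + t^* * s u v + t * (s u v)^* + t * t^* * s v v.
Proof. by rewrite !(sD, sDr, sZ, sZr) -(sC u v); ring. Qed.

Lemma semi_CS2 u v : s u v * (s u v)^* <= s u u * s v v.
Proof.
have vv0 := s_ge0 v; have uu0 := s_ge0 u.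
have [v0|v0] := eqVneq (s v v) 0.
  rewrite v0 mulr0 -normCK.
  have [->//|nz] := eqVneq (`|s u v| ^+ 2) 0.
  have p0 : 0 < `|s u v| ^+ 2 by rewrite lt_def nz exprn_ge0.
  pose t := (s u u + 1) / `|s u v| ^+ 2.
  have t0 : 0 <= t by rewrite divr_ge0// ?addr_ge0// ltW.
  have := s_ge0 (add u (scl (- t * s u v) v)).
  rewrite expand v0 mulr0 addr0 rmorphM rmorphN/= (geC0_conj t0).
  have -> : s u u + - t * (s u v)^* * s u v + - t * s u v * (s u v)^* =
     s u u - (t * `|s u v| ^+ 2) *+ 2 by rewrite normCK; ring.
  rewrite divfK// subr_ge0 mulr2n -subr_ge0.
  have -> : s u u - (s u u + 1 + (s u u + 1)) = - (s u u + 2) by ring.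
  rewrite oppr_ge0 => h; exfalso; move: (lt_le_trans (ltr_wpDl uu0 (ltr0Sn _ 1)) h).
  by rewrite ltxx.
have vgt0 : 0 < s v v by rewrite lt_def v0.
have := s_ge0 (add u (scl (- (s u v / s v v)) v)).
have vvr : (s v v)^* = s v v by rewrite -sC.
rewrite expand rmorphN rmorphM/= fmorphV/= vvr => /(mulr_ge0 vv0) h.
rewrite -subr_ge0; apply: le_trans h _.
by rewrite le_eqVlt; apply/orP; left; apply/eqP; field.
Qed.

Lemma ipnorm_ge0 u : 0 <= ipnorm s u.
Proof. exact: sqrtr_ge0. Qed.

Lemma ipnorm_sqr u : (ipnorm s u ^+ 2)%:C = s u u.
Proof.
have := s_ge0 u; rewrite lecE /= => /andP[/eqP im0 re0].
by rewrite sqr_sqrtr//; case: (s u u) im0 => a b /= ->.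
Qed.

Lemma semi_CS u v : normc (s u v) <= ipnorm s u * ipnorm s v.
Proof.
rewrite -(@ler_pXn2r _ 2)// ?nnegrE ?normc_ge0 ?mulr_ge0 ?ipnorm_ge0//.
rewrite -lecR exprMn [leRHS]rcM !ipnorm_sqr.
by apply: le_trans (semi_CS2 u v); rewrite -normCK rmorphXn.
Qed.

Lemma ipnormD u v : ipnorm s (add u v) <= ipnorm s u + ipnorm s v.
Proof.
rewrite -(@ler_pXn2r _ 2)// ?nnegrE ?ipnorm_ge0 ?addr_ge0 ?ipnorm_ge0//.
rewrite sqrrD.
have e : ipnorm s (add u v) ^+ 2 =
    ipnorm s u ^+ 2 + ipnorm s v ^+ 2 + complex.Re (s u v) *+ 2.
  apply: (@complexI R); rewrite !rcD !ipnorm_sqr sD !sDr.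
  rewrite [s v u]sC -!addrA; congr (_ + _).
  rewrite addrA addrC; congr (_ + _).
  by case: (s u v) => a b /=; apply/eqP; rewrite eq_complex/=; apply/andP; split; apply/eqP; ring.
rewrite e addrAC lerD2r lerD2l lerMn2r/=.
by apply: le_trans (ler_norm _) (le_trans (Re_le_normc _) (semi_CS _ _)).
Qed.

Lemma ipnormZ c u : ipnorm s (scl c u) = normc c * ipnorm s u.
Proof.
apply/eqP; rewrite -(@eqrXn2 _ 2)// ?mulr_ge0 ?normc_ge0 ?ipnorm_ge0//.
apply/eqP/(@complexI R); rewrite exprMn [RHS]rcM !ipnorm_sqr sZ sZr.
by rewrite mulrA -normCK rmorphXn.
Qed.

End semi_inner.

(* Positive semidefinite kernels k on I, and the Hilbert space with a total
   family (k_p)_{p : I} such that <k_p, k_q> = k p q.  It is the completion of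
   the formal combinations seq (R[i] * I); a vector x is represented by the
   function p |-> <x, k_p>, which determines it, so that no quotient is needed. *)
Record pdkernel (R : realType) (I : Type) := PDKernel {
  kernel_fun :> I -> I -> R[i];
  kernelC : forall p q, kernel_fun q p = (kernel_fun p q)^*;
  kernel_ge0 : forall u : seq (R[i] * I),
    0 <= \sum_(a <- u) \sum_(b <- u) a.1 * b.1^* * kernel_fun a.2 b.2
}.

Section kernel_space.
Context (R : realType) (I : Type) (k : pdkernel R I).
Implicit Types u v w : seq (R[i] * I).

Definition kform u v : R[i] :=
  \sum_(a <- u) \sum_(b <- v) a.1 * b.1^* * k a.2 b.2.
Definition kscale (c : R[i]) u := [seq (c * a.1, a.2) | a <- u].
Local Notation nrm := (ipnorm kform).

Let kD u v w : kform (u ++ v) w = kform u w + kform v w.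
Proof. by rewrite /kform big_cat. Qed.

Let kZ c u w : kform (kscale c u) w = c * kform u w.
Proof.
rewrite /kform big_map mulr_sumr; apply: eq_bigr => a _.
by rewrite mulr_sumr; apply: eq_bigr => b _ /=; rewrite !mulrA.
Qed.

Let kC u v : kform v u = (kform u v)^*.
Proof.
rewrite /kform rmorph_sum/= exchange_big; apply: eq_bigr => a _.
rewrite rmorph_sum/=; apply: eq_bigr => b _.
by rewrite !rmorphM/= conjCK -kernelC [b.1 * _]mulrC.
Qed.

Let k0 u : 0 <= kform u u. Proof. exact: kernel_ge0. Qed.

Let kDr u v w : kform w (u ++ v) = kform w u + kform w v.
Proof. by rewrite kC kD rmorphD/= -!kC. Qed.

Let kZr c u w : kform w (kscale c u) = c^* * kform w u.
Proof. by rewrite kC kZ rmorphM/= -!kC. Qed.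

Let CS := semi_CS kD kZ kC k0.
Let nD := ipnormD kD kZ kC k0.
Let nZ := ipnormZ kZ kC k0.
Let n0 := ipnorm_ge0 kform.
Let nsq := ipnorm_sqr k0.
Let sub u v := u ++ kscale (-1) v.

Let kB u v w : kform (sub u v) w = kform u w - kform v w.
Proof. by rewrite kD kZ mulN1r. Qed.
Let kBr u v w : kform w (sub u v) = kform w u - kform w v.
Proof. by rewrite kDr kZr rmorphN rmorph1 mulN1r. Qed.

Definition kcauchy (u : nat -> seq (R[i] * I)) := forall e : R, 0 < e ->
  exists N, forall i j, (N <= i)%N -> (N <= j)%N -> nrm (sub (u i) (u j)) < e.

Definition kpt (p : I) : seq (R[i] * I) := [:: (1, p)].

Definition krep (u : nat -> seq (R[i] * I)) (phi : I -> R[i]) :=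
  kcauchy u /\ forall p, ccvg (fun n => kform (u n) (kpt p)) (phi p).

Let krep_lin a (u v : nat -> seq (R[i] * I)) phi psi : krep u phi -> krep v psi ->
  krep (fun n => kscale a (u n) ++ v n) (a *: phi + psi).
Proof.
move=> [cu hu] [cv hv]; split; last first.
  move=> p; rewrite (_ : (fun n => _) = fun n => a * kform (u n) (kpt p) + kform (v n) (kpt p)).
    exact: ccvg_lin.
  by apply/funext => n; rewrite kD kZ.
move=> e e0.
have [N hN] := cu (e / (2 * (1 + normc a))) ltac:(by rewrite divr_gt0// mulr_gt0// ltr_pwDl// normc_ge0).
have [M hM] := cv (e / 2) ltac:(lra).
exists (maxn N M) => i j; rewrite !geq_max => /andP[Ni Mi] /andP[Nj Mj].
have : nrm (sub (kscale a (u i) ++ v i) (kscale a (u j) ++ v j)) <=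
   normc a * nrm (sub (u i) (u j)) + nrm (sub (v i) (v j)).
  rewrite -nZ; apply: le_trans _ (nD _ _); rewrite le_eqVlt; apply/orP; left.
  apply/eqP; rewrite /ipnorm; do 2 congr (_ _).
  by rewrite !(kB, kBr, kD, kDr, kZ, kZr); ring.
move=> /le_lt_trans; apply.
have := hN _ _ Ni Nj; have := hM _ _ Mi Mj.
set x := nrm _; set y := nrm _ => hx.
rewrite ltr_pdivlMr ?mulr_gt0// ?ltr_pwDl ?normc_ge0// => hy.
have := n0 (sub (u i) (u j)); rewrite -/y => y0.
have := normc_ge0 a; move: hy; set c := normc a; nra.
Qed.

Let kcauchy_bounded (u : nat -> seq (R[i] * I)) : kcauchy u -> exists2 M, 0 < M & exists N, forall n, (N <= n)%N -> nrm (u n) <= M.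
Proof.
move=> /(_ 1 ltr01)[N hN]; exists (1 + nrm (u N)).
  by rewrite ltr_pwDl.
exists N => n Nn; apply: le_trans (lerD (ltW (hN n N Nn (leqnn _))) (lexx _)).
apply: le_trans _ (nD _ _); rewrite le_eqVlt; apply/orP; left; apply/eqP.
rewrite /ipnorm; do 2 congr (_ _).
by rewrite !(kB, kBr, kD, kDr); ring.
Qed.

Let kform_null (w : nat -> seq (R[i] * I)) : (forall p, null (fun n => normc (kform (w n) (kpt p)))) ->
  forall v, null (fun n => normc (kform (w n) v)).
Proof.
move=> h; elim=> [|[c p] v IH].
  move=> e e0; exists 0%N => n _.
  by rewrite /kform big1 ?normc0// => a _; rewrite big_nil.
apply: null_le (nullD (nullM (normc_ge0 c) (h p)) IH) => n.
have -> : (c, p) :: v = kscale c (kpt p) ++ v by rewrite /kscale/= mulr1.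
rewrite kDr kZr; apply: le_trans (le_normcD _ _) _.
by rewrite normcM normc_conj.
Qed.

Let kcauchy_weak (w : nat -> seq (R[i] * I)) : kcauchy w ->
  (forall p, null (fun n => normc (kform (w n) (kpt p)))) -> null (fun n => nrm (w n)).
Proof.
move=> cw hw e e0.
have [M M0 [N hN]] := kcauchy_bounded cw.
have e2 : 0 < e ^+ 2 / 2 by rewrite divr_gt0// exprn_gt0.
have [N1 hN1] := cw _ (divr_gt0 e2 M0).
pose L := maxn N N1.
have [N2 hN2] := kform_null hw (w L) e2.
exists (maxn L N2) => n; rewrite geq_max => /andP[Ln N2n].
have [Nn N1n] : (N <= n)%N /\ (N1 <= n)%N.
  by split; apply: leq_trans Ln; rewrite /L ?leq_maxl ?leq_maxr.
rewrite -(@ltr_pXn2r _ 2)// ?nnegrE ?n0 ?ltW//.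
have : nrm (w n) ^+ 2 <= M * nrm (sub (w n) (w L)) + normc (kform (w n) (w L)).
  have -> : nrm (w n) ^+ 2 = normc (kform (w n) (w n)).
    by rewrite -nsq normcC ger0_norm ?exprn_ge0.
  have -> : kform (w n) (w n) = kform (w n) (sub (w n) (w L)) + kform (w n) (w L).
    by rewrite kBr subrK.
  apply: le_trans (le_normcD _ _) _; rewrite lerD2r.
  by apply: le_trans (CS _ _) _; rewrite ler_wpM2r// hN.
have := hN2 n N2n; have := hN1 n L N1n (leq_maxr _ _).
rewrite ltr_pdivlMr// => h1 h2 h3; apply: le_lt_trans h3 _.
rewrite mulrC in h1; set x := _ * _ in h1 *; move: h1 h2; set y := normc _; lra.
Qed.

Let krep_sub (u u' : nat -> seq (R[i] * I)) phi : krep u phi -> krep u' phi ->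
  null (fun n => nrm (sub (u n) (u' n))).
Proof.
move=> ru ru'; apply: kcauchy_weak.
  have [c _] := krep_lin (-1) ru' ru.
  move=> e /c[N hN]; exists N => i j Ni Nj; apply: le_lt_trans (hN i j Ni Nj).
  rewrite le_eqVlt; apply/orP; left; apply/eqP.
  rewrite /ipnorm; do 2 congr (_ _).
  by rewrite !(kB, kBr, kD, kDr, kZ, kZr) rmorphN rmorph1; ring.
move=> p; have := nullD (ru.2 p) (ru'.2 p); apply: null_le => n.
rewrite kB [normc (kform (u' n) _ - _)]normcB.
by apply: le_trans (le_normcD _ _); rewrite addrA subrK.
Qed.

Let kip_diff u u' v v' : normc (kform u v - kform u' v') <=
  nrm (sub u u') * nrm v + nrm u' * nrm (sub v v').
Proof.
have -> : kform u v - kform u' v' = kform (sub u u') v + kform u' (sub v v').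
  by rewrite kB kBr addrA subrK.
by apply: le_trans (le_normcD _ _) (lerD (CS _ _) (CS _ _)).
Qed.

Let kip_cvg (u v : nat -> seq (R[i] * I)) : kcauchy u -> kcauchy v -> exists l, ccvg (fun n => kform (u n) (v n)) l.
Proof.
move=> cu cv; apply: ccauchy => e e0.
have [M M0 [N hN]] := kcauchy_bounded cu.
have [M' M'0 [N' hN']] := kcauchy_bounded cv.
have [N1 hN1] := cu (e / 2 / M') ltac:(by rewrite !divr_gt0).
have [N2 hN2] := cv (e / 2 / M) ltac:(by rewrite !divr_gt0).
exists (maxn (maxn N N') (maxn N1 N2)) => i j.
rewrite !geq_max => /andP[/andP[? ?] /andP[? ?]] /andP[/andP[? ?] /andP[? ?]].
apply: le_lt_trans (kip_diff _ _ _ _) _.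
rewrite [ltRHS]splitr; apply: ltrD.
  apply: le_lt_trans (ler_wpM2l (n0 _) (hN' i _)) _ => //.
  by rewrite -ltr_pdivlMr// hN1.
apply: le_lt_trans (ler_wpM2r (n0 _) (hN j _)) _ => //.
by rewrite mulrC -ltr_pdivlMr// hN2.
Qed.

Let kip_uniq (u u' v v' : nat -> seq (R[i] * I)) phi psi l : krep u phi -> krep u' phi -> krep v psi -> krep v' psi ->
  ccvg (fun n => kform (u n) (v n)) l -> ccvg (fun n => kform (u' n) (v' n)) l.
Proof.
move=> ru ru' rv rv' hl.
have [M M0 [N hN]] := kcauchy_bounded rv.1.
have [M' M'0 [N' hN']] := kcauchy_bounded ru'.1.
have h := nullD (nullD (nullM (ltW M0) (krep_sub ru ru'))
   (nullM (ltW M'0) (krep_sub rv rv'))) hl.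
move=> e /h[N2 hN2]; exists (maxn N2 (maxn N N')) => n.
rewrite !geq_max => /andP[? /andP[? ?]]; apply: le_lt_trans (hN2 n _) => //.
have -> : kform (u' n) (v' n) - l = (kform (u' n) (v' n) - kform (u n) (v n)) + (kform (u n) (v n) - l).
  by rewrite addrA subrK.
apply: le_trans (le_normcD _ _) _; rewrite lerD2r normcB.
apply: le_trans (kip_diff _ _ _ _) _; apply: lerD.
  by rewrite mulrC ler_wpM2r// hN.
by rewrite ler_wpM2r// hN'.
Qed.


Definition kpred : {pred I -> R[i]} := fun phi => `[<exists u : nat -> seq (R[i] * I), krep u phi>].

Record kspace := KSpace { kval :> I -> R[i]; kvalP : kval \in kpred }.

Implicit Types x y z : kspace.

HB.instance Definition _ := [isSub for kval].
HB.instance Definition _ := [Choice of kspace by <:].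

Let krep0 : krep (fun=> [::]) 0.
Proof.
split=> [e e0|p e e0]; exists 0%N => *.
  by rewrite /ipnorm /kform big_nil sqrtr0.
by rewrite /kform big_nil subrr normc0.
Qed.

Let kpred_submod : submod_closed kpred.
Proof.
split; first by apply/asboolP; exists (fun=> [::]).
move=> a phi psi /asboolP[u ru] /asboolP[v rv]; apply/asboolP.
by eexists; apply: krep_lin ru rv.
Qed.

HB.instance Definition _ := GRing.isSubmodClosed.Build _ _ kpred kpred_submod.
HB.instance Definition _ := [SubChoice_isSubLmodule of kspace by <:].

Let krep_ex (x : kspace) : {u : nat -> seq (R[i] * I) | krep u x}.
Proof. by apply: cid; exact/asboolP/(kvalP x). Qed.

Definition krepr (x : kspace) := projT1 (krep_ex x).

Let kreprP x : krep (krepr x) x.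
Proof. exact: projT2 (krep_ex x). Qed.

Definition kinner (x y : kspace) : R[i] :=
  projT1 (cid (kip_cvg (kreprP x).1 (kreprP y).1)).

Lemma kinner_cvg x y (u v : nat -> seq (R[i] * I)) : krep u x -> krep v y ->
  ccvg (fun n => kform (u n) (v n)) (kinner x y).
Proof.
move=> ru rv; apply: kip_uniq (kreprP x) ru (kreprP y) rv _.
exact: projT2 (cid (kip_cvg (kreprP x).1 (kreprP y).1)).
Qed.

Let kspaceP (x y : kspace) : (forall p, x p = y p) -> x = y.
Proof. by move=> h; apply/val_inj/funext. Qed.

Let kinner_linearl a x y z : kinner (a *: x + y) z = a * kinner x z + kinner y z.
Proof.
have r := krep_lin a (kreprP x) (kreprP y).
have := kinner_cvg (x := a *: x + y) r (kreprP z).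
have := ccvg_lin a (kinner_cvg (kreprP x) (kreprP z)) (kinner_cvg (kreprP y) (kreprP z)).
under eq_fun do rewrite -kZ -kD.
by move=> h1 h2; apply: ccvg_uniq h2 h1.
Qed.

Let kinnerC x y : kinner y x = (kinner x y)^*.
Proof.
have := ccvgJ (kinner_cvg (kreprP x) (kreprP y)).
under eq_fun do rewrite -kC.
by move=> h; apply: ccvg_uniq (kinner_cvg (kreprP y) (kreprP x)) h.
Qed.

Let kinner_ge0 x : 0 <= kinner x x.
Proof. by apply: ccvg_ge0 (kinner_cvg (kreprP x) (kreprP x)) _. Qed.

Let kinner_gt0 x : x != 0 -> 0 < kinner x x.
Proof.
rewrite lt_def kinner_ge0 andbT; apply: contra => /eqP x0.
apply/eqP/kspaceP => p; have [_ /(_ p) h] := kreprP x.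
apply: (ccvg_uniq h).
have := kinner_cvg (kreprP x) (kreprP x); rewrite x0 => n_0 e e0.
pose c := nrm (kpt p) + 1.
have c0 : 0 < c by rewrite ltr_pwDr.
have [|N hN] := n_0 ((e / c) ^+ 2); first by rewrite exprn_gt0// divr_gt0.
exists N => n /hN; rewrite !subr0 => hn.
apply: le_lt_trans (CS _ _) _.
have h1 : nrm (krepr x n) < e / c.
  rewrite -(@ltr_pXn2r _ 2)// ?nnegrE ?n0// ?divr_ge0 ?ltW//.
  by apply: le_lt_trans hn; rewrite -nsq normcC ler_norm.
apply: le_lt_trans (_ : _ <= nrm (krepr x n) * c) _.
  by rewrite ler_wpM2l// lerDl.
by rewrite -ltr_pdivlMr.
Qed.

Let knrm := ipnorm kinner.

Let kemb_subproof (u : seq (R[i] * I)) : (fun p => kform u (kpt p)) \in kpred.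
Proof.
apply/asboolP; exists (fun=> u); split=> [e e0|p].
  exists 0%N => i j _ _.
  suff -> : nrm (sub u u) = 0 by [].
  by rewrite /ipnorm kB subrr sqrtr0.
by apply: null_le (@null0 R) => n; rewrite subrr normc0.
Qed.

Definition kemb (u : seq (R[i] * I)) : kspace := KSpace (kemb_subproof u).

Let krep_emb u : krep (fun=> u) (kemb u).
Proof.
split=> [e e0|p].
  exists 0%N => i j _ _.
  suff -> : nrm (sub u u) = 0 by [].
  by rewrite /ipnorm kB subrr sqrtr0.
by apply: null_le (@null0 R) => n; rewrite subrr normc0.
Qed.

Lemma inner_kemb u v : kinner (kemb u) (kemb v) = kform u v.
Proof.
apply: ccvg_uniq (kinner_cvg (krep_emb u) (krep_emb v)) _.
by apply: null_le (@null0 R) => n; rewrite subrr normc0.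
Qed.

Let knrmD x y : knrm (x + y) <= knrm x + knrm y.
Proof.
apply: (@ipnormD R _ kinner +%R *:%R _ _ kinnerC kinner_ge0).
- by move=> a b c; rewrite -[a in LHS]scale1r kinner_linearl mul1r.
- move=> c a b; rewrite -[_ *: _]addr0 kinner_linearl -[RHS]addr0; congr (_ + _).
  by have /(canLR (addrK _)) := kinner_linearl 1 0 0 b; rewrite scale1r addr0 mul1r subrr.
Qed.

Let knrmN x : knrm (- x) = knrm x.
Proof.
have kN a b : kinner (- a) b = - kinner a b.
  have k0b : kinner 0 b = 0.
    by have /(canLR (addrK _)) := kinner_linearl 1 0 0 b; rewrite scale1r addr0 mul1r subrr.
  by rewrite -[- a]addr0 -scaleN1r kinner_linearl k0b addr0 mulN1r.
by rewrite /knrm /ipnorm kN kinnerC kN rmorphN/= -kinnerC opprK.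
Qed.

Let knrm_le (x : kspace) (w : nat -> seq (R[i] * I)) c : 0 <= c -> krep w x ->
  (exists N, forall n, (N <= n)%N -> nrm (w n) <= c) -> knrm x <= c.
Proof.
move=> c0 rw [N hN].
rewrite -(@ler_pXn2r _ 2)// ?nnegrE ?ipnorm_ge0// leNgt; apply/negP => ltc.
have [|M hM] := kinner_cvg rw rw (e := knrm x ^+ 2 - c ^+ 2).
  by rewrite subr_gt0.
have := hM (maxn N M) (leq_maxr _ _).
rewrite -nsq -(ipnorm_sqr kinner_ge0) -rmorphB normcC.
apply/negP; rewrite -leNgt distrC.
apply: le_trans _ (ler_norm _); rewrite lerD2l lerN2 ler_pXn2r// ?nnegrE ?n0//.
exact: hN (leq_maxl _ _).
Qed.

Let kemb_lin a u v : kemb (kscale a u ++ v) = a *: kemb u + kemb v.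
Proof. by apply: kspaceP => p /=; rewrite kD kZ. Qed.

Lemma kemb_sum u : kemb u = \sum_(a <- u) a.1 *: kemb (kpt a.2).
Proof.
elim: u => [|[c p] u IH].
  by rewrite big_nil; apply: kspaceP => p; rewrite /= /kform big_nil.
rewrite big_cons -IH -kemb_lin; congr kemb.
by rewrite /kscale/= mulr1.
Qed.

Let knrm_sub_emb (x : kspace) (u : nat -> seq (R[i] * I)) : krep u x ->
  forall e : R, 0 < e -> exists N, forall n, (N <= n)%N -> knrm (x - kemb (u n)) < e.
Proof.
move=> ru e e0.
have e20 : 0 < e / 2 by lra.
have [N hN] := ru.1 _ e20; exists N => n Nn.
apply: (@le_lt_trans _ _ (e / 2)); last by lra.
have := krep_lin (-1) (krep_emb (u n)) ru.
rewrite scaleN1r addrC => r.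
apply: (@knrm_le (x - kemb (u n)) _ _ (ltW e20) r); exists N => j Nj.
rewrite ltW//; apply: le_lt_trans (hN j n Nj Nn).
rewrite le_eqVlt; apply/orP; left; apply/eqP.
rewrite /ipnorm; do 2 congr (_ _).
by rewrite !(kB, kBr, kD, kDr, kZ, kZr) rmorphN rmorph1; ring.
Qed.

Lemma kemb_dense (x : kspace) (e : R) : 0 < e ->
  exists u : seq (R[i] * I),
    ipnorm kinner (x - \sum_(a <- u) a.1 *: kemb (kpt a.2)) < e.
Proof.
move=> e0; have [u ru] := krep_ex x.
have [N /(_ N (leqnn _))] := knrm_sub_emb ru e0; exists (u N).
by rewrite -kemb_sum.
Qed.

Let kcomplete (x : nat -> kspace) :
    (forall e : R, 0 < e -> exists N, forall i j,
       (N <= i)%N -> (N <= j)%N -> ipnorm kinner (x i - x j) < e) ->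
    exists l, ipnorm kinner (x n - l) @[n --> \oo] --> (0 : R).
Proof.
move=> cx.
have /choice[v hv] : forall n : nat, exists u, knrm (x n - kemb u) < n.+1%:R^-1.
  move=> n; have [//|u] := @kemb_dense (x n) n.+1%:R^-1.
  by rewrite -kemb_sum => hu; exists u.
have inv_small (e : R) : 0 < e -> exists N, forall n, (N <= n)%N -> knrm (x n - kemb (v n)) < e.
  move=> e0; have [N _ hN] := near_infty_natSinv_lt (PosNum e0).
  by exists N => n Nn; apply: lt_trans (hv n) (hN n Nn).
have cv : kcauchy v.
  move=> e e0; have e30 : 0 < e / 3 by lra.
  have [N hN] := cx _ e30; have [M hM] := inv_small _ e30.
  exists (maxn N M) => i j; rewrite !geq_max => /andP[Ni Mi] /andP[Nj Mj].
  rewrite -[X in X < _]/(ipnorm kform _).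
  have -> : nrm (sub (v i) (v j)) = knrm (kemb (v i) - kemb (v j)).
    rewrite /knrm /ipnorm -inner_kemb; do 2 congr (_ _).
    suff -> : kemb (sub (v i) (v j)) = kemb (v i) - kemb (v j) by [].
    by apply: kspaceP => p /=; rewrite kB.
  have -> : kemb (v i) - kemb (v j) =
      - (x i - kemb (v i)) + ((x i - x j) + (x j - kemb (v j))).
    by rewrite opprB addrA subrKA addrA subrK.
  apply: le_lt_trans (knrmD _ _) _; rewrite knrmN.
  apply: le_lt_trans (lerD (lexx _) (knrmD _ _)) _.
  by have := hM i Mi; have := hM j Mj; have := hN i j Ni Nj; rewrite /knrm; lra.
have /choice[phi hphi] : forall p, exists l, ccvg (fun n => kform (v n) (kpt p)) l.
  move=> p; apply: ccauchy => e e0.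
  pose c := nrm (kpt p) + 1.
  have c0 : 0 < c by rewrite ltr_pwDr.
  have [|N hN] := cv (e / c); first by rewrite divr_gt0.
  exists N => i j Ni Nj; rewrite -kB; apply: le_lt_trans (CS _ _) _.
  apply: le_lt_trans (_ : _ <= nrm (sub (v i) (v j)) * c) _.
    by rewrite ler_wpM2l// lerDl.
  by rewrite -ltr_pdivlMr// hN.
have phiP : phi \in kpred by apply/asboolP; exists v.
exists (KSpace phiP); apply: null_cvg => [n|e e0]; first exact: ipnorm_ge0.
have e20 : 0 < e / 2 by lra.
have [N hN] := @knrm_sub_emb (KSpace phiP) v (conj cv hphi) _ e20.
have [M hM] := inv_small _ e20.
exists (maxn N M) => n; rewrite geq_max => /andP[Nn Mn].
have -> : x n - KSpace phiP = (x n - kemb (v n)) - (KSpace phiP - kemb (v n)).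
  by rewrite opprB addrA subrK.
apply: le_lt_trans (knrmD _ _) _; rewrite knrmN.
by have := hN n Nn; have := hM n Mn; rewrite /knrm; lra.
Qed.

HB.instance Definition _ := isHilbert.Build R kspace
  kinner_linearl kinnerC kinner_gt0 kcomplete.

End kernel_space.

Section hilbert_basics.
Context (R : realType) (V : hilbertType R).
Implicit Types x y z : V.

Lemma innerDl x y z : inner (x + y) z = inner x z + inner y z.
Proof. by rewrite -[x in LHS]scale1r inner_linearl mul1r. Qed.

Lemma inner0l y : inner (0 : V) y = 0.
Proof. by apply: (addrI (inner (0 : V) y)); rewrite -innerDl !addr0. Qed.

Lemma innerZl a x y : inner (a *: x) y = a * inner x y.
Proof. by rewrite -[_ *: _]addr0 inner_linearl inner0l addr0. Qed.

Lemma inner0r y : inner y (0 : V) = 0.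
Proof. by rewrite innerC inner0l rmorph0. Qed.

Lemma innerDr x y z : inner z (x + y) = inner z x + inner z y.
Proof. by rewrite innerC innerDl rmorphD/= -!innerC. Qed.

Lemma innerZr a x y : inner y (a *: x) = a^* * inner y x.
Proof. by rewrite innerC innerZl rmorphM/= -!innerC. Qed.

Lemma inner_ge0 x : 0 <= inner x x.
Proof.
have [->|/inner_gt0/ltW//] := eqVneq x 0; by rewrite inner0l.
Qed.

Lemma inner_suml (J : Type) (r : seq J) (F : J -> V) y :
  inner (\sum_(j <- r) F j) y = \sum_(j <- r) inner (F j) y.
Proof.
elim: r => [|j r IH]; first by rewrite !big_nil inner0l.
by rewrite !big_cons innerDl IH.
Qed.

Lemma inner_sumr (J : Type) (r : seq J) (F : J -> V) y :
  inner y (\sum_(j <- r) F j) = \sum_(j <- r) inner y (F j).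
Proof.
rewrite innerC inner_suml rmorph_sum; apply: eq_bigr => j _ /=.
by rewrite -innerC.
Qed.

End hilbert_basics.

(* The Hilbert tensor product: the completion of the span of the [pure x y] for
   <x (x) y, x' (x) y'> = <x, x'> <y, y'>; see [inner_pure], [pure_linearl],
   [pure_linearr] and [pure_dense]. *)
Section tensor.
Context (R : realType) (E K : hilbertType R).

Let gram (s : seq (E * K)) : R[i] :=
  \sum_(a <- s) \sum_(b <- s) inner a.1 b.1 * inner a.2 b.2.

Let gram_ge0 (s : seq (E * K)) : 0 <= gram s.
Proof.
have [n] := ubnP (size s); elim: n s => // n IH [_|[x y] t /=].
  by rewrite /gram big_nil.
rewrite ltnS => szt.
pose f (a : E * K) := (a.1 - (inner a.1 x / inner x x) *: x, a.2).
have fE a b : inner a.1 b.1 =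
    inner (f a).1 (f b).1 + inner a.1 x * inner x b.1 / inner x x.
  rewrite /f /= -(scaleNr (inner a.1 x / _)) -(scaleNr (inner b.1 x / _)) !innerDl !innerDr !innerZl !innerZr.
  have [x0|x0] := eqVneq (inner x x) 0.
    have -> : x = 0.
      by apply/eqP; apply: contraTT isT => /inner_gt0; rewrite x0 ltxx.
    by rewrite !inner0l !inner0r; ring.
  have xr : (inner x x)^* = inner x x by rewrite -innerC.
  rewrite rmorphN rmorphM/= fmorphV/= xr.
  rewrite -innerC.
  by field.
have gramE s : gram s = gram (map f s) +
    inner (\sum_(a <- s) inner a.1 x *: a.2) (\sum_(a <- s) inner a.1 x *: a.2) / inner x x.
  rewrite inner_suml mulr_suml /gram big_map -big_split; apply: eq_bigr => a _ /=.
  rewrite big_map inner_sumr mulr_suml -big_split; apply: eq_bigr => b _ /=.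
  rewrite fE innerZl innerZr -innerC; ring.
rewrite gramE addr_ge0//; last by rewrite divr_ge0// inner_ge0.
have fx0 : (f (x, y)).1 = 0.
  rewrite /f /=; have [x0|x0] := eqVneq (inner x x) 0.
    have -> : x = 0.
      by apply/eqP; apply: contraTT isT => /inner_gt0; rewrite x0 ltxx.
    by rewrite scaler0 subrr.
  by rewrite divff// scale1r subrr.
have -> : gram (map f ((x, y) :: t)) = gram (map f t).
  rewrite /gram [map _ _]/= big_cons fx0 big1 ?add0r; last first.
    by move=> b _; rewrite inner0l mul0r.
  apply: eq_bigr => a _; rewrite big_cons fx0.
  by rewrite inner0r mul0r add0r.
by apply: IH; rewrite size_map.
Qed.

Let tker (p q : E * K) : R[i] := inner p.1 q.1 * inner p.2 q.2.

Let tkerC p q : tker q p = (tker p q)^*.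
Proof. by rewrite /tker rmorphM/= -!innerC. Qed.

Let tker_ge0 (u : seq (R[i] * (E * K))) :
  0 <= \sum_(a <- u) \sum_(b <- u) a.1 * b.1^* * tker a.2 b.2.
Proof.
have := gram_ge0 [seq (a.1 *: a.2.1, a.2.2) | a <- u].
rewrite /gram big_map; under eq_bigr do rewrite big_map.
congr (is_true (0 <= _)).
apply: eq_bigr => a _; apply: eq_bigr => b _.
by rewrite /tker /= innerZl innerZr; ring.
Qed.

Definition tensor_kernel : pdkernel R (E * K) := PDKernel tkerC tker_ge0.

Definition tensor : hilbertType R := kspace tensor_kernel.

Definition pure (x : E) (y : K) : tensor := kemb tensor_kernel (kpt R (x, y)).

Let formal1 a b p q : kform tensor_kernel [:: (a, p)] [:: (b, q)] = a * b^* * tker p q.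
Proof. by rewrite /kform !big_seq1. Qed.

Lemma inner_pure x y x' y' : inner (pure x y) (pure x' y') = inner x x' * inner y y'.
Proof.
rewrite [LHS]inner_kemb formal1 rmorph1 !mul1r. by [].
Qed.

Let pureE x y p q : kval (pure x y) (p, q) = inner x p * inner y q.
Proof. by rewrite /= /kpt formal1 rmorph1 !mul1r. Qed.

Lemma pure_linearl c x x' y : pure (c *: x + x') y = c *: pure x y + pure x' y.
Proof.
apply/val_inj/funext => -[p q].
transitivity (c * kval (pure x y) (p, q) + kval (pure x' y) (p, q)); last by [].
by rewrite [LHS]pureE !pureE inner_linearl; ring.
Qed.

Lemma pure_linearr c x y y' : pure x (c *: y + y') = c *: pure x y + pure x y'.
Proof.
apply/val_inj/funext => -[p q].
transitivity (c * kval (pure x y) (p, q) + kval (pure x y') (p, q)); last by [].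
by rewrite [LHS]pureE !pureE inner_linearl; ring.
Qed.

Lemma pure_dense (z : tensor) (e : R) : 0 < e -> exists u : seq (R[i] * (E * K)),
  ipnorm inner (z - \sum_(a <- u) a.1 *: pure a.2.1 a.2.2) < e.
Proof.
move=> e0; have [u hu] := kemb_dense (z : kspace tensor_kernel) e0; exists u.
by move: hu; under eq_bigr => a _ do rewrite [a.2]surjective_pairing.
Qed.

End tensor.

(* The full Fock space F^2(H_n), with orthonormal basis [fbasis]; the word
   g_{i_1} ... g_{i_k} is the sequence [:: i_1; ...; i_k], and g_0 is [::]. *)
Section fock.
Context (R : realType) (n : nat).

Let delta (p q : seq 'I_n) : R[i] := (p == q)%:R.

Let deltaC p q : delta q p = (delta p q)^*.
Proof. by rewrite /delta eq_sym rmorph_nat. Qed.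

Let delta_ge0 (u : seq (R[i] * seq 'I_n)) :
  0 <= \sum_(a <- u) \sum_(b <- u) a.1 * b.1^* * delta a.2 b.2.
Proof.
pose c w := \sum_(a <- u) a.1 * delta a.2 w.
suff -> : \sum_(a <- u) \sum_(b <- u) a.1 * b.1^* * delta a.2 b.2 =
    \sum_(w <- undup [seq a.2 | a <- u]) c w * (c w)^*.
  by rewrite sumr_ge0// => w _; rewrite -normCK exprn_ge0.
under [RHS]eq_bigr do rewrite rmorph_sum mulr_suml; rewrite [RHS]exchange_big.
apply: eq_big_seq => a au; under [RHS]eq_bigr do rewrite mulr_sumr.
rewrite [RHS]exchange_big; apply: eq_bigr => b _.
rewrite [RHS](bigD1_seq a.2) ?undup_uniq ?mem_undup ?map_f//= big1 ?addr0 => [|w wa].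
  by rewrite rmorphM/= -deltaC /delta eqxx mulr1; ring.
by rewrite /delta eq_sym (negbTE wa) mulr0 mul0r.
Qed.

Definition fock_kernel : pdkernel R (seq 'I_n) := PDKernel deltaC delta_ge0.

Definition fock : hilbertType R := kspace fock_kernel.

Definition fbasis (alpha : seq 'I_n) : fock := kemb fock_kernel (kpt R alpha).

Lemma inner_fbasis alpha beta :
  inner (fbasis alpha) (fbasis beta) = (alpha == beta)%:R.
Proof.
by rewrite [LHS]inner_kemb /kform !big_seq1 rmorph1 !mul1r.
Qed.

Lemma fbasis_dense (z : fock) (e : R) : 0 < e -> exists u : seq (R[i] * seq 'I_n),
  ipnorm inner (z - \sum_(a <- u) a.1 *: fbasis a.2) < e.
Proof. by move=> e0; exact: (kemb_dense (z : kspace fock_kernel) e0). Qed.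

End fock.

Section bounded_operators.
Context (R : realType).
Implicit Types U V W : hilbertType R.

Definition hnorm V (x : V) : R := ipnorm inner x.

Lemma hnorm_ge0 V (x : V) : 0 <= hnorm x. Proof. exact: ipnorm_ge0. Qed.

Lemma hnormD V (x y : V) : hnorm (x + y) <= hnorm x + hnorm y.
Proof.
exact: (ipnormD (@innerDl R V) (@innerZl R V) (@innerC R V) (@inner_ge0 R V)).
Qed.

Lemma hnormZ V c (x : V) : hnorm (c *: x) = normc c * hnorm x.
Proof. exact: (ipnormZ (@innerZl R V) (@innerC R V) (@inner_ge0 R V)). Qed.

Lemma inner_CS V (x y : V) : normc (inner x y) <= hnorm x * hnorm y.
Proof.
exact: (semi_CS (@innerDl R V) (@innerZl R V) (@innerC R V) (@inner_ge0 R V)).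
Qed.

Definition bounded_op V W : {pred V -> W} := fun f =>
  `[< (forall c x y, f (c *: x + y) = c *: f x + f y) /\
      exists M : R, forall x, hnorm (f x) <= M * hnorm x >].

Record bop V W := Bop { bop_fun :> V -> W; bopP : bop_fun \in @bounded_op V W }.

HB.instance Definition _ V W := [isSub for @bop_fun V W].
HB.instance Definition _ V W := [Choice of bop V W by <:].

Lemma bounded_op_submod V W : submod_closed (@bounded_op V W).
Proof.
split.
  apply/asboolP; split=> [c x y|]; first by rewrite scaler0 addr0.
  exists 0 => x; rewrite mul0r; have := hnormZ 0 (0 : W).
  by rewrite scale0r normc0 mul0r => ->.
move=> a f g /asboolP[lf [M fM]] /asboolP[lg [N gN]]; apply/asboolP; split.
  move=> c x y; change (a *: f (c *: x + y) + g (c *: x + y) =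
    c *: (a *: f x + g x) + (a *: f y + g y)).
  by rewrite lf lg !scalerDr !scalerA (mulrC a c) addrACA.
exists (normc a * M + N) => x.
apply: le_trans (hnormD _ _) _; rewrite mulrDl lerD//.
by rewrite hnormZ -mulrA ler_wpM2l// normc_ge0.
Qed.

HB.instance Definition _ V W :=
  GRing.isSubmodClosed.Build _ _ (@bounded_op V W) (@bounded_op_submod V W).
HB.instance Definition _ V W := [SubChoice_isSubLmodule of bop V W by <:].

Lemma bid_subproof V : idfun \in @bounded_op V V.
Proof. by apply/asboolP; split=> //; exists 1 => x; rewrite mul1r. Qed.
Definition bid V : bop V V := Bop (@bid_subproof V).

Lemma bcomp_subproof U V W (S : bop V W) (T : bop U V) : S \o T \in @bounded_op U W.
Proof.
have /asboolP[lS [M SM]] := bopP S; have /asboolP[lT [N TN]] := bopP T.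
apply/asboolP; split=> [c x y /=|]; first by rewrite lT lS.
exists (`|M| * N) => x /=; apply: le_trans (SM _) _.
apply: le_trans (ler_wpM2r (hnorm_ge0 _) (ler_norm M)) _.
by rewrite -mulrA ler_wpM2l.
Qed.
Definition bcomp U V W (S : bop V W) (T : bop U V) : bop U W :=
  Bop (bcomp_subproof S T).

Definition opnorm V W (T : bop V W) : R :=
  sup [set hnorm (T x) | x in [set x | hnorm x <= 1]].

(* Adjoints, tensor products of operators, and below Phi_{f,X}(Y), the values
   F(rW) and the model W, are definite descriptions: [xget 0] returns the
   unique operator with the stated property.  For adjoints it exists by the
   Riesz theorem, and for A (x) X because the map x (x) y |-> A x (x) X y has
   a bounded extension, of norm ||A|| ||X||. *)
Definition adj V W (T : bop V W) : bop W V :=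
  xget 0 [set S : bop W V | forall x y, inner (T x) y = inner x (S y)].

Definition op_ge0 V (T : bop V V) : Prop := forall x, 0 <= inner (T x) x.

Definition norm_cvg V W (T : nat -> bop V W) (S : bop V W) : Prop :=
  opnorm (T N - S) @[N --> \oo] --> (0 : R).

Definition wot_cvg V W (T : nat -> bop V W) (S : bop V W) : Prop :=
  forall x y, normc (inner (T N x) y - inner (S x) y) @[N --> \oo] --> (0 : R).

Definition op_tensor E K (A : bop E E) (X : bop K K) :
    bop (tensor E K) (tensor E K) :=
  xget 0 [set S : bop (tensor E K) (tensor E K) |
    forall x y, S (pure x y) = pure (A x) (X y)].

End bounded_operators.

Notation "''B' ( K )" := (bop K K) (at level 8, format "''B' ( K )").

Section free_pluriharmonic.
Context (R : realType) (n m : nat) (a : seq 'I_n -> R).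

Definition positive_regular : Prop :=
  [/\ forall alpha, 0 <= a alpha, a [::] = 0, forall i, 0 < a [:: i] &
      (limn_esup (fun k =>
        ((\sum_(alpha : k.-tuple 'I_n) `|a alpha| ^+ 2) `^ ((2 * k)%N%:R^-1))%:E)
       < +oo)%E].

(* b^(m)_alpha; the factors gamma_i of alpha have length at most |alpha|, so
   that they range over the finite type of bounded sequences. *)
Definition bcoef (alpha : seq 'I_n) : R :=
  if alpha is [::] then 1 else
  \sum_(1 <= j < (size alpha).+1)
    \sum_(g : j.-tuple {bseq (size alpha) of 'I_n} |
          all (fun w : {bseq (size alpha) of 'I_n} => 0 < size w)%N g &&
          (flatten [seq val w | w <- g] == alpha))
      (\prod_(i < j) a (tnth g i)) * 'C(j + m - 1, m - 1)%:R.

Definition wprod (K : hilbertType R) (X : 'I_n -> 'B(K)) (alpha : seq 'I_n) : 'B(K) :=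
  foldr (fun i T => bcomp (X i) T) (bid K) alpha.

Section domain.
Context (K : hilbertType R).
Implicit Types (X : 'I_n -> 'B(K)) (Y : 'B(K)).

(* WOT convergence is that of the partial sums over |alpha| <= N.  It is only
   used for Y >= 0, where it does not depend on the order of summation. *)
Definition Phi_partial X Y (N : nat) : 'B(K) :=
  \sum_(1 <= k < N.+1) \sum_(alpha : k.-tuple 'I_n)
    (a alpha)%:C *: bcomp (wprod X alpha) (bcomp Y (adj (wprod X alpha))).

Definition Phi_defined X Y : Prop := exists Z, wot_cvg (Phi_partial X Y) Z.

Definition Phi X Y : 'B(K) := xget 0 [set Z | wot_cvg (Phi_partial X Y) Z].

(* (id - Phi_{f,X})^k (I) *)
Definition defect X (k : nat) : 'B(K) := iter k (fun Y => Y - Phi X Y) (bid K).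

Definition Dom : set ('I_n -> 'B(K)) := [set X | forall k, (1 <= k <= m)%N ->
  Phi_defined X (defect X k.-1) /\ op_ge0 (defect X k)].

Definition Drad : set ('I_n -> 'B(K)) := [set X | exists2 t : R, 0 <= t < 1 &
  exists2 Y, Dom Y & X = fun i => t%:C *: Y i].

End domain.

Context (E : hilbertType R).

(* A power series sum_alpha A_(alpha) (x) Z_alpha is its family of
   coefficients. *)
Definition analytic_partial (A : seq 'I_n -> 'B(E)) (K : hilbertType R)
    (X : 'I_n -> 'B(K)) (N : nat) : 'B(tensor E K) :=
  \sum_(0 <= k < N.+1) \sum_(alpha : k.-tuple 'I_n) op_tensor (A alpha) (wprod X alpha).

Definition coanalytic_partial (B : seq 'I_n -> 'B(E)) (K : hilbertType R)
    (X : 'I_n -> 'B(K)) (N : nat) : 'B(tensor E K) :=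
  \sum_(1 <= k < N.+1) \sum_(alpha : k.-tuple 'I_n)
    op_tensor (B alpha) (adj (wprod X alpha)).

Definition free_holomorphic (A : seq 'I_n -> 'B(E)) : Prop :=
  forall (K : hilbertType R) (X : 'I_n -> 'B(K)), Drad X ->
    exists S, norm_cvg (analytic_partial A X) S.

(* B(E) (x)_min B(K): the norm closure of the algebraic tensor product. *)
Definition spatial (K : hilbertType R) : set 'B(tensor E K) :=
  [set T | forall e : R, 0 < e -> exists N (A : 'I_N -> 'B(E)) (X : 'I_N -> 'B(K)),
     opnorm (T - \sum_(j < N) op_tensor (A j) (X j)) < e].

(* S = sum_{k >= 1} sum_{|alpha| = k} B_(alpha) (x) X_alpha^*
     + sum_{k >= 0} sum_{|alpha| = k} A_(alpha) (x) X_alpha, in norm;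
   B [::] plays no role. *)
Definition pluri_value (B A : seq 'I_n -> 'B(E)) (K : hilbertType R)
    (X : 'I_n -> 'B(K)) (S : 'B(tensor E K)) : Prop :=
  exists S1 S2, [/\ norm_cvg (coanalytic_partial B X) S1,
    norm_cvg (analytic_partial A X) S2 & S = S1 + S2].

Context (H : hilbertType R).

Definition radmap : Type :=
  {X : 'I_n -> 'B(H) | Drad X} -> {T : 'B(tensor E H) | spatial T}.

Definition sa_pluriharmonic (G : radmap) : Prop :=
  exists2 A, free_holomorphic A & forall X,
    exists2 S, norm_cvg (analytic_partial A (sval X)) S &
      sval (G X) = 2^-1 *: (S + adj S).

Definition Har : set radmap := [set F | exists N (c : 'I_N -> R[i]) (G : 'I_N -> radmap),
  (forall j, sa_pluriharmonic (G j)) /\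
  forall X, sval (F X) = \sum_(j < N) c j *: sval (G j X)].

(* The value at X in Drad K of the series representing F on Drad H. *)
Definition pluri_eval (F : radmap) (K : hilbertType R) (X : 'I_n -> 'B(K)) :
    'B(tensor E K) :=
  xget 0 [set S | exists B A,
    (forall Y, pluri_value B A (sval Y) (sval (F Y))) /\ pluri_value B A X S].

(* The universal model W: the weights are bounded because
   bcoef alpha / bcoef (i :: alpha) <= 1 / a [:: i]. *)
Definition univ_model (i : 'I_n) : 'B(fock R n) :=
  xget 0 [set T : 'B(fock R n) | forall alpha, T (fbasis R alpha) =
    (Num.sqrt (bcoef alpha / bcoef (i :: alpha)))%:C *: fbasis R (i :: alpha)].

Definition dr (r : R) (F G : radmap) : R :=
  opnorm (pluri_eval F (fun i => r%:C *: univ_model i) -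
          pluri_eval G (fun i => r%:C *: univ_model i)).

Definition rho (r : nat -> R) (F G : radmap) : R :=
  limn (fun N => \sum_(1 <= k < N.+1)
    (1 / 2) ^+ k * (dr (r k) F G / (1 + dr (r k) F G))).

End free_pluriharmonic.

Arguments Har {R n} m a E H.
Arguments rho {R n} m a E H.

Definition separable (R : realType) (V : hilbertType R) : Prop :=
  exists s : nat -> V, forall x (e : R), 0 < e -> exists k, hnorm (x - s k) < e.

Definition infinite_dimensional (R : realType) (V : hilbertType R) : Prop :=
  ~ exists N (s : 'I_N -> V), forall x, exists c : 'I_N -> R[i],
      x = \sum_(j < N) c j *: s j.

Definition complete_metric_space (R : realType) (T : Type) (S : set T)
    (d : T -> T -> R) : Prop :=
  [/\ forall x y, S x -> S y -> 0 <= d x y /\ (d x y = 0 <-> x = y),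
      forall x y, S x -> S y -> d x y = d y x,
      forall x y z, S x -> S y -> S z -> d x z <= d x y + d y z &
      forall u : nat -> T, (forall k, S (u k)) ->
        (forall e : R, 0 < e -> exists N, forall i j,
           (N <= i)%N -> (N <= j)%N -> d (u i) (u j) < e) ->
        exists2 l, S l & d (u k) l @[k --> \oo] --> (0 : R)].

(* Main.v *)
From Pilot Require Import Defs.
From HB Require Import structures.
From mathcomp Require Import all_boot all_order all_algebra.
From mathcomp Require Import complex.
From mathcomp Require Import boolp classical_sets functions reals ereal.
From mathcomp Require Import topology normedtype sequences exp.
From mathcomp Require Import ring lra zify.
Import Pilot.Defs.
Set Implicit Arguments.
Unset Strict Implicit.
Unset Printing Implicit Defensive.
Import Order.TTheory GRing.Theory Num.Theory numFieldNormedType.Exports.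
Import ComplexField Normc.
Local Open Scope classical_set_scope.
Local Open Scope complex_scope.
Local Open Scope ring_scope.

(* Let W be the universal model and b the coefficients b^(m).  The first column
   of F(rW) = sum A_w (x) (rW)_w + sum B_w (x) (rW)_w^* has the entries
   r^|w| b_w^(-1/2) A_w, and its first row the entries r^|w| b_w^(-1/2) B_w.  Hence
   F(rW) determines F, and
     sum_(|w| = k) |A_w x|^2 / b_w <= r^(-2k) |F(rW)|^2 |x|^2,
   and likewise for the B_w^*.  Conversely, if X = tY with Y in the domain, then
   Phi_Y(I) <= I gives sum_(|w| = k) b_w |Y_w^* y|^2 <= s^(-k) (1 - s)^(-m) |y|^2 for
   all 0 < s < 1, so by Cauchy-Schwarz such a bound on the A_w makes the
   homogeneous parts of sum A_w (x) X_w decay geometrically as soon as t < r.  So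
   if F_j(r_p W) is Cauchy for every p, then the coefficients converge, the limits
   are those of a free pluriharmonic F, and |F_j(r_p W) - F(r_p W)| is controlled
   by the values at any r_q > r_p.

   That W lies in the domain is the identity
   (id - Phi_W)^k (I) = diag (b^(m-k) / b^(m)). *)

(** * Hilbert spaces and bounded operators *)

(** [adj], [op_tensor], [Phi], [univ_model] and [pluri_eval] are definite descriptions with default
    0, so each needs an existence and a uniqueness argument before anything can be computed with it.
    For [pluri_eval] this shapes the proof: F is a map on the domain over H, while the metric looks
    at its value at rW on Fock space, and the two are linked only through the coefficients. To see
    that the values over H fix the coefficients, Fock space is embedded isometrically in the
    infinite-dimensional H, and the copy of rW in B(H) has the same first row and column. The
    coanalytic part is treated as the adjoint of a second analytic series C, so that all estimates
    concern analytic series; the normalization C_[] = 0 then settles where the constant term goes.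
    The parameter s is the price of an elementary growth bound: it costs s^(-k/2) in degree k, which
    is absorbed because one always passes from a radius to a strictly smaller one. The constants
    depend on the two radii only, and this uniformity is what makes the limit argument work. *)

Section null_sequences.
Context (R : realType).

Lemma null_cst0 (c : R) : 0 <= c -> null (fun=> c) -> c = 0.
Proof. by move=> c0 /null_cst cl; apply/eqP; rewrite eq_le cl c0. Qed.

Lemma null_invS (c : R) : 0 <= c -> null (fun k => c * k.+1%:R^-1).
Proof.
move=> c0; apply: nullM => // e e0.
have [N _ hN] := near_infty_natSinv_lt (PosNum e0).
by exists N => k /hN.
Qed.

Lemma null_ge0P (x : nat -> R) : (forall k, 0 <= x k) ->
  x k @[k --> \oo] --> (0 : R) <-> null x.
Proof. by move=> x0; split; [exact: cvg_null | exact: null_cvg]. Qed.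

End null_sequences.

Section hilbert_norm.
Context (R : realType) (V : hilbertType R).
Implicit Types x y z : V.

Lemma hnorm_sqr x : (hnorm x ^+ 2)%:C = inner x x.
Proof. exact: (ipnorm_sqr (@inner_ge0 R V)). Qed.

Lemma hnorm_Re x : hnorm x ^+ 2 = complex.Re (inner x x).
Proof. by rewrite -hnorm_sqr. Qed.

Lemma hnorm0 : hnorm (0 : V) = 0.
Proof. by rewrite -(scale0r (0 : V)) hnormZ normc0 mul0r. Qed.

Lemma hnormN x : hnorm (- x) = hnorm x.
Proof. by rewrite -scaleN1r hnormZ normcN normc1 mul1r. Qed.

Lemma hnorm_subC x y : hnorm (x - y) = hnorm (y - x).
Proof. by rewrite -hnormN opprB. Qed.

Lemma hnorm_eq0 x : hnorm x = 0 -> x = 0.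
Proof.
move=> x0; have [//|/inner_gt0] := eqVneq x 0.
by rewrite -hnorm_sqr x0 expr0n /= ltxx.
Qed.

Lemma innerNl x y : inner (- x) y = - inner x y.
Proof. by rewrite -scaleN1r innerZl mulN1r. Qed.

Lemma innerNr x y : inner x (- y) = - inner x y.
Proof. by rewrite innerC innerNl rmorphN /= -innerC. Qed.

Lemma innerBl x y z : inner (x - y) z = inner x z - inner y z.
Proof. by rewrite innerDl innerNl. Qed.

Lemma innerBr x y z : inner z (x - y) = inner z x - inner z y.
Proof. by rewrite innerDr innerNr. Qed.

Lemma inner_injl x y : (forall z, inner x z = inner y z) -> x = y.
Proof.
move=> e; apply/eqP; rewrite -subr_eq0; apply/eqP/hnorm_eq0.
by apply/eqP; rewrite -sqrf_eq0 hnorm_Re innerBl e subrr.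
Qed.

Lemma hnorm_sqrD x y :
  hnorm (x + y) ^+ 2 = hnorm x ^+ 2 + hnorm y ^+ 2 + complex.Re (inner x y) *+ 2.
Proof.
rewrite !hnorm_Re innerDl !innerDr [inner y x]innerC.
by case: (inner x x) (inner x y) (inner y y) => ? ? [? ?] [? ?] /=; ring.
Qed.

Lemma parallelogram x y : hnorm (x - y) ^+ 2 =
  hnorm x ^+ 2 *+ 2 + hnorm y ^+ 2 *+ 2 - hnorm (x + y) ^+ 2.
Proof.
rewrite !hnorm_sqrD hnormN innerNr.
by case: (inner x y) => ? ? /=; ring.
Qed.

Lemma hnorm_le_inner x c : 0 <= c ->
  (forall y, normc (inner x y) <= c * hnorm y) -> hnorm x <= c.
Proof.
move=> c0 /(_ x); have [->|x0] := eqVneq (hnorm x) 0; first by [].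
rewrite -hnorm_sqr normcC ger0_norm ?exprn_ge0 ?hnorm_ge0// expr2.
by rewrite ler_pM2r// lt_def x0 hnorm_ge0.
Qed.

Definition hcvg (u : nat -> V) (l : V) := null (fun k => hnorm (u k - l)).

Lemma hcvg_ex (u : nat -> V) :
  (forall e : R, 0 < e -> exists N, forall i j,
     (N <= i)%N -> (N <= j)%N -> hnorm (u i - u j) < e) -> exists l, hcvg u l.
Proof. by move=> /hilbert_complete[l /cvg_null hl]; exists l. Qed.

Lemma hcvg_uniq u l l' : hcvg u l -> hcvg u l' -> l = l'.
Proof.
move=> h h'; apply/eqP; rewrite -subr_eq0; apply/eqP/hnorm_eq0.
apply: null_cst0; first exact: hnorm_ge0.
apply: null_le (nullD h h') => k; rewrite [hnorm (u k - l)]hnorm_subC.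
by apply: le_trans (hnormD _ _); rewrite addrA subrK.
Qed.

Lemma hcvg_lin c u v l l' : hcvg u l -> hcvg v l' ->
  hcvg (fun k => c *: u k + v k) (c *: l + l').
Proof.
move=> hu hv; apply: null_le (nullD (nullM (normc_ge0 c) hu) hv) => k.
rewrite opprD addrACA -scalerBr; apply: le_trans (hnormD _ _) _.
by rewrite hnormZ.
Qed.

Lemma hcvgB u v l l' : hcvg u l -> hcvg v l' -> hcvg (fun k => u k - v k) (l - l').
Proof.
move=> hu hv; have h := hcvg_lin (-1) hv hu; apply: null_le h => k.
by rewrite !scaleN1r ![- _ + _]addrC.
Qed.

Lemma hcvg_cst l : hcvg (fun=> l) l.
Proof. by move=> d d0; exists 0%N => ? _; rewrite subrr hnorm0. Qed.

Lemma hcvg_inner u l y : hcvg u l -> ccvg (fun k => inner (u k) y) (inner l y).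
Proof.
move=> hu; apply: null_le (nullM (hnorm_ge0 y) hu) => k.
by rewrite -innerBl mulrC; apply: inner_CS.
Qed.

Lemma hcvg_norm_le u l c :
  hcvg u l -> (exists N, forall k, (N <= k)%N -> hnorm (u k) <= c) -> hnorm l <= c.
Proof.
move=> hu [N hN]; rewrite leNgt; apply/negP => ltc.
have [|M hM] := hu (hnorm l - c); first by rewrite subr_gt0.
have := hM _ (leq_maxr N M); have := hN _ (leq_maxl N M).
set k := maxn N M => h1 h2.
have := hnormD (u k) (l - u k); rewrite addrC subrK hnorm_subC; lra.
Qed.

End hilbert_norm.

Section operators.
Context (R : realType).
Implicit Types U V W : hilbertType R.

Lemma bop_lin V W (T : bop V W) c x y : T (c *: x + y) = c *: T x + T y.
Proof. by have /asboolP[lT _] := bopP T. Qed.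

Lemma bopD V W (T : bop V W) x y : T (x + y) = T x + T y.
Proof. by rewrite -[x in LHS]scale1r bop_lin scale1r. Qed.

Lemma bop0 V W (T : bop V W) : T 0 = 0.
Proof. by apply: (addrI (T 0)); rewrite -bopD !addr0. Qed.

Lemma bopZ V W (T : bop V W) c x : T (c *: x) = c *: T x.
Proof. by rewrite -[c *: x]addr0 bop_lin bop0 addr0. Qed.

Lemma bopN V W (T : bop V W) x : T (- x) = - T x.
Proof. by rewrite -scaleN1r bopZ scaleN1r. Qed.

Lemma bopB V W (T : bop V W) x y : T (x - y) = T x - T y.
Proof. by rewrite bopD bopN. Qed.

Lemma bop_sum V W (T : bop V W) J (s : seq J) (P : pred J) (F : J -> V) :
  T (\sum_(j <- s | P j) F j) = \sum_(j <- s | P j) T (F j).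
Proof. by elim/big_rec2: _ => [|j x y _ <-]; rewrite ?bop0 ?bopD. Qed.

Lemma bop_ext V W (S T : bop V W) : (forall x, S x = T x) -> S = T.
Proof. by move=> e; apply/val_inj/funext. Qed.

Lemma addbE V W (S T : bop V W) x : (S + T) x = S x + T x. Proof. by []. Qed.
Lemma oppbE V W (T : bop V W) x : (- T) x = - T x. Proof. by []. Qed.
Lemma subbE V W (S T : bop V W) x : (S - T) x = S x - T x. Proof. by []. Qed.
Lemma scalebE V W c (T : bop V W) x : (c *: T) x = c *: T x. Proof. by []. Qed.
Lemma zerobE V W x : (0 : bop V W) x = 0. Proof. by []. Qed.

Lemma sumbE V W J (s : seq J) (P : pred J) (F : J -> bop V W) x :
  (\sum_(j <- s | P j) F j) x = \sum_(j <- s | P j) F j x.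
Proof. by elim/big_rec2: _ => [|j y S _ <-]. Qed.

Lemma opnorm_has_sup V W (T : bop V W) :
  has_sup [set hnorm (T x) | x in [set x | hnorm x <= 1]].
Proof.
split; first by exists (hnorm (T 0)), 0 => //=; rewrite hnorm0.
have /asboolP[_ [M TM]] := bopP T; exists `|M| => _ [x /= x1 <-].
apply: le_trans (TM x) _; apply: le_trans (ler_wpM2r (hnorm_ge0 _) (ler_norm M)) _.
by rewrite ler_piMr.
Qed.

Lemma opnorm_ge0 V W (T : bop V W) : 0 <= opnorm T.
Proof.
apply: le_trans (hnorm_ge0 (T 0)) _; apply: sup_upper_bound (opnorm_has_sup T) _ _.
by exists 0 => //=; rewrite hnorm0.
Qed.

Lemma opnormP V W (T : bop V W) x : hnorm (T x) <= opnorm T * hnorm x.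
Proof.
have [x0|x0] := eqVneq (hnorm x) 0.
  by rewrite (hnorm_eq0 x0) bop0 !hnorm0 mulr0.
have xp : 0 < hnorm x by rewrite lt_def x0 hnorm_ge0.
rewrite -ler_pdivrMr//.
have -> : hnorm (T x) / hnorm x = hnorm (T ((hnorm x)^-1%:C *: x)).
  by rewrite bopZ hnormZ normcC mulrC ger0_norm// invr_ge0 hnorm_ge0.
apply: sup_upper_bound (opnorm_has_sup T) _ _; eexists; last by [].
by rewrite /= hnormZ normcC ger0_norm ?invr_ge0 ?hnorm_ge0// mulVf.
Qed.

Lemma opnorm_le V W (T : bop V W) c : 0 <= c ->
  (forall x, hnorm (T x) <= c * hnorm x) -> opnorm T <= c.
Proof.
move=> c0 Tc; apply: ge_sup; first by case: (opnorm_has_sup T).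
by move=> _ [x /= x1 <-]; apply: le_trans (Tc x) _; rewrite ler_piMr.
Qed.

Lemma opnorm_eq0 V W (T : bop V W) : opnorm T = 0 -> T = 0.
Proof.
move=> T0; apply: bop_ext => x; apply: hnorm_eq0; apply/eqP.
by rewrite eq_le hnorm_ge0 andbT -(mul0r (hnorm x)) -T0 opnormP.
Qed.

Lemma opnormD V W (S T : bop V W) : opnorm (S + T) <= opnorm S + opnorm T.
Proof.
apply: opnorm_le => [|x]; first by rewrite addr_ge0 ?opnorm_ge0.
rewrite addbE mulrDl; apply: le_trans (hnormD _ _) _.
by rewrite lerD ?opnormP.
Qed.

Lemma opnormZ_le V W c (T : bop V W) : opnorm (c *: T) <= normc c * opnorm T.
Proof.
apply: opnorm_le => [|x]; first by rewrite mulr_ge0 ?normc_ge0 ?opnorm_ge0.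
by rewrite scalebE hnormZ -mulrA ler_wpM2l ?normc_ge0 ?opnormP.
Qed.

Lemma opnormN V W (T : bop V W) : opnorm (- T) = opnorm T.
Proof.
by rewrite /opnorm; congr sup; apply/seteqP; split=> _ [x x1 <-]; exists x => //;
  rewrite oppbE hnormN.
Qed.

Lemma opnorm_subC V W (S T : bop V W) : opnorm (S - T) = opnorm (T - S).
Proof. by rewrite -opnormN opprB. Qed.

Lemma opnorm0 V W : opnorm (0 : bop V W) = 0.
Proof.
apply/eqP; rewrite eq_le opnorm_ge0 andbT; apply: opnorm_le => // x.
by rewrite zerobE hnorm0 mul0r.
Qed.

Lemma opnorm_sum V W J (s : seq J) (P : pred J) (F : J -> bop V W) :
  opnorm (\sum_(j <- s | P j) F j) <= \sum_(j <- s | P j) opnorm (F j).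
Proof.
apply: (big_rec2 (fun (x : bop V W) (y : R) => opnorm x <= y)) => [|j x y _ le_xy] /=.
  by rewrite opnorm0.
by apply: le_trans (opnormD _ _) _; rewrite lerD2l.
Qed.

Lemma norm_cvgP V W (T : nat -> bop V W) S :
  norm_cvg T S <-> null (fun N => opnorm (T N - S)).
Proof. by apply: null_ge0P => k; exact: opnorm_ge0. Qed.

Lemma norm_cvg_app V W (T : nat -> bop V W) S x :
  norm_cvg T S -> hcvg (fun k => T k x) (S x).
Proof.
move=> /norm_cvgP h; apply: null_le (nullM (hnorm_ge0 x) h) => k.
by rewrite -subbE mulrC opnormP.
Qed.

Lemma norm_cvg_uniq V W (T : nat -> bop V W) S S' :
  norm_cvg T S -> norm_cvg T S' -> S = S'.
Proof.
move=> h h'; apply: bop_ext => x.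
exact: hcvg_uniq (norm_cvg_app x h) (norm_cvg_app x h').
Qed.

Lemma norm_cvg_lin V W c (T T' : nat -> bop V W) S S' :
  norm_cvg T S -> norm_cvg T' S' ->
  norm_cvg (fun k => c *: T k + T' k) (c *: S + S').
Proof.
move=> /norm_cvgP h /norm_cvgP h'; apply/norm_cvgP.
apply: null_le (nullD (nullM (normc_ge0 c) h) h') => k.
rewrite opprD addrACA -scalerBr; apply: le_trans (opnormD _ _) _.
by rewrite lerD2r opnormZ_le.
Qed.

Lemma norm_cvg_cst V W (T : bop V W) : norm_cvg (fun=> T) T.
Proof.
by apply/norm_cvgP => e e0; exists 0%N => k _; rewrite subrr opnorm0.
Qed.

Lemma norm_cvg_le V W (T : nat -> bop V W) S c :
  norm_cvg T S -> (exists N, forall k, (N <= k)%N -> opnorm (T k) <= c) -> opnorm S <= c.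
Proof.
move=> TS [N hN]; have c0 : 0 <= c by exact: le_trans (opnorm_ge0 _) (hN N _).
apply: opnorm_le => // x; apply: hcvg_norm_le (norm_cvg_app x TS) _.
by exists N => k /hN h; apply: le_trans (opnormP _ _) _; rewrite ler_wpM2r ?hnorm_ge0.
Qed.

Lemma bop_complete V W (T : nat -> bop V W) :
  (forall e : R, 0 < e -> exists N, forall i j,
     (N <= i)%N -> (N <= j)%N -> opnorm (T i - T j) < e) -> exists S, norm_cvg T S.
Proof.
move=> cT.
have /choice[s hs] : forall x, exists y, hcvg (fun k => T k x) y.
  move=> x; apply: hcvg_ex => e e0.
  have x1 : 0 < hnorm x + 1 by rewrite ltr_wpDl ?hnorm_ge0.
  have [|N hN] := cT (e / (hnorm x + 1)); first by rewrite divr_gt0.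
  exists N => i j Ni Nj; have := hN i j Ni Nj; rewrite ltr_pdivlMr//.
  apply: le_lt_trans; apply: le_trans (opnormP (T i - T j) x) _.
  by rewrite ler_wpM2l ?opnorm_ge0// lerDl.
have sT e : 0 < e -> exists N, forall i, (N <= i)%N -> forall x,
    hnorm (T i x - s x) <= e * hnorm x.
  move=> e0; have [N hN] := cT e e0; exists N => i Ni x.
  apply: (@hcvg_norm_le _ _ (fun k => T i x - T k x)).
    exact: hcvgB (hcvg_cst _) (hs x).
  exists N => k Nk; apply: le_trans (opnormP (T i - T k) x) _.
  by rewrite ler_wpM2r ?hnorm_ge0// ltW// hN.
have [N1 hN1] := sT 1 ltr01.
have sP : s \in @bounded_op R V W.
  apply/asboolP; split=> [c x y|].
    apply: hcvg_uniq (hs _) _; under eq_fun do rewrite bop_lin.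
    exact: hcvg_lin.
  exists (1 + opnorm (T N1)) => x; rewrite mulrDl.
  rewrite -[s x](subrK (T N1 x)); apply: le_trans (hnormD _ _) _.
  by rewrite lerD ?opnormP// hnorm_subC hN1.
exists (Bop sP); apply/norm_cvgP => e e0.
have [|N hN] := sT (e / 2); first by lra.
exists N => k Nk; apply: (@le_lt_trans _ _ (e / 2)); last by lra.
by apply: opnorm_le => [|x]; [lra | exact: hN].
Qed.

End operators.

(** * Riesz representation and adjoints *)

Section riesz.
Context (R : realType) (V : hilbertType R) (phi : V -> R[i]) (M : R).
Hypothesis phi_lin : forall c x y, phi (c *: x + y) = c * phi x + phi y.
Hypothesis phi_bnd : forall x, normc (phi x) <= M * hnorm x.

Let J x : R := hnorm x ^+ 2 - complex.Re (phi x) *+ 2.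

Let phiD x y : phi (x + y) = phi x + phi y.
Proof. by rewrite -[x in LHS]scale1r phi_lin mul1r. Qed.

Let phi0 : phi 0 = 0.
Proof. by apply: (addrI (phi 0)); rewrite -phiD !addr0. Qed.

Let phiZ c x : phi (c *: x) = c * phi x.
Proof. by rewrite -[c *: x]addr0 phi_lin phi0 addr0. Qed.

Let ReZ (c : R) (z : R[i]) : complex.Re (c%:C * z) = c * complex.Re z.
Proof. by case: z => ? ? /=; ring. Qed.

Let J_ge x : - M ^+ 2 <= J x.
Proof.
have := sqr_ge0 (hnorm x - M); have := le_trans (Re_le_normc _) (phi_bnd x).
by move=> /(le_trans (ler_norm _)); rewrite /J; nra.
Qed.

(** The parallelogram law, in which the linear part of [J] cancels. Two near-minimizers are
    therefore close to each other, so that minimizing sequences are Cauchy. *)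
Let J_mid x y : hnorm (x - y) ^+ 2 = (J x *+ 2 + J y *+ 2) - J (2^-1%:C *: (x + y)) *+ 4.
Proof.
rewrite parallelogram /J hnormZ phiZ phiD ReZ normcC ger0_norm ?invr_ge0//.
by case: (phi x) (phi y) => ? ? [? ?] /=; field.
Qed.

Let infJ := inf [set J x | x in setT].

Let infJ_le x : infJ <= J x.
Proof.
apply: ge_inf; last by exists x.
by exists (- M ^+ 2) => _ [y _ <-]; exact: J_ge.
Qed.

Let J_inf_seq : {u : nat -> V | forall k, J (u k) < infJ + k.+1%:R^-1}.
Proof.
have h k : exists x, J x < infJ + k.+1%:R^-1.
  have [||_ [x _ <-]] := @inf_adherent R [set J x | x in setT] k.+1%:R^-1; last by exists x.
    by rewrite invr_gt0.
  split; first by exists (J 0), 0.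
  by exists (- M ^+ 2) => _ [y _ <-]; exact: J_ge.
by have [u hu] := choice h; exists u.
Qed.

Let J_min : exists z, forall y, J z <= J y.
Proof.
have [u hu] := J_inf_seq.
have [z hz] : exists z, hcvg u z.
  apply: hcvg_ex => e e0.
  (* [J_mid] bounds the squared distance by 2/(i+1) + 2/(j+1); the factor 4 makes each summand less
     than e^2 / 2. *)
  have [|N hN] := @null_invS R 4 ltac:(by []) (e ^+ 2); first by rewrite exprn_gt0.
  exists N => i j Ni Nj.
  rewrite -(@ltr_pXn2r _ 2)// ?nnegrE ?hnorm_ge0 ?ltW// J_mid.
  have := hN i Ni; have := hN j Nj; have := hu i; have := hu j.
  have := infJ_le (2^-1%:C *: (u i + u j)).
  move: (J (u i)) (J (u j)) (J (_ *: _)) (infJ) (i.+1%:R^-1) (j.+1%:R^-1) => p q s w y z.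
  lra.
exists z => y; apply: le_trans (infJ_le y); rewrite -subr_le0; apply: null_cst.
have h1 := @null_invS R 1 ltac:(by []).
have c0 : 0 <= 2 * hnorm z + 2 * `|M|.
  by have := hnorm_ge0 z; have := normr_ge0 M; lra.
apply: null_le (nullD h1 (nullM c0 hz)) => k.
have h : hnorm z ^+ 2 <= hnorm (u k) ^+ 2 + 2 * hnorm z * hnorm (u k - z).
  have := hnormD (u k) (z - u k); rewrite subrKC hnorm_subC => h.
  have := hnorm_ge0 (u k - z); have := hnorm_ge0 z; have := hnorm_ge0 (u k).
  move: (hnorm z) (hnorm (u k)) (hnorm (u k - z)) h => p q d h *; case: (lerP p d) => ?; nra.
have hr : complex.Re (phi (u k)) - complex.Re (phi z) <= `|M| * hnorm (u k - z).
  rewrite -[u k in X in X <= _](subrK z) phiD.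
  have := le_trans (ler_norm _) (le_trans (Re_le_normc (phi (u k - z))) (phi_bnd _)).
  move=> /le_trans/(_ (ler_wpM2r (hnorm_ge0 _) (ler_norm M))).
  by case: (phi (u k - z)) (phi z) => ? ? [? ?] /=; lra.
have := hu k; rewrite /J mul1r.
move: (hnorm z) (hnorm (u k)) (hnorm (u k - z)) `|M| (complex.Re _) (complex.Re _) infJ (_^-1)
  h hr => p q d m' *.
lra.
Qed.

Lemma real_quadratic_ge0 (p q : R) :
  0 <= q -> (forall t, 0 <= t * p *+ 2 + t ^+ 2 * q) -> p = 0.
Proof.
(* The minimum is at t = - p / q; the denominator q + 1 avoids the case q = 0 and still gives a
   negative value unless p = 0. *)
move=> q0 /(_ (- p / (q + 1))) h.
have q1 : 0 < q + 1 by rewrite ltr_wpDl.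
apply/eqP; rewrite -sqrf_eq0 eq_le sqr_ge0 andbT.
have := mulr_ge0 (ltW (exprn_gt0 2 q1)) h.
have -> : (q + 1) ^+ 2 * (- p / (q + 1) * p *+ 2 + (- p / (q + 1)) ^+ 2 * q) =
  - (p ^+ 2 * (q + 2)) by field; rewrite gt_eqF.
rewrite oppr_ge0 ; have := sqr_ge0 p; nra.
Qed.

(* [z] minimizes |x|^2 - 2 Re (phi x). *)
Lemma riesz : exists z, forall x, phi x = inner x z.
Proof.
have [z hz] := J_min; exists z.
(* The first variation of [J] at its minimizer [z] in the direction [x] vanishes. *)
have Re_eq x : complex.Re (phi x) = complex.Re (inner x z).
  apply/eqP; rewrite eq_sym -subr_eq0; apply/eqP.
  apply: (@real_quadratic_ge0 _ (hnorm x ^+ 2)); first by rewrite exprn_ge0 ?hnorm_ge0.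
  move=> t; have := hz (z + t%:C *: x); rewrite -subr_ge0; congr (is_true (0 <= _)).
  rewrite /J hnorm_sqrD hnormZ normcC exprMn real_normK ?num_real// phiD phiZ innerZr.
  rewrite [inner z x]innerC.
  by case: (phi z) (phi x) (inner x z) => ? ? [? ?] [? ?] /=; ring.
move=> x; apply/eqP; rewrite eq_complex Re_eq eqxx /=.
(* The real parts at i x are, up to sign, the imaginary parts at x. *)
have := Re_eq ('i%C *: x); rewrite phiZ innerZl.
by case: (phi x) (inner x z) => ? ? [? ?] /=; rewrite !mul0r !mul1r !sub0r => /oppr_inj ->.
Qed.

End riesz.

Section adjoint.
Context (R : realType).
Implicit Types U V W : hilbertType R.

Lemma inner_injr V (x y : V) : (forall z, inner z x = inner z y) -> x = y.
Proof. by move=> e; apply: inner_injl => z; rewrite innerC e -innerC. Qed.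

Lemma adj_subproof V W (T : bop V W) :
  exists S : bop W V, forall x y, inner (T x) y = inner x (S y).
Proof.
have h y : exists z, forall x, inner (T x) y = inner x z.
  apply: (@riesz _ _ _ (opnorm T * hnorm y)) => [c x x'|x].
    by rewrite bop_lin innerDl innerZl.
  apply: le_trans (inner_CS _ _) _; rewrite mulrAC.
  by rewrite ler_wpM2r ?hnorm_ge0 ?opnormP.
have [s hs] := choice h.
have sP : s \in @bounded_op R W V.
  apply/asboolP; split=> [c x y|].
    apply: inner_injr => z; rewrite -hs innerDr innerZr innerDr innerZr.
    by rewrite !hs.
  exists (opnorm T) => y; apply: hnorm_le_inner.
    by rewrite mulr_ge0 ?opnorm_ge0 ?hnorm_ge0.
  move=> x; rewrite innerC normc_conj -hs; apply: le_trans (inner_CS _ _) _.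
  by rewrite mulrAC ler_wpM2r ?hnorm_ge0 ?opnormP.
by exists (Bop sP).
Qed.

Lemma adjP V W (T : bop V W) x y : inner (T x) y = inner x (adj T y).
Proof.
have [S hS] := adj_subproof T.
exact: (xgetPex 0 (P := [set S : bop W V | forall x y, inner (T x) y = inner x (S y)])
  (ex_intro _ S hS)).
Qed.

Lemma adjPr V W (T : bop V W) x y : inner (adj T y) x = inner y (T x).
Proof. by rewrite innerC -adjP -innerC. Qed.

Lemma adj_uniq V W (T : bop V W) (S : bop W V) :
  (forall x y, inner (T x) y = inner x (S y)) -> adj T = S.
Proof. by move=> h; apply: bop_ext => y; apply: inner_injr => x; rewrite -adjP h. Qed.

Lemma adjK V W (T : bop V W) : adj (adj T) = T.
Proof. by apply: adj_uniq => x y; rewrite adjPr. Qed.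

Lemma adj_bid V : adj (bid V) = bid V.
Proof. exact: adj_uniq. Qed.

Lemma adj_comp U V W (S : bop V W) (T : bop U V) :
  adj (bcomp S T) = bcomp (adj T) (adj S).
Proof. by apply: adj_uniq => x y /=; rewrite !adjP. Qed.

Lemma adj_lin V W c (S T : bop V W) : adj (c *: S + T) = c^* *: adj S + adj T.
Proof.
apply: adj_uniq => x y; rewrite addbE scalebE innerDl innerZl !adjP.
by rewrite addbE scalebE innerDr innerZr conjCK.
Qed.

Lemma adjD V W (S T : bop V W) : adj (S + T) = adj S + adj T.
Proof. by apply: adj_uniq => x y; rewrite !addbE innerDl innerDr !adjP. Qed.

Lemma adj0 V W : adj (0 : bop V W) = 0.
Proof. by apply: adj_uniq => x y; rewrite !zerobE inner0l inner0r. Qed.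

Lemma adjZ V W c (S : bop V W) : adj (c *: S) = c^* *: adj S.
Proof. by rewrite -[c *: S]addr0 adj_lin adj0 addr0. Qed.

Lemma adjB V W (S T : bop V W) : adj (S - T) = adj S - adj T.
Proof. by apply: adj_uniq => x y; rewrite !subbE innerBl innerBr !adjP. Qed.

Lemma adj_sum V W J (s : seq J) (P : pred J) (F : J -> bop V W) :
  adj (\sum_(j <- s | P j) F j) = \sum_(j <- s | P j) adj (F j).
Proof. by elim/big_rec2: _ => [|j x y _ <-]; rewrite ?adj0 ?adjD. Qed.

Lemma opnorm_adj V W (T : bop V W) : opnorm (adj T) = opnorm T.
Proof.
suff le U U' (S : bop U U') : opnorm (adj S) <= opnorm S.
  by apply/eqP; rewrite eq_le le -{1}[T]adjK le.
apply: opnorm_le (opnorm_ge0 _) _ => y; apply: hnorm_le_inner.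
  by rewrite mulr_ge0 ?opnorm_ge0 ?hnorm_ge0.
move=> x; rewrite adjPr innerC normc_conj; apply: le_trans (inner_CS _ _) _.
by rewrite mulrAC ler_wpM2r ?hnorm_ge0 ?opnormP.
Qed.

Lemma norm_cvg_adj V W (T : nat -> bop V W) S :
  norm_cvg T S -> norm_cvg (fun k => adj (T k)) (adj S).
Proof.
move=> /norm_cvgP h; apply/norm_cvgP; apply: null_le h => k.
by rewrite -adjB opnorm_adj.
Qed.

End adjoint.

(** * Extension of bounded maps from a total family *)

Section total_families.
Context (R : realType) (V : hilbertType R) (I : Type) (v : I -> V).

Definition comb W (g : I -> W : lmodType R[i]) (u : seq (R[i] * I)) : W :=
  \sum_(a <- u) a.1 *: g a.2.

Definition total := forall x (e : R), 0 < e -> exists u, hnorm (x - comb v u) < e.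

Hypothesis totv : total.

Lemma comb_kscale W (g : I -> W : lmodType R[i]) c u :
  comb g (kscale c u) = c *: comb g u.
Proof.
by rewrite /comb big_map scaler_sumr; apply: eq_bigr => a _; rewrite scalerA.
Qed.

Lemma comb_cat W (g : I -> W : lmodType R[i]) u u' :
  comb g (u ++ u') = comb g u + comb g u'.
Proof. by rewrite /comb big_cat. Qed.

Lemma bop_comb (W : hilbertType R) (T : bop V W) u :
  T (comb v u) = comb (T \o v) u.
Proof. by rewrite bop_sum; apply: eq_bigr => a _; rewrite bopZ. Qed.

Lemma total_eq (W : hilbertType R) (S T : bop V W) :
  (forall p, S (v p) = T (v p)) -> S = T.
Proof.
move=> e; apply/eqP; rewrite -subr_eq0; apply/eqP/bop_ext => x.
apply: hnorm_eq0; apply: null_cst0; first exact: hnorm_ge0.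
move=> d d0; exists 0%N => _ _; set D := S - T.
have D1 : 0 < opnorm D + 1 by rewrite ltr_wpDl ?opnorm_ge0.
have [u hu] := totv x (divr_gt0 d0 D1).
have -> : D x = D (x - comb v u).
  rewrite bopB bop_comb /comb big1 ?subr0// => a _.
  by rewrite /D /= [X in _ *: X](_ : _ = S (v a.2) - T (v a.2))// e subrr scaler0.
apply: le_lt_trans (opnormP _ _) _; move: hu; rewrite ltr_pdivlMr// mulrC.
by apply: le_lt_trans; rewrite ler_wpM2r ?hnorm_ge0 ?lerDl.
Qed.

Section extension.
Context (W : hilbertType R) (g : I -> W) (M : R).
Hypothesis M0 : 0 <= M.
Hypothesis gM : forall u, hnorm (comb g u) <= M * hnorm (comb v u).

(** The closure of the set of pairs ([comb v u], [comb g u]). The vectors [v p] may be linearly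
    dependent, so the extension is built as a relation and shown to be a function afterwards. *)
Let rel x y := forall e : R, 0 < e ->
  exists u, hnorm (x - comb v u) < e /\ hnorm (y - comb g u) < e.

(** The bound [gM] survives the closure. Applied to a difference it makes the relation
    single-valued, and it is also the bound of the extension. *)
Let rel_norm x y : rel x y -> hnorm y <= M * hnorm x.
Proof.
move=> rxy; rewrite -subr_le0; apply: null_cst => e e0; exists 0%N => _ _.
have M1 : 0 < M + 1 by rewrite ltr_wpDl.
have [u [hx hy]] := rxy _ (divr_gt0 e0 M1).
have de : e / (M + 1) * (M + 1) = e by rewrite divfK// gt_eqF.
have h0 := ler_wpM2l M0 (ltW hx).
have h1 := hnormD (y - comb g u) (comb g u); rewrite subrK in h1.
have h2 := hnormD x (comb v u - x); rewrite subrKC hnorm_subC in h2.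
have h3 := gM u; have h4 := ler_wpM2l M0 h2.
move: (e / _) (hnorm x) (hnorm y) (hnorm (x - _)) (hnorm (y - _)) (hnorm (comb v u))
  (hnorm (comb g u)) de h0 hx hy h1 h2 h3 h4 => *; lra.
Qed.

Let rel_lin c x x' y y' : rel x y -> rel x' y' -> rel (c *: x + x') (c *: y + y').
Proof.
move=> r r' e e0.
have c1 : 0 < normc c + 1 by rewrite ltr_wpDl ?normc_ge0.
have [u [hx hy]] := r _ (divr_gt0 e0 (mulr_gt0 (ltr0Sn _ 1) c1)).
have [|u' [hx' hy']] := r' (e / 2); first by rewrite divr_gt0.
exists (kscale c u ++ u'); rewrite !comb_cat !comb_kscale.
have linB (U : lmodType R[i]) (z z' w w' : U) :
    (c *: z + z') - (c *: w + w') = c *: (z - w) + (z' - w').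
  by rewrite scalerBr opprD addrACA.
rewrite !linB.
split; apply: le_lt_trans (hnormD _ _) _; rewrite hnormZ.
  rewrite ltr_pdivlMr ?mulr_gt0// in hx; have := hnorm_ge0 (x - comb v u).
  by move: (normc c) (hnorm (x - _)) (hnorm (x' - _)) hx hx' => *; nra.
rewrite ltr_pdivlMr ?mulr_gt0// in hy; have := hnorm_ge0 (y - comb g u).
by move: (normc c) (hnorm (y - _)) (hnorm (y' - _)) hy hy' => *; nra.
Qed.

Let rel_fun x y y' : rel x y -> rel x y' -> y = y'.
Proof.
move=> r r'; have := rel_norm (rel_lin (-1) r r').
rewrite !scaleN1r addNr hnorm0 mulr0 => le0.
apply/eqP; rewrite eq_sym -subr_eq0 addrC; apply/eqP/hnorm_eq0/eqP.
by rewrite eq_le le0 hnorm_ge0.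
Qed.

Let rel_total x : exists y, rel x y.
Proof.
have inv_gt0 (k : nat) : 0 < k.+1%:R^-1 :> R by rewrite invr_gt0.
have [u hu] := choice (fun k => totv x (inv_gt0 k)).
have hcv : hcvg (fun k => comb v (u k)) x.
  move=> e e0; have [|N hN] := @null_invS R 1 _ e e0; first by [].
  exists N => k /hN; rewrite mul1r hnorm_subC; exact: lt_trans (hu k).
have [y hy] : exists y, hcvg (fun k => comb g (u k)) y.
  apply: hcvg_ex => e e0.
  have M1 : 0 < M + 1 by rewrite ltr_wpDl.
  have [|N hN] := hcv (e / (M + 1) / 2); first by rewrite !divr_gt0.
  have de : e / (M + 1) * (M + 1) = e by rewrite divfK// gt_eqF.
  exists N => i j Ni Nj; have hi := hN i Ni; have hj := hN j Nj.
  have -> : comb g (u i) - comb g (u j) = comb g (u i ++ kscale (-1) (u j)).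
    by rewrite comb_cat comb_kscale scaleN1r.
  apply: le_lt_trans (gM _) _; rewrite comb_cat comb_kscale scaleN1r.
  have h := hnormD (comb v (u i) - x) (x - comb v (u j)).
  rewrite addrA subrK [hnorm (x - _)]hnorm_subC in h.
  have d0 := divr_gt0 e0 M1.
  apply: le_lt_trans (ler_wpM2l M0 (_ : _ <= e / (M + 1))) _; first lra.
  by rewrite -[ltRHS]de mulrDr mulr1 mulrC ltrDl.
exists y => e e0; have [N hN] := hcv e e0; have [N' hN'] := hy e e0.
exists (u (maxn N N')); rewrite hnorm_subC hN ?leq_maxl//.
by rewrite hnorm_subC hN' ?leq_maxr.
Qed.

Lemma bop_extend : exists T : bop V W,
  (forall p, T (v p) = g p) /\ forall x, hnorm (T x) <= M * hnorm x.
Proof.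
have [t ht] := choice rel_total.
have tP : t \in @bounded_op R V W.
  apply/asboolP; split=> [c x y|]; last by exists M => x; apply: rel_norm.
  by apply: rel_fun (ht _) _; apply: rel_lin.
exists (Bop tP); split=> [p|x]; last exact: rel_norm.
apply: rel_fun (ht _) _ => e e0; exists [:: (1, p)].
by rewrite /comb !big_seq1 !scale1r !subrr !hnorm0.
Qed.

End extension.
End total_families.

(** * Operators on tensor products *)

Section schur_product.
Context (R : realType) (E K : hilbertType R) (q : E -> E -> R[i]).
Hypothesis q_lin : forall c x y z, q (c *: x + y) z = c * q x z + q y z.
Hypothesis qC : forall x y, q y x = (q x y)^*.
Hypothesis q_ge0 : forall x, 0 <= q x x.

Let qD x y z : q (x + y) z = q x z + q y z.
Proof. by rewrite -[x in LHS]scale1r q_lin mul1r. Qed.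

Let q0 z : q 0 z = 0.
Proof. by apply: (addrI (q 0 z)); rewrite -qD !addr0. Qed.

Let qZ c x z : q (c *: x) z = c * q x z.
Proof. by rewrite -[c *: x]addr0 q_lin q0 addr0. Qed.

Let q_suml J (s : seq J) (F : J -> E) z : q (\sum_(j <- s) F j) z = \sum_(j <- s) q (F j) z.
Proof. by elim/big_rec2: _ => [|j x y _ <-]; rewrite ?q0 ?qD. Qed.

Let q_sumr J (s : seq J) (F : J -> E) z : q z (\sum_(j <- s) F j) = \sum_(j <- s) q z (F j).
Proof.
rewrite qC q_suml rmorph_sum; apply: eq_bigr => j _ /=.
by rewrite -qC.
Qed.

Let qZr c x z : q z (c *: x) = c^* * q z x.
Proof. by rewrite qC qZ rmorphM/= -!qC. Qed.

Let gram (s : seq (E * K)) : R[i] :=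
  \sum_(a <- s) \sum_(b <- s) q a.1 b.1 * inner a.2 b.2.

(* Splitting off the component of every second factor along that of the head
   leaves a sum with one vector fewer. *)
Lemma schur_ge0 (s : seq (E * K)) :
  0 <= \sum_(a <- s) \sum_(b <- s) q a.1 b.1 * inner a.2 b.2.
Proof.
rewrite -/(gram s).
have [n] := ubnP (size s); elim: n s => // n IH [_|[x y] t /=].
  by rewrite /gram big_nil.
rewrite ltnS => szt.
pose f (a : E * K) := (a.1, a.2 - (inner a.2 y / inner y y) *: y).
have yr : (inner y y)^* = inner y y by rewrite -innerC.
have y0P : inner y y = 0 -> y = 0.
  by move=> y0; apply/eqP; apply: contraTT isT => /inner_gt0; rewrite y0 ltxx.
have fE a b : inner a.2 b.2 =
    inner (f a).2 (f b).2 + inner a.2 y * inner y b.2 / inner y y.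
  rewrite /f /= innerBl !innerBr !innerZl !innerZr.
  (* If y = 0, the quotients are 0 by the convention x / 0 = 0 and [f] changes nothing. *)
  have [y0|y0] := eqVneq (inner y y) 0.
    by rewrite (y0P y0) !inner0l !inner0r; ring.
  rewrite rmorphM/= fmorphV/= yr -innerC.
  by field.
(* The components along [y] add up to one value q z z divided by <y, y>, which is nonnegative. *)
have gramE s : gram s = gram (map f s) +
    q (\sum_(a <- s) inner a.2 y *: a.1) (\sum_(a <- s) inner a.2 y *: a.1) / inner y y.
  rewrite q_suml mulr_suml /gram big_map -big_split; apply: eq_bigr => a _ /=.
  rewrite big_map q_sumr mulr_suml -big_split; apply: eq_bigr => b _ /=.
  rewrite fE qZ qZr -innerC; ring.
rewrite gramE addr_ge0//; last by rewrite divr_ge0// inner_ge0.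
have fy0 : (f (x, y)).2 = 0.
  rewrite /f /=; have [y0|y0] := eqVneq (inner y y) 0.
    by rewrite (y0P y0) scaler0 subrr.
  by rewrite divff// scale1r subrr.
have -> : gram (map f ((x, y) :: t)) = gram (map f t).
  rewrite /gram [map _ _]/= big_cons fy0 big1 ?add0r; last first.
    by move=> b _; rewrite inner0l mulr0.
  apply: eq_bigr => a _; rewrite big_cons fy0.
  by rewrite inner0r mulr0 add0r.
by apply: IH; rewrite size_map.
Qed.

End schur_product.

Section square_sums.
Context (R : realType).

Lemma conj_rc (c : R) : (c%:C)^* = c%:C.
Proof. exact: conjc_real. Qed.

Lemma sum_CS J (s : seq J) (p q : J -> R) :
  \sum_(j <- s) p j * q j <=
  Num.sqrt (\sum_(j <- s) p j ^+ 2) * Num.sqrt (\sum_(j <- s) q j ^+ 2).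
Proof.
elim: s => [|j s IH]; first by rewrite !big_nil sqrtr0 mulr0.
rewrite !big_cons; apply: le_trans (lerD (lexx _) IH) _.
set P := \sum_(j <- s) _; set Q := \sum_(j <- s) _.
have P0 : 0 <= P by apply: sumr_ge0 => *; exact: sqr_ge0.
have Q0 : 0 <= Q by apply: sumr_ge0 => *; exact: sqr_ge0.
have p0 := sqr_ge0 (p j); have q0 := sqr_ge0 (q j).
rewrite -[leRHS]sqrtrM ?addr_ge0//; apply: le_trans (ler_norm _) _.
rewrite -sqrtr_sqr ler_wsqrtr// -[in leRHS](sqr_sqrtr P0) -[in leRHS](sqr_sqrtr Q0).
have := sqr_ge0 (p j * Num.sqrt Q - q j * Num.sqrt P).
move: (Num.sqrt P) (Num.sqrt Q) (p j) (q j) => *; nra.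
Qed.

Lemma hcvg_hnorm (V : hilbertType R) (u : nat -> V) l :
  hcvg u l -> hnorm (u k) @[k --> \oo] --> hnorm l.
Proof.
move=> hu; apply/cvgrPdist_lt => e /hu[N hN]; exists N => // k /= /hN.
apply: le_lt_trans; rewrite ler_norml; apply/andP; split.
  have := hnormD (u k - l) l; rewrite subrK; lra.
have := hnormD (u k) (l - u k); rewrite subrKC hnorm_subC; lra.
Qed.

Lemma bop_hcvg (V W : hilbertType R) (T : bop V W) u l :
  hcvg u l -> hcvg (fun k => T (u k)) (T l).
Proof.
move=> hu; apply: null_le (nullM (opnorm_ge0 T) hu) => k.
by rewrite -bopB opnormP.
Qed.

(** Both sides are continuous in [z], and the combinations [comb v u] are dense. *)
Lemma total_sqr_sum_le (V W : hilbertType R) (I : Type) (v : I -> V) J (s : seq J)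
    (T : J -> bop V W) (c : R) : total v ->
  (forall u, \sum_(j <- s) hnorm (T j (comb v u)) ^+ 2 <= c * hnorm (comb v u) ^+ 2) ->
  forall z, \sum_(j <- s) hnorm (T j z) ^+ 2 <= c * hnorm z ^+ 2.
Proof.
move=> totv h z.
have inv_gt0 (k : nat) : 0 < k.+1%:R^-1 :> R by rewrite invr_gt0.
have [u hu] := choice (fun k => totv z _ (inv_gt0 k)).
have hz : hcvg (fun k => comb v (u k)) z.
  apply: null_le (@null_invS R 1 ltac:(by [])) => k.
  by rewrite mul1r hnorm_subC ltW.
have c1 : \sum_(j <- s) hnorm (T j (comb v (u k))) ^+ 2 @[k --> \oo] -->
    \sum_(j <- s) hnorm (T j z) ^+ 2.
  elim: (s) => [|j t IH].
    by rewrite big_nil; under eq_fun do rewrite big_nil; exact: cvg_cst.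
  rewrite big_cons; under eq_fun do rewrite big_cons.
  by apply: cvgD IH; rewrite expr2; apply: cvgM; apply: hcvg_hnorm; apply: bop_hcvg.
have c2 : c * hnorm (comb v (u k)) ^+ 2 @[k --> \oo] --> c * hnorm z ^+ 2.
  by apply: cvgM; [exact: cvg_cst | rewrite expr2; apply: cvgM; exact: hcvg_hnorm].
by apply: (ler_cvg_to c1 c2); near=> k; exact: h.
Unshelve. all: by end_near. Qed.

Lemma total_inner_eq (V : hilbertType R) (I : Type) (v : I -> V) x y : total v ->
  (forall p, inner (v p) x = inner (v p) y) -> x = y.
Proof.
move=> totv e; apply/eqP; rewrite -subr_eq0; apply/eqP.
have d p : inner (v p) (x - y) = 0 by rewrite innerBr e subrr.
apply: hnorm_eq0; apply: null_cst0; first exact: hnorm_ge0.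
move=> f f0; exists 0%N => _ _; have [u hu] := totv (x - y) f f0.
set w := x - y in d hu *.
have : inner (comb v u) w = 0.
  by rewrite inner_suml big1// => a _; rewrite innerZl d mulr0.
move=> uw; have : normc (inner (w - comb v u) w) <= f * hnorm w.
  by apply: le_trans (inner_CS _ _) _; rewrite ler_wpM2r ?hnorm_ge0 ?ltW.
rewrite innerBl uw subr0 -hnorm_sqr normcC ger0_norm ?exprn_ge0 ?hnorm_ge0//.
have := inner_CS (w - comb v u) w; rewrite innerBl uw subr0 -hnorm_sqr normcC.
rewrite ger0_norm ?exprn_ge0 ?hnorm_ge0// => h _.
have [->//|w0] := eqVneq (hnorm w) 0.
apply: le_lt_trans hu; move: h; rewrite expr2 ler_pM2r//.
by rewrite lt_def w0 hnorm_ge0.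
Qed.

End square_sums.

Section tensor_operators.
Context (R : realType) (E K : hilbertType R).
Implicit Types (A : 'B(E)) (X : 'B(K)).

Definition purep (p : E * K) : tensor E K := pure p.1 p.2.

Lemma total_pure : total purep.
Proof. by move=> z e e0; have [u hu] := pure_dense z e0; exists u. Qed.

Lemma inner_comb_pure (f : E -> E) (g : K -> K)
    (u : seq (R[i] * (E * K))) :
  inner (comb (fun p => pure (f p.1) (g p.2)) u) (comb (fun p => pure (f p.1) (g p.2)) u) =
  \sum_(a <- u) \sum_(b <- u) a.1 * b.1^* * (inner (f a.2.1) (f b.2.1) * inner (g a.2.2) (g b.2.2)).
Proof.
rewrite inner_suml; apply: eq_bigr => a _; rewrite inner_sumr; apply: eq_bigr => b _.
by rewrite innerZl innerZr inner_pure; ring.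
Qed.

(** The form c <x, y> - sum_j <A_j x, A_j y> is positive semidefinite by assumption; [schur_ge0]
    multiplies it by the inner product of the second factors. *)
Lemma ampl (E' K' : hilbertType R) J (s : seq J) (A : J -> 'B(E')) (c : R) :
  (forall x, \sum_(j <- s) hnorm (A j x) ^+ 2 <= c * hnorm x ^+ 2) ->
  forall u : seq (R[i] * (E' * K')), 0 <= \sum_(a <- u) \sum_(b <- u) a.1 * b.1^* *
    ((c%:C * inner a.2.1 b.2.1 - \sum_(j <- s) inner (A j a.2.1) (A j b.2.1)) *
     inner a.2.2 b.2.2).
Proof.
move=> h u.
pose q x y := c%:C * inner x y - \sum_(j <- s) inner (A j x) (A j y).
have ql k x y z : q (k *: x + y) z = k * q x z + q y z.
  rewrite /q innerDl innerZl mulrDr mulrBr mulr_sumr [RHS]addrACA -opprD -big_split.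
  rewrite mulrCA; congr (_ - _); apply: eq_bigr => j _.
  by rewrite bop_lin innerDl innerZl.
have qC x y : q y x = (q x y)^*.
  rewrite /q rmorphB rmorphM /= conj_rc -innerC rmorph_sum.
  by congr (_ - _); apply: eq_bigr => j _; rewrite innerC.
have q0 x : 0 <= q x x.
  rewrite /q -hnorm_sqr -rmorphM /=; under eq_bigr do rewrite -hnorm_sqr.
  by rewrite -rmorph_sum -rmorphB lecR subr_ge0 h.
have := schur_ge0 ql qC q0 [seq (a.1 *: a.2.1, a.2.2) | a <- u].
rewrite big_map; congr (is_true (0 <= _)).
apply: eq_bigr => a _; rewrite big_map; apply: eq_bigr => b _ /=.
rewrite /q innerZl innerZr mulrA; congr (_ * _).
rewrite mulrBr mulr_sumr; congr (_ - _); first by ring.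
by apply: eq_bigr => j _; rewrite !bopZ innerZl innerZr; ring.
Qed.

(** The difference of the two sides is the sum in [ampl]. Thus the column of the A_j (x) I obeys the
    same bound as the column of the A_j. *)
Lemma ampl_left J (s : seq J) (A : J -> 'B(E)) (c : R) :
  (forall x, \sum_(j <- s) hnorm (A j x) ^+ 2 <= c * hnorm x ^+ 2) ->
  forall u, \sum_(j <- s) hnorm (comb (fun p => pure (A j p.1) p.2) u) ^+ 2 <=
    c * hnorm (comb purep u) ^+ 2.
Proof.
move=> h u; rewrite -subr_ge0 -lecR rmorphB rmorphM rmorph_sum /= hnorm_sqr.
under [X in _ - X]eq_bigr => j _ do rewrite hnorm_sqr (inner_comb_pure (A j) id).
rewrite (inner_comb_pure id id); have := ampl h u; congr (is_true (0 <= _)).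
rewrite [in RHS]mulr_sumr [X in _ = _ - X]exchange_big -sumrB; apply: eq_bigr => a _.
rewrite [in RHS]mulr_sumr [X in _ = _ - X]exchange_big -sumrB; apply: eq_bigr => b _ /=.
rewrite mulrBl mulrBr mulr_suml mulr_sumr; congr (_ - _); first by ring.
Qed.

Lemma ampl_right J (s : seq J) (X : J -> 'B(K)) (c : R) :
  (forall x, \sum_(j <- s) hnorm (X j x) ^+ 2 <= c * hnorm x ^+ 2) ->
  forall u, \sum_(j <- s) hnorm (comb (fun p => pure p.1 (X j p.2)) u) ^+ 2 <=
    c * hnorm (comb purep u) ^+ 2.
Proof.
move=> h u; rewrite -subr_ge0 -lecR rmorphB rmorphM rmorph_sum /= hnorm_sqr.
under [X in _ - X]eq_bigr => j _ do rewrite hnorm_sqr (inner_comb_pure id (X j)).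
rewrite (inner_comb_pure id id).
(* Exchanging the two tensor factors reduces this to the same positivity. *)
have := ampl h [seq (a.1, (a.2.2, a.2.1)) | a <- u]; congr (is_true (0 <= _)).
rewrite [in RHS]mulr_sumr [X in _ = _ - X]exchange_big -sumrB big_map; apply: eq_bigr => a _.
rewrite [in RHS]mulr_sumr [X in _ = _ - X]exchange_big -sumrB big_map; apply: eq_bigr => b _ /=.
rewrite mulrBl mulrBr mulr_suml mulr_sumr; congr (_ - _); first by ring.
by apply: eq_bigr => j _; ring.
Qed.

Lemma sqr_le_norm (V W : hilbertType R) (T : bop V W) x :
  hnorm (T x) ^+ 2 <= opnorm T ^+ 2 * hnorm x ^+ 2.
Proof.
by rewrite -exprMn ler_pXn2r ?nnegrE ?mulr_ge0 ?hnorm_ge0 ?opnorm_ge0 ?opnormP.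
Qed.

(** A (x) X is the product of I (x) X and A (x) I, and each factor is bounded on the pure
    combinations by the amplification bound for one operator. *)
Lemma op_tensor_subproof A X : exists S : 'B(tensor E K),
  (forall x y, S (pure x y) = pure (A x) (X y)).
Proof.
have [u|TA [hA _]] := @bop_extend R _ _ _ total_pure _ (fun p => pure (A p.1) p.2) _ (opnorm_ge0 A).
  rewrite -(@ler_pXn2r _ 2)// ?nnegrE ?mulr_ge0 ?hnorm_ge0 ?opnorm_ge0// exprMn.
  have := @ampl_left _ [:: tt] (fun=> A) (opnorm A ^+ 2) _ u; rewrite !big_seq1; apply.
  by move=> x; rewrite big_seq1 sqr_le_norm.
have [u|TX [hX _]] := @bop_extend R _ _ _ total_pure _ (fun p => pure p.1 (X p.2)) _ (opnorm_ge0 X).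
  rewrite -(@ler_pXn2r _ 2)// ?nnegrE ?mulr_ge0 ?hnorm_ge0 ?opnorm_ge0// exprMn.
  have := @ampl_right _ [:: tt] (fun=> X) (opnorm X ^+ 2) _ u; rewrite !big_seq1; apply.
  by move=> x; rewrite big_seq1 sqr_le_norm.
exists (bcomp TX TA) => x y /=.
by rewrite (hA (x, y)) (hX (A x, y)).
Qed.

Lemma op_tensorE A X x y : op_tensor A X (pure x y) = pure (A x) (X y).
Proof.
have [S hS] := op_tensor_subproof A X.
exact: (xgetPex 0 (P := [set S : 'B(tensor E K) |
  forall x y, S (pure x y) = pure (A x) (X y)]) (ex_intro _ S hS)).
Qed.

Lemma op_tensor_uniq A X (S : 'B(tensor E K)) :
  (forall x y, S (pure x y) = pure (A x) (X y)) -> op_tensor A X = S.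
Proof.
by move=> h; apply: (total_eq total_pure) => -[x y]; rewrite /purep op_tensorE h.
Qed.

Lemma pureZr c x y : pure x (c *: y) = c *: pure x y :> tensor E K.
Proof.
have pure0 : pure x 0 = 0 :> tensor E K.
  by apply: (addrI (1 *: pure x (0 : K))); rewrite -pure_linearr !scale1r !addr0.
by rewrite -[c *: y]addr0 pure_linearr pure0 addr0.
Qed.

Lemma op_tensor_linl c A A' X :
  op_tensor (c *: A + A') X = c *: op_tensor A X + op_tensor A' X.
Proof.
apply: op_tensor_uniq => x y.
by rewrite addbE !scalebE !op_tensorE addbE scalebE pure_linearl.
Qed.

Lemma op_tensorZr c A X : op_tensor A (c *: X) = c *: op_tensor A X.
Proof. by apply: op_tensor_uniq => x y; rewrite !scalebE !op_tensorE pureZr. Qed.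

Lemma op_tensor0l X : op_tensor (0 : 'B(E)) X = 0.
Proof.
by have := op_tensor_linl (-1) (0 : 'B(E)) 0 X; rewrite scaler0 addr0 scaleN1r addNr.
Qed.

Lemma adj_op_tensor A X : adj (op_tensor A X) = op_tensor (adj A) (adj X).
Proof.
apply: (total_eq total_pure) => -[x y]; rewrite /purep op_tensorE.
apply: (total_inner_eq total_pure) => -[x' y'].
by rewrite /purep -adjP op_tensorE !inner_pure !adjP.
Qed.

Lemma op_tensor_comp A A' X X' :
  bcomp (op_tensor A X) (op_tensor A' X') = op_tensor (bcomp A A') (bcomp X X').
Proof. by apply/esym/op_tensor_uniq => x y /=; rewrite !op_tensorE. Qed.

(** The sum is the row of the I (x) X_j times the column of the A_j (x) I. After moving I (x) X_j to
    the other side of the inner product, Cauchy-Schwarz over j leaves the two amplified column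
    bounds. *)
Lemma op_tensor_rowcol J (s : seq J) (A : J -> 'B(E)) (X : J -> 'B(K)) (c d : R) :
  0 <= c -> 0 <= d ->
  (forall x, \sum_(j <- s) hnorm (A j x) ^+ 2 <= c ^+ 2 * hnorm x ^+ 2) ->
  (forall y, \sum_(j <- s) hnorm (adj (X j) y) ^+ 2 <= d ^+ 2 * hnorm y ^+ 2) ->
  opnorm (\sum_(j <- s) op_tensor (A j) (X j)) <= c * d.
Proof.
move=> c0 d0 hA hX; apply: opnorm_le => [|z]; first exact: mulr_ge0.
apply: hnorm_le_inner => [|w]; first by rewrite !mulr_ge0 ?hnorm_ge0.
have hz : \sum_(j <- s) hnorm (op_tensor (A j) (bid K) z) ^+ 2 <= (c * hnorm z) ^+ 2.
  rewrite exprMn; move: z; apply: total_sqr_sum_le total_pure _ => u.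
  under eq_bigr do rewrite bop_comb.
  apply: le_trans _ (ampl_left hA u); rewrite le_eqVlt; apply/orP; left; apply/eqP.
  apply: eq_bigr => j _; congr (hnorm _ ^+ _); apply: eq_bigr => p _.
  by rewrite /= /purep op_tensorE.
have hw : \sum_(j <- s) hnorm (op_tensor (bid E) (adj (X j)) w) ^+ 2 <= (d * hnorm w) ^+ 2.
  rewrite exprMn; move: w; apply: total_sqr_sum_le total_pure _ => u.
  under eq_bigr do rewrite bop_comb.
  apply: le_trans _ (ampl_right hX u); rewrite le_eqVlt; apply/orP; left; apply/eqP.
  apply: eq_bigr => j _; congr (hnorm _ ^+ _); apply: eq_bigr => p _.
  by rewrite /= /purep op_tensorE.
rewrite sumbE inner_suml.
have normc_sum (F : J -> R[i]) : normc (\sum_(j <- s) F j) <= \sum_(j <- s) normc (F j).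
  apply: (big_rec2 (fun (x : R[i]) (y : R) => normc x <= y)) => [|j x y _ le_xy].
    by rewrite normc0.
  by apply: le_trans (le_normcD _ _) _; rewrite lerD2l.
apply: le_trans (normc_sum _) _.
apply: le_trans (_ : _ <= \sum_(j <- s) hnorm (op_tensor (A j) (bid K) z) *
    hnorm (op_tensor (bid E) (adj (X j)) w)) _.
  apply: ler_sum => j _; apply: le_trans (inner_CS _ _).
  have -> : op_tensor (A j) (X j) = bcomp (op_tensor (bid E) (X j)) (op_tensor (A j) (bid K)).
    rewrite op_tensor_comp; congr op_tensor; exact: bop_ext.
  by rewrite /= adjP adj_op_tensor adj_bid.
apply: le_trans (sum_CS _ _ _) _; rewrite (mulrAC c) -(mulrA (c * _)).
by apply: ler_pM; rewrite ?sqrtr_ge0// -[leRHS]ger0_norm ?mulr_ge0 ?hnorm_ge0//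
  -sqrtr_sqr ler_wsqrtr.
Qed.

End tensor_operators.

(** * The coefficients b^(m) *)

Section word_sums.
Context (V : nmodType).

Lemma big_tuple0 (T : finType) (F : seq T -> V) : \sum_(g : 0.-tuple T) F g = F [::].
Proof.
rewrite (big_pred1 [tuple]) //.
by move=> g; apply/esym/eqP/tuple0.
Qed.

Lemma big_tupleS (T : finType) k (F : seq T -> V) :
  \sum_(g : k.+1.-tuple T) F g = \sum_(x : T) \sum_(g : k.-tuple T) F (x :: g).
Proof.
rewrite pair_big /=.
rewrite (reindex (fun p : T * k.-tuple T => [tuple of p.1 :: p.2])) /=.
  by apply: eq_bigr => -[x g].
exists (fun g : k.+1.-tuple T => (thead g, [tuple of behead g])) => [[x g] _|g _].
  by congr pair; apply: val_inj.
by rewrite -tuple_eta.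
Qed.

Lemma big_tupleD (T : finType) k l (F : seq T -> V) :
  \sum_(g : (k + l).-tuple T) F g =
  \sum_(g : k.-tuple T) \sum_(h : l.-tuple T) F (g ++ h).
Proof.
elim: k F => [|k IH] F.
  by rewrite (big_tuple0 (fun g : seq T => \sum_(h : l.-tuple T) F (g ++ h))).
rewrite addSn big_tupleS (big_tupleS _ (fun g : seq T => \sum_(h : l.-tuple T) F (g ++ h))).
by apply: eq_bigr => x _; rewrite (IH (fun w => F (x :: w))).
Qed.

End word_sums.

Section convolution.
Context (R : realType) (n : nat) (a : seq 'I_n -> R).
Implicit Types (f g : seq 'I_n -> R) (w : seq 'I_n).

(** The coefficient at [w] of a product of power series in noncommuting indeterminates; [cpow j]
    below gives the coefficients of f^j. *)
Definition conv f g w : R := \sum_(i < (size w).+1) f (take i w) * g (drop i w).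

Fixpoint cpow j : seq 'I_n -> R :=
  if j is j'.+1 then conv a (cpow j') else fun w => (w == [::])%:R.

(* The coefficients of (1 - f)^(-p), where (1 - x)^(-p) = sum_j 'C(j + p - 1, j) x^j
   also for p = 0, as 'C(j - 1, j) = (j == 0). *)
Definition binc (p j : nat) : nat := 'C((j + p - 1)%N, j).
Definition npow p w : R := \sum_(j < (size w).+1) (binc p j)%:R * cpow j w.

Hypothesis a_ge0 : forall w, 0 <= a w.
Hypothesis a0 : a [::] = 0.
Hypothesis a_gt0 : forall i, 0 < a [:: i].

Lemma binc0 p : binc p 0 = 1%N. Proof. exact: bin0. Qed.

Lemma bincS p j : binc p.+1 j.+1 = (binc p.+1 j + binc p j.+1)%N.
Proof.
by rewrite /binc !addSn !addnS !subn1 /= binS addnC.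
Qed.

Lemma binc0S j : binc 0 j.+1 = 0%N.
Proof. by rewrite /binc addn0 subn1 bin_small. Qed.

Lemma cpow_ge0 j w : 0 <= cpow j w.
Proof.
elim: j w => [|j IH] w /=; first exact: ler0n.
by apply: sumr_ge0 => i _; rewrite mulr_ge0.
Qed.

Lemma conv_recl g w : conv a g w = \sum_(i < size w) a (take i.+1 w) * g (drop i.+1 w).
Proof. by rewrite /conv big_ord_recl take0 a0 mul0r add0r. Qed.

(** As [a [::] = 0], each of the j factors uses up a letter. Hence the sum in [npow] may be extended
    to any larger range, as in [npowE]. *)
Lemma cpow_small j w : (size w < j)%N -> cpow j w = 0.
Proof.
elim: j w => // j IH w ltj /=; rewrite conv_recl big1// => i _.
rewrite IH ?mulr0// size_drop; have := ltn_ord i; move: (nat_of_ord i) => k ltk.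
by rewrite ltn_subLR//; apply: leq_trans ltj _; rewrite addSn ltnS leq_addl.
Qed.

Lemma npowE p w N : (size w < N)%N -> npow p w = \sum_(j < N) (binc p j)%:R * cpow j w.
Proof.
move=> ltN; rewrite /npow (big_ord_widen N (fun j => (binc p j)%:R * cpow j w))//.
rewrite [RHS](bigID (fun j : 'I_N => (j < (size w).+1)%N)) /= [X in _ + X]big1 ?addr0//.
by move=> j; rewrite -leqNgt => /cpow_small ->; rewrite mulr0.
Qed.

Lemma npow_nil p : npow p [::] = 1.
Proof. by rewrite /npow big_ord1 binc0 mul1r. Qed.

(** The identity (1 - f)^(-p-1) = (1 - f)^(-p) + f (1 - f)^(-p-1) at the coefficient of [w]; on the
    binomial coefficients it is Pascal's rule [bincS]. *)
Lemma npowS p w : npow p.+1 w = npow p w + conv a (npow p.+1) w.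
Proof.
rewrite {1 2}/npow big_ord_recl [X in _ = X + _]big_ord_recl !binc0 -addrA; congr (_ + _).
under eq_bigr => j _ do rewrite lift0 bincS natrD mulrDl.
rewrite big_split addrC; congr (_ + _).
rewrite conv_recl /=.
under [RHS]eq_bigr => i _.
  rewrite (npowE _ (N := size w)); last first.
    by rewrite size_drop ltn_subrL; case: (size w) i => [[]|].
  rewrite mulr_sumr; over.
rewrite exchange_big; apply: eq_bigr => j _ /=.
rewrite conv_recl mulr_sumr; apply: eq_bigr => i _.
by rewrite mulrCA.
Qed.

Lemma npow_ge0 p w : 0 <= npow p w.
Proof. by apply: sumr_ge0 => j _; rewrite mulr_ge0 ?cpow_ge0. Qed.

Lemma conv_npow_ge0 p w : 0 <= conv a (npow p) w.
Proof. by apply: sumr_ge0 => j _; rewrite mulr_ge0 ?npow_ge0. Qed.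

Lemma npow_le p w : npow p w <= npow p.+1 w.
Proof. by rewrite npowS lerDl conv_npow_ge0. Qed.

Lemma npow_mono p p' w : (p <= p')%N -> npow p w <= npow p' w.
Proof.
move=> /subnK <-; elim: (p' - p)%N => [|k IH]; first by rewrite add0n.
by rewrite addSn; apply: le_trans IH (npow_le _ _).
Qed.

(** Of the recursion [npowS] only the one-letter prefix is kept. This is what bounds the weights of
    the universal model. *)
Lemma npow_cons p i w : a [:: i] * npow p.+1 w <= npow p.+1 (i :: w).
Proof.
rewrite [leRHS]npowS conv_recl /= big_ord_recl /= take0 drop0.
rewrite addrCA lerDl addr_ge0 ?npow_ge0// sumr_ge0// => j _.
by rewrite mulr_ge0 ?npow_ge0.
Qed.

Lemma npow_gt0 p w : 0 < npow p.+1 w.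
Proof.
elim: w => [|i w IH]; first by rewrite npow_nil.
by apply: lt_le_trans (npow_cons _ _ _); rewrite mulr_gt0.
Qed.

(** A prefix of [w] is determined by its length, so a sum over bounded words collapses to a sum over
    the cuts of [w]. *)
Let prefix_sum N w (G : seq 'I_n -> R) : (size w <= N)%N ->
  \sum_(v : {bseq N of 'I_n}) (if take (size v) w == val v then G v else 0) =
  \sum_(i < (size w).+1) G (take i w).
Proof.
move=> leN.
transitivity (\sum_(v : {bseq N of 'I_n}) \sum_(i < (size w).+1 | take i w == val v) G v).
  apply: eq_bigr => v _; case: ifP => [/eqP e|ne].
    have lev : (size v < (size w).+1)%N.
      by rewrite ltnS -[X in (size X <= _)%N]e size_take_min geq_minr.
    rewrite (big_pred1 (Ordinal lev))// => i /=; apply/eqP/eqP => [ei|->//].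
    apply: val_inj => /=; rewrite -[in RHS]ei size_takel//.
    by rewrite -ltnS ltn_ord.
  rewrite big1// => i /eqP ei.
  have sv : size v = i by rewrite -[bseqval v]/(val v) -ei size_takel// -ltnS ltn_ord.
  by move: ne; rewrite sv ei eqxx.
rewrite (exchange_big_dep xpredT)//=; apply: eq_bigr => i _.
have le_i : (size (take i w) <= N)%N.
  by rewrite size_take_min (leq_trans (geq_minr _ _)).
by rewrite (big_pred1 (Bseq le_i)).
Qed.

(** Induction on [j] peels off the first factor, which must be a prefix of [w]. The bound [N] is
    kept apart from [size w] because the rest of the word shrinks while the finite type of the
    factors stays. Empty factors are excluded on the left and weighted by [a [::] = 0] on the
    right. *)
Lemma flatten_sum N j w : (size w <= N)%N ->
  \sum_(g : j.-tuple {bseq N of 'I_n} |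
        all (fun v : {bseq N of 'I_n} => 0 < size v)%N g &&
        (flatten [seq val v | v <- g] == w))
    \prod_(v <- g) a v = cpow j w.
Proof.
rewrite big_mkcond; elim: j w => [|j IH] w leN.
  rewrite (big_tuple0 (fun g : seq {bseq N of 'I_n} =>
    if all (fun v : {bseq N of 'I_n} => 0 < size v)%N g &&
        (flatten [seq val v | v <- g] == w) then \prod_(v <- g) a v else 0)) /=.
  by rewrite big_nil eq_sym; case: eqP.
rewrite (big_tupleS _ (fun g : seq {bseq N of 'I_n} =>
    if all (fun v : {bseq N of 'I_n} => 0 < size v)%N g &&
        (flatten [seq val v | v <- g] == w) then \prod_(v <- g) a v else 0)) /=.
transitivity (\sum_(i < (size w).+1)
    a (take i w) * cpow j (drop (size (take i w)) w)); last first.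
  by apply: eq_bigr => i _; rewrite size_takel// -ltnS ltn_ord.
rewrite -(prefix_sum (fun v => a v * cpow j (drop (size v) w)) leN); apply: eq_bigr => v _.
case: (altP eqP) => [e|ne]; last first.
  rewrite big1// => g _; case: andP => // -[_ /eqP ew].
  by case/eqP: ne; rewrite -ew take_size_cat.
have [v0|v0] := posnP (size v).
  rewrite (size0nil v0) a0 mul0r big1// => g _.
rewrite -[in RHS]IH ?size_drop ?leq_subLR ?(leq_trans leN) ?leq_addl//.
rewrite mulr_sumr; apply: eq_bigr => g _.
rewrite big_cons /= -[X in _ ++ _ == X](cat_take_drop (size v) w) e eqseq_cat// eqxx /=.
by case: ifP; rewrite ?mulr0.
Qed.

Lemma bcoef_npow m w : bcoef m.+1 a w = npow m.+1 w.
Proof.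
case: w => [|i w]; first by rewrite npow_nil.
(* The power f^0 = 1 has no term at a nonempty word, so that both sums start at j = 1. *)
rewrite /npow big_ord_recl (_ : cpow (@ord0 _) (i :: w) = 0)// mulr0 add0r /bcoef.
rewrite big_add1 big_mkord; apply: eq_bigr => j _.
rewrite lift0 -(@flatten_sum (size (i :: w)))// -mulr_suml mulrC; congr (_ * _).
  by rewrite /binc addnS !subn1 /= -[in RHS]bin_sub ?leq_addr// addKn.
by apply: eq_bigr => g _; rewrite [RHS]big_tuple.
Qed.

End convolution.

(** * The universal model *)

Section orthonormal_families.
Context (R : realType) (I : eqType).

Definition onfamily (V : hilbertType R) (v : I -> V) :=
  forall p q, inner (v p) (v q) = (p == q)%:R.

Definition coef (u : seq (R[i] * I)) (p : I) : R[i] := \sum_(a <- u | a.2 == p) a.1.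

(** A combination may repeat an index; collecting equal ones makes [pythagoras] applicable. *)
Lemma comb_coef (V : lmodType R[i]) (g : I -> V) u :
  comb g u = \sum_(p <- undup [seq a.2 | a <- u]) coef u p *: g p.
Proof.
under eq_bigr do rewrite /coef scaler_suml.
rewrite (exchange_big_dep xpredT)//=; rewrite /comb; apply: eq_big_seq => a au.
rewrite big_mkcond (bigD1_seq a.2) ?undup_uniq ?mem_undup ?map_f//= eqxx.
by rewrite big1 ?addr0// => p; rewrite eq_sym => /negbTE ->.
Qed.

Lemma pythagoras (V : hilbertType R) (v : I -> V) (c : I -> R[i]) s : onfamily v -> uniq s ->
  hnorm (\sum_(p <- s) c p *: v p) ^+ 2 = \sum_(p <- s) normc (c p) ^+ 2.
Proof.
move=> ov us; apply: (@complexI R); rewrite hnorm_sqr inner_suml rmorph_sum /=.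
apply: eq_big_seq => p ps; rewrite inner_sumr (bigD1_seq p)//= big1 ?addr0.
  by rewrite innerZl innerZr ov eqxx mulr1 -normCK rmorphXn.
by move=> q qp; rewrite innerZl innerZr ov eq_sym (negbTE qp) !mulr0.
Qed.

(** With both families orthonormal, Pythagoras reduces the norm bound to the bound on the single
    weights. *)
Lemma weighted_extend (V W : hilbertType R) (v : I -> V) (h : I -> W) (w : I -> R) M :
  total v -> onfamily v -> onfamily h -> 0 <= M -> (forall p, `|w p| <= M) ->
  exists T : bop V W, (forall p, T (v p) = (w p)%:C *: h p) /\ opnorm T <= M.
Proof.
move=> tv ov oh M0 wM.
have [u|T [TE TM]] := bop_extend tv (g := fun p => (w p)%:C *: h p) M0.
  rewrite -(@ler_pXn2r _ 2)// ?nnegrE ?mulr_ge0 ?hnorm_ge0// exprMn !comb_coef.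
  under eq_bigr do rewrite scalerA.
  rewrite !pythagoras ?undup_uniq// mulr_sumr; apply: ler_sum => p _.
  rewrite normcM normcC exprMn mulrC ler_wpM2r ?sqr_ge0//.
  by rewrite ler_pXn2r ?nnegrE.
by exists T; split=> //; exact: opnorm_le.
Qed.

Lemma weighted_opnorm (V W : hilbertType R) (v : I -> V) (h : I -> W) (w : I -> R) M
    (T : bop V W) :
  total v -> onfamily v -> onfamily h -> 0 <= M -> (forall p, `|w p| <= M) ->
  (forall p, T (v p) = (w p)%:C *: h p) -> opnorm T <= M.
Proof.
move=> tv ov oh M0 wM TE; have [S [SE SM]] := weighted_extend tv ov oh M0 wM.
by rewrite (total_eq tv (S := T) (T := S))// => p; rewrite TE SE.
Qed.

End orthonormal_families.

Section weak_convergence.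
Context (R : realType).

Lemma wot_cvgP (V W : hilbertType R) (T : nat -> bop V W) S :
  wot_cvg T S <-> forall x y, ccvg (fun N => inner (T N x) y) (inner (S x) y).
Proof.
by split=> h x y; have := h x y; rewrite null_ge0P// => k; exact: normc_ge0.
Qed.

Lemma wot_cvg_uniq (V W : hilbertType R) (T : nat -> bop V W) S S' :
  wot_cvg T S -> wot_cvg T S' -> S = S'.
Proof.
move=> /wot_cvgP h /wot_cvgP h'; apply: bop_ext => x; apply: inner_injl => y.
exact: ccvg_uniq (h x y) (h' x y).
Qed.

(** Uniform boundedness and density turn eventual equality on a total family into strong
    convergence, hence into weak convergence. *)
Lemma wot_cvg_total (V W : hilbertType R) (I : Type) (v : I -> V)
    (T : nat -> bop V W) (S : bop V W) (C : R) :
  total v -> (forall N, opnorm (T N) <= C) ->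
  (forall p, exists N0, forall N, (N0 <= N)%N -> T N (v p) = S (v p)) -> wot_cvg T S.
Proof.
move=> tv TC TS; apply/wot_cvgP => x y.
have C0 : 0 <= C by exact: le_trans (opnorm_ge0 _) (TC 0%N).
suff h : hcvg (fun N => T N x) (S x) by exact: hcvg_inner.
move=> e e0; set D := C + opnorm S + 1.
have D0 : 0 < D by rewrite ltr_wpDl ?addr_ge0 ?opnorm_ge0.
have [u hu] := tv x _ (divr_gt0 e0 D0).
have [N0 hN0] : exists N0, forall N, (N0 <= N)%N -> T N (comb v u) = S (comb v u).
  elim: (u) => [|[c p] t [N1 hN1]].
    by exists 0%N => N _; rewrite /comb big_nil !bop0.
  have [N2 hN2] := TS p; exists (maxn N1 N2) => N; rewrite geq_max => /andP[h1 h2].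
  by rewrite /comb big_cons !bopD !bopZ hN2// -/(comb v t) hN1.
exists N0 => N /hN0 e1.
have -> : T N x - S x = (T N - S) (x - comb v u).
  by rewrite bopB [(T N - S) (comb v u)]subbE e1 subrr subr0.
apply: le_lt_trans (opnormP _ _) _; rewrite ltr_pdivlMr// mulrC in hu.
apply: le_lt_trans hu; rewrite ler_wpM2r ?hnorm_ge0//.
apply: le_trans (opnormD _ _) _; rewrite opnormN.
by have := TC N; rewrite /D; lra.
Qed.

End weak_convergence.

Section cut_sums.
Context (R : realType) (tau : nat -> R).
Hypothesis tau_ge0 : forall k, 0 <= tau k.

Lemma sum_cut N L : (L <= N)%N ->
  \sum_(k < N) (if (k < L)%N then tau k else 0) = \sum_(k < L) tau k.
Proof. by move=> LN; rewrite (big_ord_widen N tau LN) [RHS]big_mkcond. Qed.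

Lemma sum_cut_le N L :
  \sum_(k < N) (if (k < L)%N then tau k else 0) <= \sum_(k < L) tau k.
Proof.
have [NL|/ltnW LN] := leqP N L; last by rewrite sum_cut.
apply: le_trans (_ : _ <= \sum_(k < N) tau k) _.
  by apply: ler_sum => k _; case: ifP.
rewrite (big_ord_widen L tau NL) [leLHS]big_mkcond; apply: ler_sum => k _.
by case: ifP.
Qed.

End cut_sums.

Section Phi_limits.
Context (R : realType) (n : nat) (a : seq 'I_n -> R) (K : hilbertType R).
Implicit Types (X : 'I_n -> 'B(K)) (Y : 'B(K)).

Lemma Phi_unique X Y Z : wot_cvg (Phi_partial a X Y) Z -> Phi a X Y = Z.
Proof.
move=> hZ; apply: (wot_cvg_uniq _ hZ).
exact: (xgetPex 0 (P := [set Z | wot_cvg (Phi_partial a X Y) Z]) (ex_intro _ Z hZ)).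
Qed.

Lemma Phi_cvg X Y : Phi_defined a X Y -> wot_cvg (Phi_partial a X Y) (Phi a X Y).
Proof. by case=> Z hZ; rewrite (Phi_unique hZ). Qed.

End Phi_limits.

Section universal_model.
Context (R : realType) (n m : nat) (a : seq 'I_n -> R).
Hypothesis a_ge0 : forall w, 0 <= a w.
Hypothesis a0 : a [::] = 0.
Hypothesis a_gt0 : forall i, 0 < a [:: i].

Local Notation b := (npow a m.+1).
Local Notation e := (@fbasis R n).
Local Notation W := (univ_model m.+1 a).
Local Notation pw := (npow_gt0 a_ge0 a0 a_gt0).

Lemma total_fbasis : total e.
Proof. by move=> z d d0; have [u hu] := fbasis_dense z d0; exists u; exact: hu. Qed.

Lemma onfamily_fbasis : onfamily e.
Proof. exact: inner_fbasis. Qed.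

Lemma univ_modelE i w : W i (e w) = (Num.sqrt (b w / b (i :: w)))%:C *: e (i :: w).
Proof.
have oi : onfamily (fun w => e (i :: w)).
  by move=> p q; rewrite onfamily_fbasis eqseq_cons eqxx.
(* By [npow_cons] the weights are at most a_i^(-1/2), so the description of W_i is satisfied by a
   bounded operator. *)
have [|p|T [TE _]] := weighted_extend (w := fun w => Num.sqrt (b w / b (i :: w)))
    (M := Num.sqrt (a [:: i])^-1) total_fbasis onfamily_fbasis oi.
- exact: sqrtr_ge0.
- rewrite ger0_norm ?sqrtr_ge0// ler_wsqrtr// ler_pdivrMr ?pw//.
  by rewrite mulrC ler_pdivlMr ?a_gt0// mulrC npow_cons.
have TP : [set T : 'B(fock R n) | forall alpha, T (e alpha) =
    (Num.sqrt (bcoef m.+1 a alpha / bcoef m.+1 a (i :: alpha)))%:C *: e (i :: alpha)] T.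
  by move=> alpha; rewrite TE !(bcoef_npow a0).
by have := xgetPex 0 (ex_intro _ T TP) w; rewrite !(bcoef_npow a0).
Qed.

(** The weights telescope along the word [v]. *)
Lemma wprod_univ_model v w :
  wprod W v (e w) = (Num.sqrt (b w / b (v ++ w)))%:C *: e (v ++ w).
Proof.
elim: v => [|i v IH] /=; first by rewrite divff ?gt_eqF ?pw// sqrtr1 scale1r.
rewrite IH bopZ univ_modelE scalerA -rcM -sqrtrM ?divr_ge0 ?npow_ge0//.
by rewrite mulrA divfK// gt_eqF ?pw.
Qed.

Lemma adj_wprod_univ_model v w : adj (wprod W v) (e w) =
  if take (size v) w == v
  then (Num.sqrt (b (drop (size v) w) / b w))%:C *: e (drop (size v) w) else 0.
Proof.
apply: (total_inner_eq total_fbasis) => z.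
rewrite -adjP wprod_univ_model innerZl onfamily_fbasis.
case: ifPn => [/eqP e1|ne].
  have wE : v ++ drop (size v) w = w by rewrite -{1}e1 cat_take_drop.
  rewrite innerZr conj_rc onfamily_fbasis -[X in _ == X]wE eqseq_cat// eqxx /=.
  by case: eqP => [->|_]; rewrite ?wE ?mulr0.
rewrite inner0r; case: eqP => [e2|_]; last by rewrite mulr0.
by case/eqP: ne; rewrite -e2 take_size_cat.
Qed.

Definition diagonal (d : seq 'I_n -> R) (D : 'B(fock R n)) :=
  forall w, D (e w) = (d w)%:C *: e w.

Lemma diagonal_ex d M : 0 <= M -> (forall w, `|d w| <= M) -> exists D, diagonal d D.
Proof.
move=> M0 dM; have [D [DE _]] :=
  weighted_extend total_fbasis onfamily_fbasis onfamily_fbasis M0 dM.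
by exists D.
Qed.

Lemma diagonal_uniq d D D' : diagonal d D -> diagonal d D' -> D = D'.
Proof. by move=> h h'; apply: (total_eq total_fbasis) => w; rewrite h h'. Qed.

(** The diagonal operator Q of the square roots is self-adjoint with D = Q Q, whence <D x, x> = |Q
    x|^2. *)
Lemma diagonal_ge0 d M D : 0 <= M -> (forall w, 0 <= d w <= M) -> diagonal d D -> op_ge0 D.
Proof.
move=> M0 dM hD.
have [|w|Q hQ] := @diagonal_ex (fun w => Num.sqrt (d w)) (Num.sqrt M).
- exact: sqrtr_ge0.
- by rewrite ger0_norm ?sqrtr_ge0// ler_wsqrtr//; case/andP: (dM w).
have adjQ : adj Q = Q.
  apply: (total_eq total_fbasis) => w; apply: (total_inner_eq total_fbasis) => z.
  rewrite -adjP !hQ innerZl innerZr conj_rc onfamily_fbasis.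
  by case: eqP => [->|_]; rewrite ?mulr0.
have -> : D = bcomp Q Q.
  apply: (diagonal_uniq hD) => w; rewrite /= hQ bopZ hQ scalerA -rcM -expr2 sqr_sqrtr//.
  by case/andP: (dM w).
by move=> x; rewrite /= adjP adjQ inner_ge0.
Qed.

(** The contribution to the diagonal entry at [w] of its prefix of length [k.+1], the only word of
    that length whose term does not kill e_w. *)
Let tau (d : seq 'I_n -> R) w k : R :=
  a (take k.+1 w) * (b (drop k.+1 w) * d (drop k.+1 w)) / b w.

Let Phi_term d D v w : diagonal d D ->
  bcomp (wprod W v) (bcomp D (adj (wprod W v))) (e w) =
  if take (size v) w == v
  then (b (drop (size v) w) * d (drop (size v) w) / b w)%:C *: e w else 0.
Proof.
move=> hD; rewrite /= adj_wprod_univ_model; case: ifP => [/eqP e1|_]; last by rewrite !bop0.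
have wE : v ++ drop (size v) w = w by rewrite -{1}e1 cat_take_drop.
rewrite !bopZ hD !bopZ wprod_univ_model wE !scalerA -!rcM.
rewrite mulrAC -expr2 sqr_sqrtr ?divr_ge0 ?npow_ge0//.
by rewrite mulrAC.
Qed.

Let Phi_partial_diag d D N w : diagonal d D -> Phi_partial a W D N (e w) =
  (\sum_(k < N) (if (k < size w)%N then tau d w k else 0))%:C *: e w.
Proof.
move=> hD; rewrite /Phi_partial sumbE big_add1 big_mkord rmorph_sum /= scaler_suml.
apply: eq_bigr => k _; rewrite sumbE.
under eq_bigr => v _ do rewrite scalebE (Phi_term _ _ hD) size_tuple.
case: ifPn => [ltk|gek].
  have st : size (take k.+1 w) == k.+1 by rewrite size_takel.
  rewrite (bigD1 (Tuple st)) //= big1 ?addr0 => [|v]; last first.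
    rewrite -val_eqE /= eq_sym => /negbTE ->; exact: scaler0.
  by rewrite eqxx scalerA -rcM mulrA.
rewrite scale0r big1// => v _; case: eqP => [ev|]; last by rewrite scaler0.
by have := size_tuple v; rewrite -ev size_take_min; move: gek; rewrite -leqNgt; lia.
Qed.

(** The terms are nonnegative, so each partial sum is a diagonal operator with entries at most 1,
    and at e_w nothing changes from N = |w| on; [wot_cvg_total] applies. *)
Lemma Phi_diagonal d D : (forall w, 0 <= d w) ->
  (forall w, conv a (fun v => b v * d v) w / b w <= 1) -> diagonal d D ->
  exists Z, wot_cvg (Phi_partial a W D) Z /\
    diagonal (fun w => conv a (fun v => b v * d v) w / b w) Z.
Proof.
move=> d0 c1 hD.
have tau0 w k : 0 <= tau d w k.
  by rewrite divr_ge0 ?npow_ge0// mulr_ge0// mulr_ge0 ?npow_ge0.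
have convE w : conv a (fun v => b v * d v) w / b w = \sum_(k < size w) tau d w k.
  by rewrite (conv_recl a0) mulr_suml.
have [|w|Z hZ] := @diagonal_ex (fun w => conv a (fun v => b v * d v) w / b w) 1.
- by [].
- by rewrite ger0_norm// convE sumr_ge0.
exists Z; split=> //; apply: (@wot_cvg_total _ _ _ _ _ _ _ 1 total_fbasis) => [N|w].
  apply: (weighted_opnorm total_fbasis onfamily_fbasis onfamily_fbasis _ _
    (fun w => Phi_partial_diag N w hD)) => // w.
  rewrite ger0_norm ?sumr_ge0// => [|k _]; last by case: ifP.
  by apply: le_trans (c1 w); rewrite convE; exact: sum_cut_le.
exists (size w) => N leN; rewrite (Phi_partial_diag N w hD) hZ convE.
by rewrite sum_cut.
Qed.

(** By [npowS] an application of id - Phi_W lowers the exponent in the numerator from p + 1 to p.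
    The entries needed for [Phi_diagonal] are at most 1 because the coefficients increase with the
    exponent. *)
Let defect_step p D : diagonal (fun w => npow a p.+1 w / b w) D -> (p <= m)%N ->
  exists Z, wot_cvg (Phi_partial a W D) Z /\
    diagonal (fun w => npow a p w / b w) (D - Z).
Proof.
move=> hD pm; have bne w : b w != 0 by rewrite gt_eqF ?pw.
have convE w : conv a (fun v => b v * (npow a p.+1 v / b v)) w =
    npow a p.+1 w - npow a p w.
  rewrite npowS// addrC addKr; apply: eq_bigr => k _.
  by congr (_ * _); rewrite /= mulrC divfK.
have [w|w|Z [hZ dZ]] := Phi_diagonal _ _ hD.
- by rewrite divr_ge0 ?npow_ge0.
- rewrite convE ler_pdivrMr ?pw// mul1r.
  have := npow_mono a_ge0 a0 w (_ : p.+1 <= m.+1)%N; have := npow_ge0 a_ge0 p w.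
  by move=> ? /(_ pm); lra.
exists Z; split=> // w; rewrite subbE hD dZ convE -scalerBl -rmorphB /=.
by rewrite mulrBl opprB addrC subrK.
Qed.

Lemma univ_model_Dom : Dom m.+1 a W.
Proof.
(* At k = m.+1 the numerator is the coefficient family of the constant series 1, and the defect is
   the projection onto e_[]. *)
have hd k : (k <= m.+1)%N -> diagonal (fun w => npow a (m.+1 - k) w / b w) (defect a W k).
  elim: k => [_ w|k IH ltk].
    by rewrite subn0 divff ?gt_eqF ?pw// scale1r.
  have [] := @defect_step (m - k) (defect a W k) _ (leq_subr _ _).
    by rewrite -subSn//; apply: IH; exact: ltnW.
  by move=> Z [hZ dZ]; rewrite /= -/(defect a W k) (Phi_unique hZ) subSS.
move=> k /andP[k1 km]; split.
  have [] := @defect_step (m - k.-1) (defect a W k.-1) _ (leq_subr _ _).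
    by rewrite -subSn; [apply: hd; lia | lia].
  by move=> Z [hZ _]; exists Z.
apply: (@diagonal_ge0 _ 1 _ _ _ (hd k km)) => // w.
rewrite divr_ge0 ?npow_ge0//= ler_pdivrMr ?pw// mul1r.
by apply: npow_mono; rewrite ?leq_subr.
Qed.

End universal_model.

(** * Recovering coefficients from values *)

Section orthonormal_sequences.
Context (R : realType) (H : hilbertType R).

Let gram_schmidt_step k (h : nat -> H) : infinite_dimensional H ->
  (forall i j, (i < k)%N -> (j < k)%N -> inner (h i) (h j) = (i == j)%:R) ->
  exists y, inner y y = 1 /\ forall i, (i < k)%N -> inner y (h i) = 0.
Proof.
move=> infH oh.
have [x hx] : exists x, forall c : 'I_k -> R[i], x <> \sum_(j < k) c j *: h j.
  apply: contrapT => nx; apply: infH; exists k, (fun j : 'I_k => h j) => x.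
  by apply: contrapT => nc; apply: nx; exists x => c e; apply: nc; exists c.
pose y := x - \sum_(j < k) inner x (h j) *: h j.
have y0 : 0 < hnorm y.
  rewrite lt_def hnorm_ge0 andbT; apply/eqP => /hnorm_eq0/eqP.
  by rewrite subr_eq0 => /eqP; exact: hx.
exists ((hnorm y)^-1%:C *: y); split=> [|i ik].
  rewrite innerZl innerZr conj_rc -hnorm_sqr -!rcM mulrA -expr2 exprVn.
  by rewrite mulVf// expf_neq0// gt_eqF.
rewrite innerZl innerBl inner_suml (bigD1 (Ordinal ik)) //= big1 => [|j ji].
  by rewrite innerZl oh// eqxx mulr1 addr0 subrr mulr0.
by rewrite innerZl oh// (_ : (j == i :> nat) = false) ?mulr0//; apply/negbTE.
Qed.

Lemma onfamily_nat : infinite_dimensional H -> exists h : nat -> H, onfamily h.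
Proof.
move=> infH.
(* The next vector depends on all previous ones, so the choice function takes their list; on lists
   that are not orthonormal its value is arbitrary. *)
have step (l : seq H) : exists y,
    (forall i j, (i < size l)%N -> (j < size l)%N -> inner l`_i l`_j = (i == j)%:R) ->
    inner y y = 1 /\ forall i, (i < size l)%N -> inner y l`_i = 0.
  have [hl|nhl] := pselect (forall i j, (i < size l)%N -> (j < size l)%N ->
    inner l`_i l`_j = (i == j)%:R); last by exists 0 => /nhl.
  by have [y hy] := gram_schmidt_step infH hl; exists y.
have [f hf] := choice step.
pose L k := iter k (fun l => rcons l (f l)) [::].
pose h k := f (L k).
have LE k : L k = mkseq h k.
  by elim: k => // k IH; rewrite mkseqS -IH.
have on k : (forall i j, (i < k)%N -> (j < k)%N -> inner (h i) (h j) = (i == j)%:R).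
  elim: k => // k IH.
  have hk : inner (h k) (h k) = 1 /\ forall i, (i < k)%N -> inner (h k) (h i) = 0.
    have [|h1 h2] := hf (L k).
      move=> i j; rewrite LE size_mkseq => ik jk; rewrite !nth_mkseq//; exact: IH.
    split=> // i ik; have := h2 i; rewrite LE size_mkseq nth_mkseq// -LE.
    exact.
  move=> i j; rewrite ltnS leq_eqVlt => /predU1P[->|ik];
    rewrite ltnS leq_eqVlt => /predU1P[->|jk].
  - by rewrite hk.1 eqxx.
  - by rewrite hk.2// gtn_eqF.
  - by rewrite innerC hk.2// rmorph0 ltn_eqF.
  - exact: IH.
by exists h => p q; apply: (on (maxn p q).+1); rewrite ltnS ?leq_maxl ?leq_maxr.
Qed.

Lemma onfamily_count (I : countType) :
  infinite_dimensional H -> exists h : I -> H, onfamily h.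
Proof.
move=> /onfamily_nat[h oh]; exists (h \o pickle) => p q.
by rewrite /= oh (inj_eq (pcan_inj pickleK)).
Qed.

End orthonormal_sequences.

(** * Transport of a tuple along an isometry *)

Section isometric_transport.
Context (R : realType) (n : nat) (a : seq 'I_n -> R) (K H : hilbertType R).
Context (V : bop K H) (X : 'I_n -> 'B(K)).
Hypothesis V_iso : forall x, adj V (V x) = x.

Definition conj_by (T : 'B(K)) : 'B(H) := bcomp V (bcomp T (adj V)).
Local Notation XV := (fun i => conj_by (X i)).

Lemma conj_by_lin c S T : conj_by (c *: S + T) = c *: conj_by S + conj_by T.
Proof.
apply: bop_ext => x; transitivity (c *: V (S (adj V x)) + V (T (adj V x))) => //.
by rewrite -bop_lin.
Qed.

Lemma conj_by0 : conj_by 0 = 0.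
Proof. by apply: bop_ext => x; exact: bop0. Qed.

Lemma conj_byZ c T : conj_by (c *: T) = c *: conj_by T.
Proof. by rewrite -[c *: T]addr0 conj_by_lin conj_by0 addr0. Qed.

Lemma conj_by_sum J (s : seq J) (P : pred J) (F : J -> 'B(K)) :
  conj_by (\sum_(j <- s | P j) F j) = \sum_(j <- s | P j) conj_by (F j).
Proof.
elim/big_rec2: _ => [|j x y _ <-]; first exact: conj_by0.
by rewrite -[F j]scale1r conj_by_lin !scale1r.
Qed.

Lemma conj_by_comp S T : conj_by (bcomp S T) = bcomp (conj_by S) (conj_by T).
Proof. by apply: bop_ext => x /=; rewrite V_iso. Qed.

Lemma wprod_conj_by w y : wprod XV w (V y) = V (wprod X w y).
Proof. by elim: w => //= i w ->; rewrite V_iso. Qed.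

(** Only for nonempty words: the empty product is the identity of [H], whereas [conj_by] sends the
    identity of [K] to the projection V V^*. *)
Lemma wprod_conj_by_cons i w : wprod XV (i :: w) = conj_by (wprod X (i :: w)).
Proof.
elim: w i => [|j w IH] i /=.
  by apply: bop_ext => x.
rewrite -[bcomp (conj_by (X j)) _]/(wprod XV (j :: w)) IH -conj_by_comp.
by [].
Qed.

Lemma adj_conj_by T : adj (conj_by T) = conj_by (adj T).
Proof. by rewrite !adj_comp adjK; apply: bop_ext. Qed.

Lemma Phi_partial_conj_by Y N : Phi_partial a XV Y N =
  conj_by (Phi_partial a X (bcomp (adj V) (bcomp Y V)) N).
Proof.
rewrite /Phi_partial conj_by_sum !big_add1 !big_mkord; apply: eq_bigr => k _.
rewrite conj_by_sum; apply: eq_bigr => w _; rewrite conj_byZ; congr (_ *: _).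
case: w => -[//|i w] sw; rewrite wprod_conj_by_cons adj_conj_by.
by apply: bop_ext => x.
Qed.

Lemma wot_cvg_conj_by (T : nat -> 'B(K)) S :
  wot_cvg T S -> wot_cvg (fun N => conj_by (T N)) (conj_by S).
Proof.
move=> /wot_cvgP h; apply/wot_cvgP => x y.
have := h (adj V x) (adj V y); apply: null_le => N.
by rewrite /= !(adjP V).
Qed.

(** On the orthogonal complement of the range of [V] the transported tuple is 0, so the defect
    remains the identity there; the second summand is the projection onto that complement. *)
Lemma defect_conj_by k : (forall j, (j < k)%N -> Phi_defined a X (defect a X j)) ->
  defect a XV k = conj_by (defect a X k) + (bid H - bcomp V (adj V)).
Proof.
elim: k => [|k IH] hk /=; first by apply: bop_ext => x; rewrite addbE subbE subrKC.
have {}IH := IH (fun j jk => hk j (leqW jk)).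
rewrite (Phi_unique (Z := conj_by (Phi a X (defect a X k)))).
  rewrite IH addrAC; congr (_ + _).
  by rewrite -[- conj_by _]scaleN1r addrC -conj_by_lin scaleN1r addrC.
have -> : Phi_partial a XV (defect a XV k) =
    fun N => conj_by (Phi_partial a X (defect a X k) N).
  apply/funext => N; rewrite Phi_partial_conj_by; congr conj_by; congr Phi_partial.
  rewrite IH; apply: bop_ext => x.
  transitivity (adj V (V (defect a X k (adj V (V x))) + (V x - V (adj V (V x))))) => //.
  by rewrite !V_iso subrr addr0 V_iso.
by apply: wot_cvg_conj_by; apply: Phi_cvg; exact: hk.
Qed.

Lemma Dom_conj_by m : Dom m a X -> Dom m a XV.
Proof.
move=> dX k km; have /andP[k1 lekm] := km.
have hdef j : (j < k)%N -> Phi_defined a X (defect a X j).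
  by move=> jk; have [] := dX j.+1; rewrite //= (leq_trans jk).
have [[Z hZ] pos] := dX k km; split.
  exists (conj_by Z).
  have -> : Phi_partial a XV (defect a XV k.-1) =
      fun N => conj_by (Phi_partial a X (defect a X k.-1) N).
    apply/funext => N; rewrite Phi_partial_conj_by; congr conj_by; congr Phi_partial.
    rewrite defect_conj_by => [|j jk]; last by apply: hdef; apply: leq_trans jk (leq_pred _).
    apply: bop_ext => x.
    transitivity (adj V (V (defect a X k.-1 (adj V (V x))) + (V x - V (adj V (V x))))) => //.
    by rewrite !V_iso subrr addr0 V_iso.
  exact: wot_cvg_conj_by.
rewrite defect_conj_by// => x.
rewrite addbE innerDl addr_ge0//; first by rewrite /= adjP.
have -> : (bid H - bcomp V (adj V)) x = x - V (adj V x) by [].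
(* An orthogonal projection is positive: x - V V^* x is orthogonal to the range of [V]. *)
have <- : inner (x - V (adj V x)) (x - V (adj V x)) = inner (x - V (adj V x)) x.
  rewrite innerBr [X in _ - X](_ : _ = 0) ?subr0//.
  by rewrite -adjPr bopB V_iso subrr inner0l.
exact: inner_ge0.
Qed.

End isometric_transport.

(** * Matrix entries and coefficients at the model *)

Section model_families.
Context (R : realType) (n m : nat) (a : seq 'I_n -> R).
Hypothesis a_ge0 : forall w, 0 <= a w.
Hypothesis a0 : a [::] = 0.
Hypothesis a_gt0 : forall i, 0 < a [:: i].

Local Notation b := (npow a m.+1).
Local Notation pw := (npow_gt0 a_ge0 a0 a_gt0).

(* [X] acts on the orthonormal family [h] as [r W] acts on the basis of the
   Fock space. *)
Definition is_model (K : hilbertType R) (r : R) (X : 'I_n -> 'B(K)) (h : seq 'I_n -> K) :=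
  onfamily h /\ forall v w, wprod X v (h w) =
    (r ^+ size v * Num.sqrt (b w / b (v ++ w)))%:C *: h (v ++ w).

Lemma wprod_scale (K : hilbertType R) (X : 'I_n -> 'B(K)) (r : R[i]) w :
  wprod (fun i => r *: X i) w = r ^+ size w *: wprod X w.
Proof.
elim: w => [|i w IH] /=; first by rewrite scale1r.
rewrite IH; apply: bop_ext => x.
transitivity (r *: X i (r ^+ size w *: wprod X w x)) => //.
by rewrite bopZ scalerA -exprS.
Qed.

Lemma is_model_univ r : is_model r (fun i => r%:C *: univ_model m.+1 a i) (@fbasis R n).
Proof.
split=> [|v w]; first exact: onfamily_fbasis.
rewrite wprod_scale scalebE (wprod_univ_model m a_ge0 a0 a_gt0) scalerA.
by rewrite rcM -rmorphXn.
Qed.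

Lemma Drad_univ r : 0 <= r < 1 -> Drad m.+1 a (fun i => r%:C *: univ_model m.+1 a i).
Proof.
by move=> r01; exists r => //; exists (univ_model m.+1 a) => //; exact: univ_model_Dom.
Qed.

(** A copy of rW inside B(H), obtained from an isometry of Fock space into [H]. It lets the
    coefficients be read off from the values over [H]. *)
Lemma model_ex (H : hilbertType R) r : infinite_dimensional H -> 0 <= r < 1 ->
  exists (X : 'I_n -> 'B(H)) h, Drad m.+1 a X /\ is_model r X h.
Proof.
move=> infH r01; have [h oh] := onfamily_count (seq 'I_n) infH.
have [|w|V [VE _]] := weighted_extend (w := fun=> 1) (M := 1)
  (@total_fbasis R n) (@onfamily_fbasis R n) oh.
- by [].
- by rewrite normr1.
have V_iso x : adj V (V x) = x.
  suff VV : bcomp (adj V) V = bid _ by rewrite -[LHS]/(bcomp (adj V) V x) VV.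
  apply: (total_eq (@total_fbasis R n)) => w.
  apply: (total_inner_eq (@total_fbasis R n)) => v.
  by rewrite /= -adjP !VE !scale1r oh onfamily_fbasis.
exists (fun i => r%:C *: conj_by V (univ_model m.+1 a i)), h; split.
  exists r => //; exists (fun i => conj_by V (univ_model m.+1 a i)) => //.
  by apply: Dom_conj_by => //; exact: univ_model_Dom.
split=> // v w; rewrite wprod_scale scalebE.
have hE u : h u = V (fbasis R u) by rewrite VE scale1r.
rewrite !hE wprod_conj_by// (wprod_univ_model m a_ge0 a0 a_gt0) bopZ scalerA.
by rewrite rcM -rmorphXn.
Qed.

Context (E : hilbertType R).

Lemma norm_cvg_eventually (V V' : hilbertType R) (T : nat -> bop V V') S x y c :
  norm_cvg T S -> (exists N0, forall N, (N0 <= N)%N -> inner (T N x) y = c) ->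
  inner (S x) y = c.
Proof.
move=> hT [N0 hN]; have := hcvg_inner y (norm_cvg_app x hT) => h.
apply: ccvg_uniq h _ => e e0; exists N0 => k /hN ->.
by rewrite subrr normc0.
Qed.

Section matrix_entries.
Context (K : hilbertType R) (r : R) (X : 'I_n -> 'B(K)) (h : seq 'I_n -> K).
Hypothesis Xh : is_model r X h.
Implicit Types (A B : seq 'I_n -> 'B(E)) (T : 'B(tensor E K)) (x y : E).

Let sum_single (k : nat) (w : seq 'I_n) (F : seq 'I_n -> R[i]) :
  \sum_(v : k.-tuple 'I_n) (if val v == w then F v else 0) =
  if k == size w then F w else 0.
Proof.
case: eqP => [->|ne].
  rewrite (bigD1 (in_tuple w)) //= eqxx big1 ?addr0// => v.
  by rewrite -val_eqE /= => /negbTE ->.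
rewrite big1// => v _; case: eqP => // e; case: ne.
by rewrite -e size_tuple.
Qed.

Let sum_sizes (l N : nat) (c : R[i]) : (l < N)%N ->
  \sum_(0 <= k < N) (if k == l then c else 0) = c.
Proof.
move=> lN; rewrite big_mkord (bigD1 (Ordinal lN)) //= eqxx big1 ?addr0// => k.
by rewrite -val_eqE /= => /negbTE ->.
Qed.

Let analytic_entry (A : seq 'I_n -> 'B(E)) u w x y N :
  inner (analytic_partial A X N (pure x (h u))) (pure y (h w)) =
  \sum_(0 <= k < N.+1) \sum_(v : k.-tuple 'I_n)
    (if v ++ u == w then (r ^+ k * Num.sqrt (b u / b w))%:C * inner (A v x) y else 0).
Proof.
rewrite sumbE inner_suml; apply: eq_bigr => k _.
rewrite sumbE inner_suml; apply: eq_bigr => v _.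
rewrite op_tensorE inner_pure Xh.2 innerZl Xh.1 size_tuple.
by case: eqP => [->|_]; rewrite ?mulr1 ?mulr0// mulrC.
Qed.

Let coanalytic_entry (B : seq 'I_n -> 'B(E)) u w x y N :
  inner (coanalytic_partial B X N (pure x (h u))) (pure y (h w)) =
  \sum_(1 <= k < N.+1) \sum_(v : k.-tuple 'I_n)
    (if v ++ w == u then (r ^+ k * Num.sqrt (b w / b u))%:C * inner (B v x) y else 0).
Proof.
rewrite sumbE inner_suml; apply: eq_bigr => k _.
rewrite sumbE inner_suml; apply: eq_bigr => v _.
rewrite op_tensorE inner_pure adjPr Xh.2 innerZr conj_rc Xh.1 size_tuple.
rewrite eq_sym; case: eqP => [->|_]; rewrite ?mulr1 ?mulr0//.
by rewrite mulrC.
Qed.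

Lemma pluri_first_column B A T x y w : pluri_value B A X T ->
  inner (T (pure x (h [::]))) (pure y (h w)) =
  (r ^+ size w / Num.sqrt (b w))%:C * inner (A w x) y.
Proof.
move=> [S1 [S2 [h1 h2 ->]]]; rewrite addbE innerDl.
(* For nonempty v the vector X_v^* h_[] is orthogonal to every h_w, and the coanalytic series
   contains nonempty words only. *)
rewrite (norm_cvg_eventually (c := 0) h1); last first.
  exists 0%N => N _; rewrite coanalytic_entry big_add1 big_mkord big1// => k _.
  by rewrite big1// => v _; case: v => -[].
rewrite add0r; apply: (norm_cvg_eventually h2); exists (size w) => N leN.
rewrite analytic_entry npow_nil.
under eq_bigr => k _.
  under eq_bigr do rewrite cats0.
  rewrite (sum_single k w (fun v => (r ^+ k * Num.sqrt (1 / b w))%:C * inner (A v x) y)).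
  over.
under eq_bigr => k _.
  rewrite (_ : (if _ then _ else _) = if k == size w then
    (r ^+ size w / Num.sqrt (b w))%:C * inner (A w x) y else 0); first over.
  by case: eqP => // ->; rewrite div1r sqrtrV ?npow_ge0.
by rewrite sum_sizes.
Qed.

Lemma pluri_first_row B A T x y w : w != [::] -> pluri_value B A X T ->
  inner (T (pure x (h w))) (pure y (h [::])) =
  (r ^+ size w / Num.sqrt (b w))%:C * inner (B w x) y.
Proof.
move=> w0 [S1 [S2 [h1 h2 ->]]]; rewrite addbE innerDl addrC.
(* For nonempty w the vector X_v h_w is a multiple of h_(vw), which is orthogonal to h_[]. *)
rewrite (norm_cvg_eventually (c := 0) h2); last first.
  exists 0%N => N _; rewrite analytic_entry big1// => k _.
  rewrite big1// => v _; case: eqP => //; case: (w) w0 => // i s _.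
  by case: (val v).
rewrite add0r; apply: (norm_cvg_eventually h1); exists (size w) => N leN.
rewrite coanalytic_entry npow_nil.
(* The missing degree 0 may be added, since its only word is empty and [w] is not. *)
have F0 : forall F : nat -> R[i], F 0%N = 0 ->
    \sum_(1 <= k < N.+1) F k = \sum_(0 <= k < N.+1) F k.
  by move=> F F0; rewrite [RHS]big_ltn// F0 add0r.
rewrite F0; last first.
  rewrite big1// => v _; rewrite cats0; case: eqP => // e; case/eqP: w0.
  by rewrite -e; case: v {e} => -[].
under eq_bigr => k _.
  under eq_bigr do rewrite cats0.
  rewrite (sum_single k w (fun v => (r ^+ k * Num.sqrt (1 / b w))%:C * inner (B v x) y)).
  over.
under eq_bigr => k _.
  rewrite (_ : (if _ then _ else _) = if k == size w then
    (r ^+ size w / Num.sqrt (b w))%:C * inner (B w x) y else 0); first over.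
  by case: eqP => // ->; rewrite div1r sqrtrV ?npow_ge0.
by rewrite sum_sizes.
Qed.

Hypothesis r_gt0 : 0 < r.

Lemma pluri_coef_unique B A B' A' T : pluri_value B A X T -> pluri_value B' A' X T ->
  A = A' /\ forall w, w != [::] -> B w = B' w.
Proof.
move=> h1 h2.
have c0 w : (r ^+ size w / Num.sqrt (b w))%:C != 0.
  rewrite eq_complex /= eqxx andbT mulf_neq0 ?expf_neq0 ?gt_eqF//.
  by rewrite invr_gt0 sqrtr_gt0 pw.
split=> [|w w0].
  apply/funext => w; apply: bop_ext => x; apply: inner_injl => y; apply: (mulfI (c0 w)).
  by rewrite -(pluri_first_column x y w h1) (pluri_first_column x y w h2).
apply: bop_ext => x; apply: inner_injl => y; apply: (mulfI (c0 w)).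
by rewrite -(pluri_first_row x y w0 h1) (pluri_first_row x y w0 h2).
Qed.

(* Test [T (x (x) h_0)] against the sum of the [b_w^(-1/2) A_w x (x) h_w]. *)
Let column_bound (A : seq 'I_n -> 'B(E)) (T : 'B(tensor E K)) k x :
  (forall y (w : k.-tuple 'I_n), inner (T (pure x (h [::]))) (pure y (h w)) =
    (r ^+ k / Num.sqrt (b w))%:C * inner (A w x) y) ->
  \sum_(w : k.-tuple 'I_n) hnorm (A w x) ^+ 2 / b w <=
  (opnorm T / r ^+ k) ^+ 2 * hnorm x ^+ 2.
Proof.
move=> hT; set s := \sum_(w : _) _.
have s0 : 0 <= s by apply: sumr_ge0 => w _; rewrite divr_ge0 ?sqr_ge0 ?npow_ge0.
have rk : 0 < r ^+ k by rewrite exprn_gt0.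
have bsq w : Num.sqrt (b w) ^+ 2 = b w by rewrite sqr_sqrtr ?npow_ge0.
pose y (w : seq 'I_n) := (Num.sqrt (b w))^-1%:C *: A w x.
pose u := \sum_(w : k.-tuple 'I_n) pure (y w) (h w) : tensor E K.
have uu : hnorm u ^+ 2 = s.
  apply: (@complexI R); rewrite hnorm_sqr inner_suml rmorph_sum; apply: eq_bigr => w _.
  rewrite inner_sumr (bigD1 w) //= big1 ?addr0 => [|v vw].
    rewrite inner_pure Xh.1 eqxx mulr1 innerZl innerZr conj_rc -hnorm_sqr.
    by rewrite -!rcM mulrA -invfM -expr2 bsq mulrC.
  by rewrite inner_pure Xh.1 eq_sym val_eqE (negbTE vw) mulr0.
have Tu : inner (T (pure x (h [::]))) u = (r ^+ k * s)%:C.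
  rewrite inner_sumr mulr_sumr rmorph_sum; apply: eq_bigr => w _.
  rewrite hT innerZr conj_rc -hnorm_sqr -!rcM; congr (_%:C).
  by rewrite -[in RHS]bsq; field; rewrite gt_eqF// sqrtr_gt0 pw.
have hx : hnorm (pure x (h [::]) : tensor E K) = hnorm x.
  apply/eqP; rewrite -(@eqrXn2 _ 2)// ?hnorm_ge0//; apply/eqP/(@complexI R).
  by rewrite !hnorm_sqr inner_pure Xh.1 eqxx mulr1.
have := inner_CS (T (pure x (h [::]))) u.
have rs0 : 0 <= r ^+ k * s by rewrite mulr_ge0// ltW.
(* Since s = |u|^2, this bounds r^k |u|^2 by the product of |T (x (x) h_[])| and |u|; one factor |u|
   is cancelled below. *)
rewrite Tu normcC ger0_norm// -uu => le1.
have [->|u0] := eqVneq (hnorm u) 0.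
  by rewrite expr0n /= mulr_ge0 ?sqr_ge0.
have up : 0 < hnorm u by rewrite lt_def u0 hnorm_ge0.
rewrite -exprMn ler_pXn2r ?nnegrE ?hnorm_ge0//; last first.
  by rewrite mulr_ge0 ?hnorm_ge0// divr_ge0 ?opnorm_ge0// ltW.
rewrite mulrAC ler_pdivlMr// mulrC.
move: le1; rewrite expr2 mulrA ler_pM2r// => /le_trans; apply.
by apply: le_trans (opnormP _ _) _; rewrite hx.
Qed.

Lemma pluri_column_bound B A T k x : pluri_value B A X T ->
  \sum_(w : k.-tuple 'I_n) hnorm (A w x) ^+ 2 / b w <=
  (opnorm T / r ^+ k) ^+ 2 * hnorm x ^+ 2.
Proof.
move=> hT; apply: column_bound => y w.
by rewrite (pluri_first_column x y w hT) size_tuple.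
Qed.

(** This is the column bound for [adj T], whose first column is the adjoint of the first row of
    [T]. *)
Lemma pluri_row_bound B A T k x : (0 < k)%N -> pluri_value B A X T ->
  \sum_(w : k.-tuple 'I_n) hnorm (adj (B w) x) ^+ 2 / b w <=
  (opnorm T / r ^+ k) ^+ 2 * hnorm x ^+ 2.
Proof.
move=> k0 hT; rewrite -opnorm_adj.
apply: (column_bound (A := fun w => adj (B w))) => y w.
have w0 : val w != [::] by rewrite -size_eq0 size_tuple -lt0n.
rewrite adjPr innerC (pluri_first_row y x w0 hT) rmorphM /= conj_rc size_tuple.
by rewrite -innerC adjPr.
Qed.

End matrix_entries.
End model_families.

(** * Convergence on the domain *)

Section geometric_series.
Context (R : realType).

Lemma null_geom (q : R) : 0 <= q < 1 -> null (fun k => q ^+ k).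
Proof.
move=> /andP[q0 q1]; apply: cvg_null; apply: cvg_expr.
by rewrite ger0_norm.
Qed.

Lemma geom_sum_le (q : R) N : 0 <= q < 1 -> \sum_(k < N) q ^+ k <= (1 - q)^-1.
Proof.
move=> /andP[q0 q1]; have q10 : 0 < 1 - q by rewrite subr_gt0.
rewrite -[leRHS]mul1r ler_pdivlMr// mulrC -[1 - q]opprB mulNr -subrX1 opprB.
by rewrite gerBl exprn_ge0.
Qed.

Lemma geom_cvg (V W : hilbertType R) (T : nat -> bop V W) (C q : R) :
  0 <= C -> 0 <= q < 1 -> (forall k, opnorm (T k) <= C * q ^+ k) ->
  exists S, norm_cvg (fun N => \sum_(0 <= k < N.+1) T k) S /\ opnorm S <= C / (1 - q).
Proof.
move=> C0 q01 hT; have /andP[q0 q1] := q01; have q10 : 0 < 1 - q by rewrite subr_gt0.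
have tail i j : (i <= j)%N ->
    opnorm (\sum_(0 <= k < j) T k - \sum_(0 <= k < i) T k) <= C / (1 - q) * q ^+ i.
  move=> ij; rewrite (big_cat_nat (n := i)) //= addrAC subrr add0r.
  apply: le_trans (opnorm_sum _ _ _) _.
  rewrite -{1}(add0n i) big_addn big_mkord.
  apply: (@le_trans _ _ (\sum_(k < j - i) C * q ^+ (k + i))).
    by apply: ler_sum => k _; exact: hT.
  under eq_bigr do rewrite exprD mulrA.
  rewrite -mulr_suml -mulr_sumr ler_wpM2r ?exprn_ge0// ler_wpM2l//.
  exact: geom_sum_le.
have M0 : 0 <= C / (1 - q) by rewrite divr_ge0// ltW.
have [S hS] : exists S, norm_cvg (fun N => \sum_(0 <= k < N.+1) T k) S.
  apply: bop_complete => e e0.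
  have [N hN] := nullM M0 (null_geom q01) e0.
  exists N => i j Ni Nj.
  wlog ij : i j Ni Nj / (j <= i)%N.
    move=> h; have [/h|/ltnW/h] := leqP j i; first exact.
    by rewrite opnorm_subC; apply.
  apply: le_lt_trans (tail j.+1 i.+1 ij) (hN _ (leqW Nj)).
exists S; split=> //; apply: norm_cvg_le hS _; exists 0%N => k _.
by have := tail 0%N k.+1 (leq0n _); rewrite [X in _ - X]big_geq// subr0 expr0 mulr1.
Qed.

End geometric_series.

Lemma big_tuple_split (V : nmodType) (T : finType) i k (F : seq T -> V) : (i <= k)%N ->
  \sum_(g : k.-tuple T) F g = \sum_(g : i.-tuple T) \sum_(h : (k - i).-tuple T) F (g ++ h).
Proof. by move=> ik; rewrite -big_tupleD subnKC. Qed.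

(** * Growth of words on the domain *)

Section domain_bounds.
Context (R : realType) (n m : nat) (a : seq 'I_n -> R).
Hypothesis a_ge0 : forall w, 0 <= a w.
Hypothesis a0 : a [::] = 0.
Hypothesis a_gt0 : forall i, 0 < a [:: i].

Local Notation b := (npow a m.+1).
Local Notation pw := (npow_gt0 a_ge0 a0 a_gt0).

(** Writing S_p(N) for the sum, [bincS] gives S_(p+1)(N+1) = S_p(N+1) + s S_(p+1)(N). As the terms
    are nonnegative, (1 - s) S_(p+1)(N+1) <= S_p(N+1). *)
Lemma binc_series_le p (s : R) N : 0 <= s < 1 ->
  \sum_(j < N) (binc p j)%:R * s ^+ j <= (1 - s) ^- p.
Proof.
move=> /andP[s0 s1]; have s10 : 0 < 1 - s by rewrite subr_gt0.
case: N => [|N]; first by rewrite big_ord0 invr_ge0 exprn_ge0// ltW.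
elim: p => [|p IH].
  rewrite big_ord_recl binc0 !expr0 mulr1 invr1 big1 ?addr0// => j _.
  by rewrite /= binc0S mul0r.
rewrite exprS invfM -ler_pdivrMl ?invr_gt0// invrK; apply: le_trans IH.
have : s * \sum_(j < N) (binc p.+1 j)%:R * s ^+ j <=
    s * \sum_(j < N.+1) (binc p.+1 j)%:R * s ^+ j.
  by rewrite ler_wpM2l// [leRHS]big_ord_recr lerDl mulr_ge0// exprn_ge0.
have E : \sum_(j < N.+1) (binc p.+1 j)%:R * s ^+ j =
    \sum_(j < N.+1) (binc p j)%:R * s ^+ j + s * \sum_(j < N) (binc p.+1 j)%:R * s ^+ j.
  rewrite big_ord_recl [in RHS]big_ord_recl !binc0 -addrA; congr (_ + _).
  rewrite mulr_sumr -big_split; apply: eq_bigr => j _.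
  by rewrite lift0 bincS natrD exprS /=; ring.
move: E; set x := \sum_(j < N.+1) (binc p.+1 j)%:R * _.
by set y := \sum_(j < N) _; set z := \sum_(j < _) _; lra.
Qed.

Lemma wprod_cat (K : hilbertType R) (X : 'I_n -> 'B(K)) v w :
  wprod X (v ++ w) = bcomp (wprod X v) (wprod X w).
Proof. by elim: v => [|i v IH] /=; [exact: bop_ext | rewrite IH; exact: bop_ext]. Qed.

Section domain_point.
Context (K : hilbertType R) (Y : 'I_n -> 'B(K)).
Hypothesis dY : Dom m.+1 a Y.

Local Notation nY w y := (hnorm (adj (wprod Y w) y) ^+ 2).

(** Positivity of the first defect says Phi_Y(I) <= I, and the partial sums of <Phi_Y(I) y, y>
    increase to their weak limit. *)
Lemma Dom_row_le N y :
  \sum_(k < N) \sum_(w : k.+1.-tuple 'I_n) a w * nY w y <= hnorm y ^+ 2.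
Proof.
have [defd pos] := @dY 1%N (isT : (1 <= 1 <= m.+1)%N).
have /wot_cvgP/(_ y y) := Phi_cvg defd; rewrite /= in pos *.
set L := inner (Phi a Y (bid K) y) y => hL.
pose p N := \sum_(k < N) \sum_(w : k.+1.-tuple 'I_n) a w * nY w y.
have pE M : inner (Phi_partial a Y (bid K) M y) y = (p M)%:C.
  rewrite /Phi_partial sumbE big_add1 big_mkord inner_suml rmorph_sum.
  apply: eq_bigr => k _; rewrite sumbE inner_suml rmorph_sum; apply: eq_bigr => w _.
  by rewrite scalebE innerZl /= adjP -hnorm_sqr -rcM.
have pmono M M' : (M <= M')%N -> p M <= p M'.
  move=> /subnK <-; elim: (M' - M)%N => [|k IH]; first by rewrite add0n.
  apply: le_trans IH _; rewrite addSn /p big_ord_recr /= lerDl.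
  by rewrite sumr_ge0// => w _; rewrite mulr_ge0 ?sqr_ge0.
(* A limit of real numbers is real: its real part is at least as close to each of them. *)
have LE : L = (complex.Re L)%:C.
  apply: (ccvg_uniq hL); rewrite /ccvg; apply: null_le hL => k.
  rewrite pE -rmorphB normcC; apply: le_trans _ (Re_le_normc _).
  by case: (L).
have pL : p N <= complex.Re L.
  rewrite -subr_le0; apply: null_cst => e /hL[N1 hN1]; exists 0%N => _ _.
  have := hN1 (maxn N N1) (leq_maxr _ _); rewrite pE LE -rmorphB normcC.
  have := pmono _ _ (leq_maxl N N1); move=> h1 /(le_lt_trans (ler_norm _)) /= h2; lra.
apply: le_trans pL _; have := pos y; rewrite innerBl -hnorm_sqr -/L LE -rmorphB lecR.
by rewrite subr_ge0.
Qed.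

(* The j-th iterate of Phi at I is at most I; this is its part of degree k. *)
Lemma cpow_row_le j k y :
  \sum_(w : k.-tuple 'I_n) cpow a j w * nY w y <= hnorm y ^+ 2.
Proof.
elim: j k y => [|j IH] k y.
  case: k => [|k].
    rewrite (big_tuple0 (fun w => cpow a 0 w * nY w y)) /= mul1r adj_bid.
    by [].
  rewrite big1 ?sqr_ge0// => w _; case: w => -[//|i w] sw /=.
  by rewrite mul0r.
(* [F i] is the part whose first factor g has length [i.+1]; the induction hypothesis is used at the
   vector Y_g^* y. *)
pose F i w := a (take i.+1 w) * cpow a j (drop i.+1 w) * nY w y.
have -> : \sum_(w : k.-tuple 'I_n) cpow a j.+1 w * nY w y =
    \sum_(i < k) \sum_(w : k.-tuple 'I_n) F i w.
  rewrite exchange_big; apply: eq_bigr => w _.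
  by rewrite [cpow a j.+1 w](conv_recl a0) size_tuple mulr_suml.
apply: le_trans (Dom_row_le k y); apply: ler_sum => i _.
rewrite (big_tuple_split _ (ltn_ord i)); apply: ler_sum => g _.
apply: le_trans (_ : _ <= a g * \sum_(h : (k - i.+1).-tuple 'I_n) cpow a j h *
    nY h (adj (wprod Y g) y)) _; last by rewrite ler_wpM2l.
rewrite mulr_sumr; apply: ler_sum => h _.
rewrite /F take_size_cat ?drop_size_cat ?size_tuple// wprod_cat adj_comp.
by rewrite /= mulrA.
Qed.

(** After multiplication by s^k: at a word of length k only powers j <= k enter into b, and there
    s^k <= s^j. With [cpow_row_le] for each j, the partial sum of the binomial series of (1 -
    s)^(-m-1) remains. *)
Lemma npow_row_le k y (s : R) : 0 < s < 1 ->
  \sum_(w : k.-tuple 'I_n) b w * nY w y <= s ^- k * (1 - s) ^- m.+1 * hnorm y ^+ 2.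
Proof.
move=> /andP[s0 s1]; have sk : 0 < s ^+ k by rewrite exprn_gt0.
rewrite -mulrA mulrC ler_pdivlMr// mulrC.
have s01 : 0 <= s < 1 by rewrite ltW.
apply: le_trans (_ : _ <= (\sum_(j < k.+1) (binc m.+1 j)%:R * s ^+ j) * hnorm y ^+ 2) _;
  last by rewrite ler_wpM2r ?sqr_ge0// binc_series_le.
rewrite mulr_sumr mulr_suml.
apply: le_trans (_ : _ <= \sum_(j < k.+1) (binc m.+1 j)%:R * s ^+ j *
  \sum_(w : k.-tuple 'I_n) cpow a j w * nY w y) _; last first.
  apply: ler_sum => j _; rewrite ler_wpM2l ?cpow_row_le//.
  by rewrite mulr_ge0// exprn_ge0// ltW.
under [leRHS]eq_bigr do rewrite mulr_sumr.
rewrite [leRHS]exchange_big; apply: ler_sum => w _ /=.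
rewrite /npow size_tuple mulr_suml mulr_sumr; apply: ler_sum => j _.
rewrite [leLHS]mulrA [leRHS]mulrA ler_wpM2r ?sqr_ge0// [leLHS]mulrA.
rewrite ler_wpM2r ?cpow_ge0// mulrC ler_wpM2l//.
by rewrite ler_wiXn2l ?(ltW s0) ?(ltW s1)// -ltnS ltn_ord.
Qed.

End domain_point.

Context (E : hilbertType R).

(** What a value of norm at most [c] at the point rho W forces on the coefficients, by
    [pluri_column_bound]. *)
Definition coef_bound (A : seq 'I_n -> 'B(E)) (c rho : R) := forall k x,
  \sum_(w : k.-tuple 'I_n) hnorm (A w x) ^+ 2 / b w <= (c / rho ^+ k) ^+ 2 * hnorm x ^+ 2.

(* Only [Phi(I) <= I] is used: splitting [b w] between the two factors, the
   row-column estimate replaces the von Neumann inequality at the price of a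
   factor [s^(-k/2)] with [s] as close to 1 as needed. *)
Lemma homogeneous_le (K : hilbertType R) (Y : 'I_n -> 'B(K)) (A : seq 'I_n -> 'B(E))
    (c rho t s : R) k : Dom m.+1 a Y -> coef_bound A c rho ->
  0 <= c -> 0 < rho -> 0 <= t -> 0 < s < 1 ->
  opnorm (\sum_(w : k.-tuple 'I_n) op_tensor (A w) (wprod (fun i => t%:C *: Y i) w)) <=
  c * Num.sqrt ((1 - s) ^- m.+1) * (t / (rho * Num.sqrt s)) ^+ k.
Proof.
move=> dY hA c0 rho0 t0 s01; have /andP[s0 s1] := s01.
have s10 : 0 < 1 - s by rewrite subr_gt0.
have sb w : 0 < Num.sqrt (b w) by rewrite sqrtr_gt0 pw.
have bsq w : Num.sqrt (b w) ^+ 2 = b w by rewrite sqr_sqrtr ?npow_ge0.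
have -> : \sum_(w : k.-tuple 'I_n) op_tensor (A w) (wprod (fun i => t%:C *: Y i) w) =
    \sum_(w : k.-tuple 'I_n) op_tensor ((Num.sqrt (b w))^-1%:C *: A w)
      ((t ^+ k * Num.sqrt (b w))%:C *: wprod Y w).
  apply: eq_bigr => w _; rewrite wprod_scale size_tuple -rmorphXn !op_tensorZr.
  rewrite -[_^-1%:C *: _]addr0 op_tensor_linl op_tensor0l addr0 scalerA -rcM.
  by rewrite mulfK// gt_eqF.
have -> : c * Num.sqrt ((1 - s) ^- m.+1) * (t / (rho * Num.sqrt s)) ^+ k =
    (c / rho ^+ k) * (t ^+ k * Num.sqrt (s ^- k * (1 - s) ^- m.+1)).
  rewrite sqrtrM ?invr_ge0 ?exprn_ge0 ?ltW// (@sqrtrV _ (s ^+ k)) ?exprn_ge0 ?ltW//.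
  have -> : Num.sqrt (s ^+ k) = Num.sqrt s ^+ k.
    apply/eqP; rewrite -(@eqrXn2 _ 2)// ?sqrtr_ge0 ?exprn_ge0 ?sqrtr_ge0//.
    by rewrite exprAC !sqr_sqrtr// ?exprn_ge0 ?ltW//.
  by rewrite expr_div_n exprMn invfM; ring.
apply: op_tensor_rowcol => [||x|y].
- by rewrite divr_ge0 ?exprn_ge0// ltW.
- by rewrite mulr_ge0 ?exprn_ge0 ?sqrtr_ge0.
- apply: le_trans (hA k x); apply: ler_sum => w _.
  rewrite scalebE hnormZ normcC exprMn ger0_norm ?invr_ge0 ?sqrtr_ge0//.
  by rewrite exprVn bsq mulrC.
have D0 : 0 <= s ^- k * (1 - s) ^- m.+1.
  by rewrite mulr_ge0// invr_ge0 exprn_ge0// ltW.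
rewrite exprMn (sqr_sqrtr D0) -mulrA.
apply: le_trans (ler_wpM2l (sqr_ge0 (t ^+ k)) (npow_row_le dY k y s01)).
rewrite mulr_sumr; apply: ler_sum => w _.
rewrite adjZ conj_rc scalebE hnormZ normcC exprMn ger0_norm; last first.
  by rewrite mulr_ge0 ?exprn_ge0// ltW.
by rewrite exprMn bsq -mulrA.
Qed.

(** The homogeneous parts decay geometrically. The constant [M] is chosen before [K], [Y], [A] and
    [c], so small coefficient bounds give small values. *)
Lemma analytic_cvg (rho t : R) : 0 <= t < rho -> exists2 M, 0 <= M &
  forall (K : hilbertType R) (Y : 'I_n -> 'B(K)) (A : seq 'I_n -> 'B(E)) (c : R),
  Dom m.+1 a Y -> 0 <= c -> coef_bound A c rho ->
  exists S, norm_cvg (analytic_partial A (fun i => t%:C *: Y i)) S /\ opnorm S <= M * c.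
Proof.
move=> /andP[t0 tr]; have rho0 : 0 < rho by exact: le_lt_trans tr.
have tr1 : t / rho < 1 by rewrite ltr_pdivrMr// mul1r.
have tr0 : 0 <= t / rho by rewrite divr_ge0// ltW.
(* [sigma] is the midpoint of t / rho and 1; with s = sigma^2 in [homogeneous_le] the ratio t / (rho
   sigma) is still less than 1. *)
have [sigma [sg0 sg1 sgt]] : exists sg : R, [/\ 0 < sg, sg < 1 & t / rho < sg].
  by exists ((1 + t / rho) / 2); split; lra.
have s01 : 0 < sigma ^+ 2 < 1 by rewrite exprn_gt0// expr_lt1// ltW.
pose q := t / (rho * sigma).
have q01 : 0 <= q < 1.
  rewrite /q divr_ge0 ?mulr_ge0 ?(ltW rho0) ?(ltW sg0)//=.
  by rewrite invfM mulrA ltr_pdivrMr// mul1r.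
pose D := Num.sqrt ((1 - sigma ^+ 2) ^- m.+1).
exists (D / (1 - q)).
  by rewrite divr_ge0 ?sqrtr_ge0// subr_ge0; case/andP: q01 => _ /ltW.
move=> K Y A c dY c0 hA.
have [||k|S [hS leS]] := @geom_cvg _ _ _ (fun k => \sum_(w : k.-tuple 'I_n)
    op_tensor (A w) (wprod (fun i => t%:C *: Y i) w)) (c * D) q.
- by rewrite mulr_ge0 ?sqrtr_ge0.
- by [].
- have := @homogeneous_le _ _ _ _ _ _ _ k dY hA c0 rho0 t0 s01.
  by rewrite sqrtr_sqr gtr0_norm.
exists S; split=> //; apply: le_trans leS _.
by rewrite -mulrA [leLHS]mulrC.
Qed.

End domain_bounds.

(** * Free pluriharmonic functions *)

Section pair_values.
Context (R : realType) (n : nat) (E K : hilbertType R) (X : 'I_n -> 'B(K)).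
Implicit Types (A B C : seq 'I_n -> 'B(E)) (T : 'B(tensor E K)).

Lemma analytic_partial_lin c A A' N :
  analytic_partial (fun w => c *: A w + A' w) X N =
  c *: analytic_partial A X N + analytic_partial A' X N.
Proof.
rewrite /analytic_partial scaler_sumr -big_split; apply: eq_bigr => k _ /=.
rewrite scaler_sumr -big_split; apply: eq_bigr => w _ /=.
exact: op_tensor_linl.
Qed.

Lemma analytic_partial0 N : analytic_partial (fun=> 0 : 'B(E)) X N = 0.
Proof. by rewrite /analytic_partial big1// => k _; rewrite big1// => w _; exact: op_tensor0l. Qed.

(** Serves to move the constant term of C^* into the analytic part. *)
Definition constant_coef (D : 'B(E)) (w : seq 'I_n) : 'B(E) := if w == [::] then D else 0.

Lemma analytic_partial_constant D N :
  analytic_partial (constant_coef D) X N = op_tensor D (bid K).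
Proof.
rewrite /analytic_partial big_ltn//.
rewrite (big_tuple0 (fun w => op_tensor (constant_coef D w) (wprod X w))) /=.
rewrite big_add1 big_mkord big1 ?addr0// => k _.
by rewrite big1// => w _; case: w => -[//|i w] sw; exact: op_tensor0l.
Qed.

(* [B [::]] does not occur in [coanalytic_partial B]. *)
Definition adj_coef B (w : seq 'I_n) : 'B(E) := if w == [::] then 0 else adj (B w).

Lemma adj_coanalytic B N : adj (coanalytic_partial B X N) = analytic_partial (adj_coef B) X N.
Proof.
rewrite /analytic_partial big_ltn//.
rewrite (big_tuple0 (fun w => op_tensor (adj_coef B w) (wprod X w))) /= op_tensor0l add0r.
rewrite adj_sum; apply: eq_big_nat => k /andP[k0 _].
rewrite adj_sum; apply: eq_bigr => w _; rewrite adj_op_tensor adjK; congr op_tensor.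
by rewrite /adj_coef -size_eq0 size_tuple gtn_eqF.
Qed.

Lemma coanalytic_adj C N : coanalytic_partial (fun w => adj (C w)) X N =
  adj (analytic_partial C X N) - op_tensor (adj (C [::])) (bid K).
Proof.
apply: (canRL (addrK _)); apply: (canRL (@adjK R _ _)).
rewrite adjD adj_coanalytic adj_op_tensor adjK adj_bid.
rewrite -(analytic_partial_constant _ N) -[X in X + _]scale1r -analytic_partial_lin.
congr (analytic_partial _ X N); apply/funext => w; rewrite scale1r /adj_coef /constant_coef.
by case: eqP => [->|_]; rewrite ?add0r// addr0 adjK.
Qed.

Lemma analytic_cvg_lin c A A' S S' :
  norm_cvg (analytic_partial A X) S -> norm_cvg (analytic_partial A' X) S' ->
  norm_cvg (analytic_partial (fun w => c *: A w + A' w) X) (c *: S + S').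
Proof.
move=> h h'.
have -> : analytic_partial (fun w => c *: A w + A' w) X =
    fun N => c *: analytic_partial A X N + analytic_partial A' X N.
  by apply/funext => N; rewrite analytic_partial_lin.
exact: norm_cvg_lin.
Qed.

Lemma analytic_cvg0 : norm_cvg (analytic_partial (fun=> 0 : 'B(E)) X) 0.
Proof.
have -> : analytic_partial (fun=> 0 : 'B(E)) X = fun=> 0.
  by apply/funext => N; rewrite analytic_partial0.
exact: norm_cvg_cst.
Qed.

(** The value of A + C^* with two analytic series, so that estimates and linearity are needed for
    analytic series only. Unlike in [pluri_value], both series may have a constant term. *)
Definition pair_value A C T := exists S1 S2, [/\ norm_cvg (analytic_partial A X) S1,
  norm_cvg (analytic_partial C X) S2 & T = S1 + adj S2].

Lemma pluri_pair B A T : pluri_value B A X T <-> pair_value A (adj_coef B) T.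
Proof.
split=> [[S1 [S2 [h1 h2 ->]]]|[S1 [S2 [h1 h2 ->]]]].
  exists S2, (adj S1); rewrite adjK addrC; split=> //.
  have -> : analytic_partial (adj_coef B) X = fun N => adj (coanalytic_partial B X N).
    by apply/funext => N; rewrite adj_coanalytic.
  exact: norm_cvg_adj.
exists (adj S2), S1; rewrite addrC; split=> //.
have -> : coanalytic_partial B X = fun N => adj (analytic_partial (adj_coef B) X N).
  by apply/funext => N; rewrite -adj_coanalytic adjK.
exact: norm_cvg_adj.
Qed.

(** The coanalytic sum of a [pluri_value] starts in degree 1, so the constant term of C^* is added
    to that of A. *)
Lemma pair_pluri A C T : pair_value A C T ->
  pluri_value (fun w => adj (C w)) (fun w => 1 *: A w + constant_coef (adj (C [::])) w) X T.
Proof.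
move=> [S1 [S2 [h1 h2 ->]]].
set D := op_tensor (adj (C [::])) (bid K).
exists (adj S2 - D), (1 *: S1 + D); split; last by rewrite scale1r (addrC S1 D) addrA subrK addrC.
  have -> : coanalytic_partial (fun w => adj (C w)) X =
      fun N => (-1) *: D + adj (analytic_partial C X N).
    by apply/funext => N; rewrite coanalytic_adj scaleN1r addrC.
  have -> : adj S2 - D = (-1) *: D + adj S2 by rewrite scaleN1r addrC.
  apply: norm_cvg_lin (norm_cvg_cst D) _.
  exact: norm_cvg_adj.
apply: analytic_cvg_lin h1 _.
have -> : analytic_partial (constant_coef (adj (C [::]))) X = fun=> D.
  by apply/funext => N; rewrite analytic_partial_constant.
exact: norm_cvg_cst.
Qed.

Lemma pair_value_lin c A A' C C' T T' : pair_value A C T -> pair_value A' C' T' ->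
  pair_value (fun w => c *: A w + A' w) (fun w => c^* *: C w + C' w) (c *: T + T').
Proof.
move=> [S1 [S2 [h1 h2 ->]]] [S1' [S2' [h1' h2' ->]]].
exists (c *: S1 + S1'), (c^* *: S2 + S2'); split.
- exact: analytic_cvg_lin.
- exact: analytic_cvg_lin.
- by rewrite adj_lin conjCK scalerDr addrACA.
Qed.

Lemma pair_value0 : pair_value (fun=> 0) (fun=> 0) 0.
Proof.
exists 0, 0; rewrite adj0 addr0; split=> //; exact: analytic_cvg0.
Qed.

Lemma pair_value_uniq A C T T' : pair_value A C T -> pair_value A C T' -> T = T'.
Proof.
move=> [S1 [S2 [h1 h2 ->]]] [S1' [S2' [h1' h2' ->]]].
by rewrite (norm_cvg_uniq h1 h1') (norm_cvg_uniq h2 h2').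
Qed.

Lemma eq_adj_coef B B' : (forall w, w != [::] -> B w = B' w) -> adj_coef B = adj_coef B'.
Proof. by move=> e; apply/funext => w; rewrite /adj_coef; case: ifPn => // /e ->. Qed.

Lemma pluri_value_uniq B B' A T T' : (forall w, w != [::] -> B w = B' w) ->
  pluri_value B A X T -> pluri_value B' A X T' -> T = T'.
Proof. by move=> /eq_adj_coef e /pluri_pair h /pluri_pair; rewrite -e; exact: pair_value_uniq. Qed.

Lemma pluri_value_ext B B' A T : (forall w, w != [::] -> B w = B' w) ->
  pluri_value B A X T -> pluri_value B' A X T.
Proof. by move=> /eq_adj_coef e /pluri_pair h; apply/pluri_pair; rewrite -e. Qed.

End pair_values.

(** * The spatial tensor product as a norm closure *)

Section spatial_closure.
Context (R : realType) (E K : hilbertType R).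

(** With lists instead of indexed families, sums become concatenations. *)
Let spatial_seq (T : 'B(tensor E K)) : spatial T <-> forall e : R, 0 < e ->
  exists s : seq ('B(E) * 'B(K)), opnorm (T - \sum_(p <- s) op_tensor p.1 p.2) < e.
Proof.
split=> h e e0.
  have [N [A [X hT]]] := h e e0; exists [seq (A j, X j) | j <- enum 'I_N].
  by rewrite big_map big_enum.
have [s hs] := h e e0; exists (size s), (fun j => (tnth (in_tuple s) j).1),
  (fun j => (tnth (in_tuple s) j).2).
by move: hs; rewrite big_tnth.
Qed.

Lemma spatial_op_tensor (A : 'B(E)) (X : 'B(K)) : spatial (op_tensor A X).
Proof.
by apply/spatial_seq => e e0; exists [:: (A, X)]; rewrite big_seq1 subrr opnorm0.
Qed.

Lemma spatial_lin c (S T : 'B(tensor E K)) : spatial S -> spatial T -> spatial (c *: S + T).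
Proof.
move=> /spatial_seq hS /spatial_seq hT; apply/spatial_seq => e e0.
have c1 : 0 < normc c + 1 by rewrite ltr_wpDl ?normc_ge0.
have [|s hs] := hS (e / 2 / (normc c + 1)); first by rewrite !divr_gt0.
have [|t ht] := hT (e / 2); first by rewrite divr_gt0.
exists ([seq (c *: p.1, p.2) | p <- s] ++ t).
have -> : \sum_(p <- [seq (c *: p.1, p.2) | p <- s] ++ t) op_tensor p.1 p.2 =
    c *: \sum_(p <- s) op_tensor p.1 p.2 + \sum_(p <- t) op_tensor p.1 p.2.
  rewrite big_cat big_map scaler_sumr; congr (_ + _); apply: eq_bigr => p _ /=.
  by rewrite -[c *: p.1]addr0 op_tensor_linl op_tensor0l addr0.
rewrite opprD addrACA -scalerBr; apply: le_lt_trans (opnormD _ _) _.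
apply: le_lt_trans (lerD (opnormZ_le _ _) (lexx _)) _.
rewrite ltr_pdivlMr// in hs; have := opnorm_ge0 (S - \sum_(p <- s) op_tensor p.1 p.2).
move: (opnorm _) (opnorm _) hs ht => x y hs ht x0.
rewrite mulrDr mulr1 in hs; lra.
Qed.

Lemma spatial0 : spatial (0 : 'B(tensor E K)).
Proof. by apply/spatial_seq => e e0; exists [::]; rewrite big_nil subrr opnorm0. Qed.

Lemma spatialD (S T : 'B(tensor E K)) : spatial S -> spatial T -> spatial (S + T).
Proof. by rewrite -[S in spatial (S + _)]scale1r; exact: spatial_lin. Qed.

Lemma spatial_sum J (s : seq J) (P : pred J) (F : J -> 'B(tensor E K)) :
  (forall j, spatial (F j)) -> spatial (\sum_(j <- s | P j) F j).
Proof.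
move=> hF; apply: (big_ind (@spatial R E K)) => [|S T|j _].
- exact: spatial0.
- exact: spatialD.
- exact: hF.
Qed.

Lemma spatial_adj (S : 'B(tensor E K)) : spatial S -> spatial (adj S).
Proof.
move=> /spatial_seq hS; apply/spatial_seq => e /hS[s hs].
exists [seq (adj p.1, adj p.2) | p <- s]; rewrite big_map.
under eq_bigr do rewrite -adj_op_tensor.
by rewrite -adj_sum -adjB opnorm_adj.
Qed.

Lemma spatial_lim (T : nat -> 'B(tensor E K)) S :
  (forall k, spatial (T k)) -> norm_cvg T S -> spatial S.
Proof.
move=> hT /norm_cvgP TS; apply/spatial_seq => e e0.
have e20 : 0 < e / 2 by rewrite divr_gt0.
have [N hN] := TS _ e20; have /spatial_seq/(_ _ e20)[s hs] := hT N.
exists s; have := hN N (leqnn _); rewrite opnorm_subC => h.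
apply: le_lt_trans (_ : _ <= opnorm (S - T N) + opnorm (T N - \sum_(p <- s) op_tensor p.1 p.2)) _.
  by apply: le_trans (opnormD _ _); rewrite addrA subrK.
lra.
Qed.

Lemma spatial_pair n (X : 'I_n -> 'B(K)) A C T : pair_value (E := E) X A C T -> spatial T.
Proof.
have sp B N : spatial (analytic_partial (E := E) B X N).
  by apply: spatial_sum => k; apply: spatial_sum => w; exact: spatial_op_tensor.
move=> [S1 [S2 [h1 h2 ->]]]; apply: spatialD; first exact: spatial_lim h1.
by apply: spatial_adj; exact: spatial_lim h2.
Qed.

End spatial_closure.

Section harmonic_maps.
Context (R : realType) (n m : nat) (a : seq 'I_n -> R) (E H : hilbertType R).
Implicit Types (A B C : seq 'I_n -> 'B(E)).

Local Notation fh := (free_holomorphic m a (E := E)).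

Lemma free_holomorphic_lin c A A' : fh A -> fh A' -> fh (fun w => c *: A w + A' w).
Proof.
move=> hA hA' K X dX; have [S hS] := hA K X dX; have [S' hS'] := hA' K X dX.
by exists (c *: S + S'); exact: analytic_cvg_lin.
Qed.

Lemma free_holomorphic0 : fh (fun=> 0).
Proof. by move=> K X _; exists 0; exact: analytic_cvg0. Qed.

Lemma free_pair_ex A C (K : hilbertType R) (X : 'I_n -> 'B(K)) :
  fh A -> fh C -> Drad m a X -> exists T, pair_value X A C T.
Proof.
move=> hA hC dX; have [S1 h1] := hA K X dX; have [S2 h2] := hC K X dX.
by exists (S1 + adj S2), S1, S2.
Qed.

Definition represented (F : radmap m a E H) A C :=
  forall X, pair_value (sval X) A C (sval (F X)).

Lemma radmap_ex A C : fh A -> fh C -> exists F, represented F A C.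
Proof.
move=> hA hC.
have h (X : {X : 'I_n -> 'B(H) | Drad m a X}) :
    exists T : {T : 'B(tensor E H) | spatial T}, pair_value (sval X) A C (sval T).
  have [T hT] := free_pair_ex hA hC (svalP X).
  by exists (exist _ T (spatial_pair hT)).
by have [F hF] := choice h; exists F.
Qed.

Let half : R[i] := 2^-1.

Let halfC : half^* = half.
Proof. by rewrite fmorphV /= rmorph_nat. Qed.

Let half_coef A w := half *: A w + 0.

Let half_value (K : hilbertType R) (X : 'I_n -> 'B(K)) A S :
  norm_cvg (analytic_partial A X) S ->
  pair_value X (half_coef A) (half_coef A) (half *: (S + adj S)).
Proof.
move=> hS; exists (half *: S + 0), (half *: S + 0); split.
- exact: analytic_cvg_lin hS (analytic_cvg0 _ _).
- exact: analytic_cvg_lin hS (analytic_cvg0 _ _).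
- by rewrite addr0 adjZ halfC scalerDr.
Qed.

Let sa_ex A : fh A -> exists G : radmap m a E H, sa_pluriharmonic G /\
  forall X S, norm_cvg (analytic_partial A (sval X)) S -> sval (G X) = half *: (S + adj S).
Proof.
move=> hA; have hh : fh (half_coef A) by exact: free_holomorphic_lin hA free_holomorphic0.
have [G hG] := radmap_ex hh hh; exists G.
have GE X S : norm_cvg (analytic_partial A (sval X)) S -> sval (G X) = half *: (S + adj S).
  by move=> hS; exact: pair_value_uniq (hG X) (half_value hS).
split=> //; exists A => // X; have [S hS] := hA _ _ (svalP X).
by exists S => //; exact: GE.
Qed.

Lemma Har_represented F : Har m a E H F ->
  exists A C, [/\ fh A, fh C & represented F A C].
Proof.
move=> [N [c [G [saG FE]]]].
(* Stated for arbitrary operator-valued maps, because the partial sums of the combination are not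
   given as elements of [radmap]. *)
pose P (f : {X : 'I_n -> 'B(H) | Drad m a X} -> 'B(tensor E H)) :=
  exists A C, [/\ fh A, fh C & forall X, pair_value (sval X) A C (f X)].
suff : P (fun X => sval (F X)) by [].
have -> : (fun X => sval (F X)) = fun X => \sum_(j < N) c j *: sval (G j X).
  by apply/funext => X; exact: FE.
elim: (index_enum _) => [|j s [A [C [hA hC hAC]]]].
  exists (fun=> 0), (fun=> 0); split; [exact: free_holomorphic0..|].
  by move=> X; rewrite big_nil; exact: pair_value0.
have [D hD hG] := saG j.
have hh : fh (half_coef D) by exact: free_holomorphic_lin hD free_holomorphic0.
exists (fun w => c j *: half_coef D w + A w), (fun w => (c j)^* *: half_coef D w + C w).
split; [exact: free_holomorphic_lin..|].
move=> X; rewrite big_cons; apply: pair_value_lin (hAC X).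
by have [S hS ->] := hG X; exact: half_value.
Qed.

(* A + C^* = Re (A + C) + i Re (- i (A - C)). *)
Lemma represented_Har F A C : fh A -> fh C -> represented F A C -> Har m a E H F.
Proof.
move=> hA hC hF.
have h1 : fh (fun w => 1 *: A w + C w) by exact: free_holomorphic_lin.
have h2 : fh (fun w => (- 'i%C) *: A w + ('i%C *: C w + 0)).
  exact: (free_holomorphic_lin (- 'i%C) hA (free_holomorphic_lin 'i%C hC free_holomorphic0)).
have [G1 [sa1 G1E]] := sa_ex h1; have [G2 [sa2 G2E]] := sa_ex h2.
exists 2%N, (fun j => if j == ord0 then 1 else 'i%C), (fun j => if j == ord0 then G1 else G2).
split=> [j|X]; first by case: ifP.
have [S1 [S2 [hS1 hS2 ->]]] := hF X.
rewrite big_ord_recl big_ord1 /=.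
rewrite (G1E X _ (analytic_cvg_lin 1 hS1 hS2)).
rewrite (G2E X _ (analytic_cvg_lin (- 'i%C) hS1 (analytic_cvg_lin 'i%C hS2 (analytic_cvg0 _ _)))).
have ii : 'i%C * 'i%C = -1 :> R[i] by rewrite -expr2 sqr_i.
have iC : ('i%C : R[i])^* = - 'i%C by apply/eqP; rewrite eq_complex /= oppr0 !eqxx.
rewrite !adj_lin adj0 rmorph1 rmorphN /= iC !opprK !addr0.
apply: bop_ext => x; apply: inner_injl => z.
rewrite !(addbE, scalebE) !(innerDl, innerZl).
move: (inner (S1 x) z) (inner (S2 x) z) (inner (adj S1 x) z) (inner (adj S2 x) z) => p q p' q'.
have hh : half + half = 1 by rewrite -mulr2n -mulr_natl mulfV// pnatr_eq0.
rewrite -[LHS]mul1r -{1}hh; move: 'i%C half ii => j h jj; ring: jj.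
Qed.

Section evaluation.
Hypothesis m_gt0 : (0 < m)%N.
Hypothesis a_ge0 : forall w, 0 <= a w.
Hypothesis a0 : a [::] = 0.
Hypothesis a_gt0 : forall i, 0 < a [:: i].
Hypothesis infH : infinite_dimensional H.

Local Notation rW r := (fun i => r%:C *: univ_model m a i).

(** Both representations are compared at one point of the domain over [H], the copy of rW with r =
    1/2. *)
Lemma pluri_coef_unique_radmap (F : radmap m a E H) B A B' A' :
  (forall X, pluri_value B A (sval X) (sval (F X))) ->
  (forall X, pluri_value B' A' (sval X) (sval (F X))) ->
  A = A' /\ forall w, w != [::] -> B w = B' w.
Proof.
case: m m_gt0 F => // p _ F hF hF'.
have r01 : 0 <= (2^-1 : R) < 1 by rewrite invr_ge0 ler0n invf_lt1 ?ltr1n.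
have [X [h [dX Xh]]] := model_ex p a_ge0 a0 a_gt0 infH r01.
apply: (pluri_coef_unique a_ge0 a0 a_gt0 Xh _ (hF (exist _ X dX)) (hF' (exist _ X dX))).
by rewrite invr_gt0.
Qed.

(** The representation behind [pluri_eval] is some unknown one; by uniqueness of the coefficients it
    agrees with the given one. *)
Lemma pluri_evalP (F : radmap m a E H) A C B A' (r : R) :
  fh A -> fh C -> represented F A C ->
  (forall X, pluri_value B A' (sval X) (sval (F X))) -> 0 <= r < 1 ->
  pluri_value B A' (rW r) (pluri_eval F (rW r)).
Proof.
move=> hA hC hF hF' r01.
have dW : Drad m a (rW r) by case: m m_gt0 => // p _; exact: Drad_univ.
have [T hT] := free_pair_ex hA hC dW.
have [B1 [A1 [hF1 hv]]] := xgetPex 0 (ex_intro (fun S => exists B A,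
  (forall Y, pluri_value B A (sval Y) (sval (F Y))) /\ pluri_value B A (rW r) S) T
  (ex_intro _ _ (ex_intro _ _ (conj (fun X => pair_pluri (hF X)) (pair_pluri hT))))).
have [eA eB] := pluri_coef_unique_radmap hF1 hF'.
by rewrite -eA; exact: pluri_value_ext hv.
Qed.

Lemma Har_coef F : Har m a E H F -> exists B A,
  (forall X, pluri_value B A (sval X) (sval (F X))) /\
  forall r : R, 0 <= r < 1 -> pluri_value B A (rW r) (pluri_eval F (rW r)).
Proof.
move=> /Har_represented[A [C [hA hC hF]]].
do 2 eexists; split=> [X|r r01]; first exact: pair_pluri (hF X).
by apply: (pluri_evalP hA hC hF _ r01) => X; exact: pair_pluri (hF X).
Qed.

End evaluation.
End harmonic_maps.

(** * The metric *)

Section weighted_metric_sums.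
Context (R : realType).
Implicit Types f g h : nat -> R.

Definition bounded_metric (t : R) : R := t / (1 + t).

Local Notation bm := bounded_metric.

Definition partial_rho f N : R := \sum_(1 <= k < N.+1) (1 / 2) ^+ k * bm (f k).

Definition rho_sum f : R := limn (partial_rho f).

Lemma bm_ge0 t : 0 <= t -> 0 <= bm t.
Proof. by move=> t0; rewrite divr_ge0// addr_ge0. Qed.

Lemma bm_lt1 t : 0 <= t -> bm t < 1.
Proof. by move=> t0; rewrite ltr_pdivrMr ?mul1r ?ltrDr// ltr_wpDr. Qed.

Lemma bm_le s t : 0 <= s -> s <= t -> bm s <= bm t.
Proof.
move=> s0 st; have s1 : 0 < 1 + s by rewrite ltr_wpDr.
have t1 : 0 < 1 + t by rewrite ltr_wpDr// (le_trans s0).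
rewrite /bm ler_pdivrMr// mulrAC ler_pdivlMr//; nra.
Qed.

Lemma bmD s t : 0 <= s -> 0 <= t -> bm (s + t) <= bm s + bm t.
Proof.
move=> s0 t0; have s1 : 0 < 1 + s by rewrite ltr_wpDr.
have t1 : 0 < 1 + t by rewrite ltr_wpDr.
have st1 : 0 < 1 + (s + t) by rewrite ltr_wpDr// addr_ge0.
rewrite /bm mulrDl lerD// ler_wpM2l// lef_pV2 ?posrE//; lra.
Qed.

Let halfp k : 0 < (1 / 2 : R) ^+ k. Proof. by rewrite exprn_gt0// divr_gt0. Qed.

Let term_ge0 f k : (forall k, 0 <= f k) -> 0 <= (1 / 2) ^+ k * bm (f k).
Proof. by move=> f0; rewrite mulr_ge0 ?bm_ge0// ltW. Qed.

Let partial_split f i j : (i <= j)%N ->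
  partial_rho f j = partial_rho f i + \sum_(i.+1 <= k < j.+1) (1 / 2) ^+ k * bm (f k).
Proof. by move=> ij; rewrite /partial_rho (big_cat_nat (n := i.+1)). Qed.

Lemma partial_rho_nd f : (forall k, 0 <= f k) -> nondecreasing_seq (partial_rho f).
Proof.
move=> f0 i j ij; rewrite (partial_split f ij) lerDl sumr_ge0// => k _.
exact: term_ge0.
Qed.

(** The sequence [partial_rho f j] + 2^(-j) is nonincreasing, since the term of index j + 1 is at
    most 2^(-j-1). *)
Lemma partial_rho_tail f i j : (forall k, 0 <= f k) -> (i <= j)%N ->
  partial_rho f j <= partial_rho f i + (1 / 2) ^+ i.
Proof.
move=> f0 ij; suff : partial_rho f j + (1 / 2) ^+ j <= partial_rho f i + (1 / 2) ^+ i.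
  by apply: le_trans; rewrite lerDl ltW.
move: ij => /subnK <-; elim: (j - i)%N => [|k IH]; first by rewrite add0n.
apply: le_trans IH; rewrite addSn /partial_rho big_nat_recr//= -addrA lerD2l.
rewrite exprS; have := bm_lt1 (f0 (k + i).+1); have := halfp (k + i).
move: (bm _) ((1 / 2) ^+ _) => x y; nra.
Qed.

Lemma partial_rho_cvg f : (forall k, 0 <= f k) -> cvgn (partial_rho f).
Proof.
move=> f0; apply: nondecreasing_is_cvgn; first exact: partial_rho_nd.
exists 1 => _ [N _ <-]; apply: le_trans (partial_rho_tail f0 (leq0n N)) _.
by rewrite /partial_rho big_geq// add0r expr0.
Qed.

Lemma partial_le_rho f N : (forall k, 0 <= f k) -> partial_rho f N <= rho_sum f.
Proof.
by move=> f0; apply: nondecreasing_cvgn_le; [exact: partial_rho_nd | exact: partial_rho_cvg].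
Qed.

Lemma rho_le f c : (forall k, 0 <= f k) ->
  (exists N0, forall N, (N0 <= N)%N -> partial_rho f N <= c) -> rho_sum f <= c.
Proof.
move=> f0 [N0 hN]; apply: limr_le; first exact: partial_rho_cvg.
by exists N0.
Qed.

Lemma rho_ge0 f : (forall k, 0 <= f k) -> 0 <= rho_sum f.
Proof. by move=> f0; have := partial_le_rho 0 f0; rewrite /partial_rho big_geq. Qed.

Lemma term_le_rho f k : (forall k, 0 <= f k) -> (0 < k)%N ->
  (1 / 2) ^+ k * bm (f k) <= rho_sum f.
Proof.
move=> f0 k0; apply: le_trans (partial_le_rho k f0).
case: k k0 => // k _; rewrite /partial_rho big_nat_recr//= lerDr sumr_ge0// => i _.
exact: term_ge0.
Qed.

Lemma rho_eq0 f k : (forall k, 0 <= f k) -> rho_sum f = 0 -> (0 < k)%N -> f k = 0.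
Proof.
move=> f0 r0 k0; apply/eqP; rewrite eq_le f0 andbT leNgt; apply/negP => fk.
have := term_le_rho f0 k0; rewrite r0; apply/negP; rewrite -ltNge.
by rewrite mulr_gt0// divr_gt0// ltr_wpDr.
Qed.

Lemma rho_0 f : (forall k, f k = 0) -> rho_sum f = 0.
Proof.
move=> f0; have fp k : 0 <= f k by rewrite f0.
apply/eqP; rewrite eq_le rho_ge0// andbT; apply: rho_le => //; exists 0%N => N _.
by rewrite /partial_rho big1// => k _; rewrite f0 /bm mul0r mulr0.
Qed.

Lemma rhoD f g h : (forall k, 0 <= f k) -> (forall k, 0 <= g k) -> (forall k, 0 <= h k) ->
  (forall k, f k <= g k + h k) -> rho_sum f <= rho_sum g + rho_sum h.
Proof.
move=> f0 g0 h0 fgh; apply: rho_le => //; exists 0%N => N _.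
apply: le_trans (lerD (partial_le_rho N g0) (partial_le_rho N h0)).
rewrite /partial_rho -big_split; apply: ler_sum => k _ /=.
by rewrite -mulrDr ler_wpM2l ?(ltW (halfp _))// (le_trans (bm_le _ (fgh k)))// bmD.
Qed.

(** The term of index k is at most the whole sum, and t / (1 + t) increases with t; hence the
    threshold 2^(-k) e / (1 + e). *)
Lemma rho_small k (e : R) : (0 < k)%N -> 0 < e -> exists2 d, 0 < d &
  forall f, (forall k, 0 <= f k) -> rho_sum f < d -> f k < e.
Proof.
move=> k0 e0; exists ((1 / 2) ^+ k * bm e).
  by rewrite mulr_gt0// divr_gt0// ltr_wpDr// ltW.
move=> f f0 hf; rewrite ltNge; apply/negP => ef.
have := le_lt_trans (term_le_rho f0 k0) hf; rewrite ltr_pM2l//; apply/negP.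
by rewrite -leNgt bm_le// ltW.
Qed.

(** Beyond an index N the tail is at most 2^(-N) uniformly in j, and the finitely many remaining
    terms tend to 0. *)
Lemma rho_null (F : nat -> nat -> R) : (forall j k, 0 <= F j k) ->
  (forall k, (0 < k)%N -> null (fun j => F j k)) -> null (fun j => rho_sum (F j)).
Proof.
move=> F0 hF e e0.
have h01 : 0 <= (1 / 2 : R) < 1 by apply/andP; split; lra.
have e20 : 0 < e / 2 by rewrite divr_gt0.
have [N hN] := null_geom h01 e20.
have [J hJ] : exists J, forall j, (J <= j)%N -> partial_rho (F j) N < e / 2.
  suff h : null (fun j => partial_rho (F j) N) by exact: h.
  elim: N {hN} => [|N IH].
    by move=> d d0; exists 0%N => j _; rewrite /partial_rho big_geq.
  apply: null_le (nullD IH (hF N.+1 isT)) => j.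
  rewrite /partial_rho big_nat_recr//= lerD2l.
  have h1 : (1 / 2 : R) ^+ N.+1 <= 1 by rewrite exprn_ile1//; lra.
  have h2 : bm (F j N.+1) <= F j N.+1.
    by rewrite ler_pdivrMr ?ltr_wpDr// ler_peMr// lerDl.
  by apply: le_trans h2; rewrite ler_piMl ?bm_ge0.
exists J => j Jj; apply: (@le_lt_trans _ _ (partial_rho (F j) N + (1 / 2) ^+ N)).
  by apply: rho_le => //; exists N => N' NN'; exact: partial_rho_tail.
by have := hN N (leqnn _); have := hJ j Jj; lra.
Qed.

End weighted_metric_sums.

Section coefficient_limits.
Context (R : realType) (n m : nat) (a : seq 'I_n -> R) (E : hilbertType R).
Hypothesis a_ge0 : forall w, 0 <= a w.
Hypothesis a0 : a [::] = 0.
Hypothesis a_gt0 : forall i, 0 < a [:: i].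
Implicit Types (A C : seq 'I_n -> 'B(E)).

Local Notation b := (npow a m.+1).
Local Notation pw := (npow_gt0 a_ge0 a0 a_gt0).
Local Notation bound := (coef_bound m a).
Local Notation rW r := (fun i => r%:C *: univ_model m.+1 a i).

Lemma coef_bound_le A c c' rho : 0 <= c -> c <= c' -> 0 < rho ->
  bound A c rho -> bound A c' rho.
Proof.
move=> c0 cc' r0 hA k x; apply: le_trans (hA k x) _.
rewrite ler_wpM2r ?sqr_ge0// ler_pXn2r ?nnegrE ?divr_ge0 ?exprn_ge0 ?(ltW r0)//.
  by rewrite ler_wpM2r// invr_ge0 exprn_ge0// ltW.
exact: le_trans cc'.
Qed.

(** The summand of [w] alone is at most the sum over all words of its length. *)
Lemma coef_bound_opnorm A c rho w : 0 <= c -> 0 < rho -> bound A c rho ->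
  opnorm (A w) <= Num.sqrt (b w) / rho ^+ size w * c.
Proof.
move=> c0 r0 hA; have cr0 : 0 <= c / rho ^+ size w.
  by rewrite divr_ge0// exprn_ge0// ltW.
have k0 := mulr_ge0 (sqrtr_ge0 (b w)) cr0.
rewrite mulrAC -mulrA; apply: opnorm_le => // x.
rewrite -(@ler_pXn2r _ 2)// ?nnegrE ?(mulr_ge0 k0) ?hnorm_ge0//.
rewrite exprMn [(Num.sqrt _ * _) ^+ 2]exprMn (@sqr_sqrtr _ (b w)) ?npow_ge0//.
rewrite -[leRHS]mulrA [leRHS]mulrC -ler_pdivrMr ?pw//; apply: le_trans (hA (size w) x).
rewrite (bigD1 (in_tuple w)) //= lerDl sumr_ge0// => v _.
by rewrite divr_ge0 ?sqr_ge0 ?npow_ge0.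
Qed.

Lemma coef_complete (A : nat -> seq 'I_n -> 'B(E)) rho : 0 < rho ->
  (forall e : R, 0 < e -> exists N, forall i j, (N <= i)%N -> (N <= j)%N ->
     bound (fun w => A i w - A j w) e rho) ->
  exists D, forall w, norm_cvg (fun i => A i w) (D w).
Proof.
move=> r0 cA.
suff h w : exists S, norm_cvg (fun i => A i w) S.
  by have [D hD] := choice h; exists D.
apply: bop_complete => e e0; set M := Num.sqrt (b w) / rho ^+ size w.
have M0 : 0 <= M by rewrite divr_ge0 ?sqrtr_ge0// exprn_ge0// ltW.
have M1 : 0 < M + 1 by rewrite ltr_wpDl.
have d0 := divr_gt0 e0 M1.
have [N hN] := cA _ d0; exists N => i j Ni Nj.
apply: le_lt_trans (coef_bound_opnorm w (ltW d0) r0 (hN i j Ni Nj)) _.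
by rewrite -/M mulrA ltr_pdivrMr// mulrC ltr_pM2l// ltrDl.
Qed.

Lemma coef_bound_lim (A : nat -> seq 'I_n -> 'B(E)) D c rho :
  (forall w, norm_cvg (fun i => A i w) (D w)) ->
  (exists N, forall i, (N <= i)%N -> bound (A i) c rho) -> bound D c rho.
Proof.
move=> AD [N hN] k x.
have cvgA : \sum_(w : k.-tuple 'I_n) hnorm (A i w x) ^+ 2 / b w @[i --> \oo] -->
    \sum_(w : k.-tuple 'I_n) hnorm (D w x) ^+ 2 / b w.
  elim: (index_enum _) => [|w s IH].
    by rewrite big_nil; under eq_fun do rewrite big_nil; exact: cvg_cst.
  rewrite big_cons; under eq_fun do rewrite big_cons.
  apply: cvgD IH; apply: cvgMl; rewrite expr2.
  by apply: cvgM; apply: hcvg_hnorm; exact: norm_cvg_app.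
apply: (cvgr_to_le cvgA); exists N => // i /= Ni.
exact: hN.
Qed.

Lemma pair_valueB (K : hilbertType R) (X : 'I_n -> 'B(K)) A A' C C' T T' :
  pair_value X A C T -> pair_value X A' C' T' ->
  pair_value X (fun w => A w - A' w) (fun w => C w - C' w) (T - T').
Proof.
move=> h h'; have := pair_value_lin (-1) h' h.
have BE (D D' : seq 'I_n -> 'B(E)) :
    (fun w => -1 *: D' w + D w) = fun w => D w - D' w.
  by apply/funext => w; rewrite scaleN1r addrC.
by rewrite rmorphN rmorph1 !BE scaleN1r addrC.
Qed.

Lemma adj_coefK C : C [::] = 0 -> adj_coef (fun w => adj (C w)) = C.
Proof.
by move=> C0; apply/funext => w; rewrite /adj_coef adjK; case: eqP => [->|].
Qed.

Lemma pair_pluri0 (K : hilbertType R) (X : 'I_n -> 'B(K)) A C T : C [::] = 0 ->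
  pair_value X A C T -> pluri_value (fun w => adj (C w)) A X T.
Proof.
move=> C0; have [_ h] := pluri_pair X (fun w => adj (C w)) A T.
by rewrite (adj_coefK C0) in h.
Qed.

Lemma pluri_pair0 (K : hilbertType R) (X : 'I_n -> 'B(K)) A C T : C [::] = 0 ->
  pluri_value (fun w => adj (C w)) A X T -> pair_value X A C T.
Proof.
move=> C0; have [h _] := pluri_pair X (fun w => adj (C w)) A T.
by rewrite (adj_coefK C0) in h.
Qed.

(** The first row yields [C] in degrees k >= 1; degree 0 is covered by [C [::] = 0], the whole
    constant term being in [A]. *)
Lemma pair_value_bounds A C (r : R) T : C [::] = 0 -> 0 < r -> pair_value (rW r) A C T ->
  bound A (opnorm T) r /\ bound C (opnorm T) r.
Proof.
move=> C0 r0 /(pair_pluri0 C0) hT.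
have model := is_model_univ m a_ge0 a0 a_gt0 r.
split=> k x; first exact: (pluri_column_bound a_ge0 a0 a_gt0 model r0 k x hT).
case: (posnP k) => [->|k0].
  rewrite (big_tuple0 (fun w => hnorm (C w x) ^+ 2 / b w)) C0 hnorm0 expr0n /= mul0r.
  by rewrite mulr_ge0 ?sqr_ge0.
have := pluri_row_bound a_ge0 a0 a_gt0 model r0 x k0 hT.
by under eq_bigr do rewrite adjK.
Qed.

Lemma pair_value_cvg (rho t : R) : 0 <= t < rho -> exists2 M, 0 <= M &
  forall (K : hilbertType R) (Y : 'I_n -> 'B(K)) A C (c : R),
  Dom m.+1 a Y -> 0 <= c -> bound A c rho -> bound C c rho ->
  exists T, pair_value (fun i => t%:C *: Y i) A C T /\ opnorm T <= M * c.
Proof.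
move=> tr; have [M M0 hM] := analytic_cvg m a_ge0 a0 a_gt0 E tr.
exists (M + M) => [|K Y A C c dY c0 hA hC]; first exact: addr_ge0.
have [S1 [h1 le1]] := hM K Y A c dY c0 hA.
have [S2 [h2 le2]] := hM K Y C c dY c0 hC.
exists (S1 + adj S2); split; first by exists S1, S2.
by rewrite mulrDl; apply: le_trans (opnormD _ _) (lerD le1 _); rewrite opnorm_adj.
Qed.

End coefficient_limits.

(** * Separation of points and completeness *)

Section completeness.
Context (R : realType) (n m : nat) (a : seq 'I_n -> R) (E H : hilbertType R).
Hypothesis a_ge0 : forall w, 0 <= a w.
Hypothesis a0 : a [::] = 0.
Hypothesis a_gt0 : forall i, 0 < a [:: i].
Hypothesis infH : infinite_dimensional H.
Variable (r : nat -> R).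
Hypothesis r01 : forall k, (1 <= k)%N -> 0 < r k < 1.
Hypothesis r_lim : r k @[k --> \oo] --> (1 : R).

Local Notation Har := (Har m.+1 a E H).
Local Notation rW t := (fun i => t%:C *: univ_model m.+1 a i).
Local Notation bound := (coef_bound m a).

Lemma radius_gt (t : R) : t < 1 -> exists2 p, (1 <= p)%N & t < r p.
Proof.
move=> t1; move/cvgrPdist_lt: r_lim => /(_ (1 - t)); rewrite subr_gt0 => /(_ t1)[N _ hN].
(* [N.+1] because the radii are indexed from 1. *)
exists N.+1 => //; have /= := hN N.+1 (leqnSn N).
by move=> /(le_lt_trans (ler_norm _)); lra.
Qed.

Lemma rhoE F G : rho m.+1 a E H r F G = rho_sum (fun k => dr (r k) F G).
Proof. by []. Qed.

Lemma dr_ge0 t (F G : radmap m.+1 a E H) : 0 <= dr t F G.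
Proof. exact: opnorm_ge0. Qed.

Lemma dr_sym t (F G : radmap m.+1 a E H) : dr t F G = dr t G F.
Proof. exact: opnorm_subC. Qed.

Lemma dr_triangle t (F G K : radmap m.+1 a E H) : dr t F K <= dr t F G + dr t G K.
Proof. by apply: le_trans (opnormD _ _); rewrite addrA subrK. Qed.

(** A single radius suffices: the value at tW determines the coefficients, and these determine the
    map over [H]. *)
Lemma dr_eq0 t F G : Har F -> Har G -> 0 < t < 1 -> dr t F G = 0 -> F = G.
Proof.
move=> hF hG /andP[t0 t1] /opnorm_eq0/eqP; rewrite subr_eq0 => /eqP e.
have t01 : 0 <= t < 1 by rewrite ltW.
have [B [A [FE hFv]]] := Har_coef (ltn0Sn m) a_ge0 a0 a_gt0 infH hF.
have [B' [A' [GE hGv]]] := Har_coef (ltn0Sn m) a_ge0 a0 a_gt0 infH hG.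
have := hFv t t01; rewrite e => hT.
have [eA eB] := pluri_coef_unique a_ge0 a0 a_gt0
  (is_model_univ m a_ge0 a0 a_gt0 t) t0 hT (hGv t t01).
apply/funext => X; apply: eq_sig_hprop => [T|]; first exact: Prop_irrelevance.
by apply: pluri_value_uniq eB (FE X) _; rewrite eA; exact: GE.
Qed.

Lemma Har_complete (u : nat -> radmap m.+1 a E H) : (forall k, Har (u k)) ->
  (forall e : R, 0 < e -> exists N, forall i j, (N <= i)%N -> (N <= j)%N ->
     rho m.+1 a E H r (u i) (u j) < e) ->
  exists2 F, Har F & forall p, (1 <= p)%N -> null (fun j => dr (r p) (u j) F).
Proof.
move=> hu cu.
have r01' p : (1 <= p)%N -> 0 <= r p < 1 by move=> /r01/andP[/ltW -> ->].
have rgt0 p : (1 <= p)%N -> 0 < r p by move=> /r01/andP[].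
(* One pair of series serves all radii, and [adj_coef] is 0 at the empty word, which gives the
   normalization. *)
have coefs j : exists AC : (seq 'I_n -> 'B(E)) * (seq 'I_n -> 'B(E)), AC.2 [::] = 0 /\
    forall p, (1 <= p)%N -> pair_value (rW (r p)) AC.1 AC.2 (pluri_eval (u j) (rW (r p))).
  have [B [A [_ hv]]] := Har_coef (ltn0Sn m) a_ge0 a0 a_gt0 infH (hu j).
  exists (A, adj_coef B); split=> [|p p1]; first by [].
  by have [h _] := pluri_pair (rW (r p)) B A (pluri_eval (u j) (rW (r p)));
    exact: h (hv _ (r01' p p1)).
have [AC hAC] := choice coefs.
pose A j := (AC j).1; pose C j := (AC j).2.
pose T j p := pluri_eval (u j) (rW (r p)).
have C0 j : C j [::] = 0 by case: (hAC j).
have hT j p : (1 <= p)%N -> pair_value (rW (r p)) (A j) (C j) (T j p).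
  by move=> p1; case: (hAC j) => _; apply.
have cT p e : (1 <= p)%N -> 0 < e -> exists N, forall i j, (N <= i)%N -> (N <= j)%N ->
    opnorm (T i p - T j p) < e.
  move=> p1 e0; have [d d0 hd] := rho_small p1 e0.
  have [N hN] := cu d d0; exists N => i j Ni Nj.
  by apply: (hd (fun k => dr (r k) (u i) (u j))) => [k|]; [exact: dr_ge0 | exact: hN].
have diff p e : (1 <= p)%N -> 0 < e -> exists N, forall i j, (N <= i)%N -> (N <= j)%N ->
    bound (fun w => A i w - A j w) e (r p) /\ bound (fun w => C i w - C j w) e (r p).
  move=> p1 e0; have [N hN] := cT p e p1 e0; exists N => i j Ni Nj.
  have [|bA bC] := pair_value_bounds a_ge0 a0 a_gt0 _ (rgt0 p p1)
    (pair_valueB (hT i p p1) (hT j p p1)); first by rewrite !C0 subr0.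
  by split; apply: coef_bound_le (opnorm_ge0 _) (ltW (hN i j Ni Nj)) (rgt0 p p1) _.
have [A' hA'] : exists D, forall w, norm_cvg (fun i => A i w) (D w).
  apply: (coef_complete (A := A) a_ge0 a0 a_gt0 (rgt0 1%N isT)) => e e0.
  have [N hN] := diff 1%N e isT e0; exists N => i j Ni Nj.
  by have [h _] := hN i j Ni Nj; exact: h.
have [C' hC'] : exists D, forall w, norm_cvg (fun i => C i w) (D w).
  apply: (coef_complete (A := C) a_ge0 a0 a_gt0 (rgt0 1%N isT)) => e e0.
  have [N hN] := diff 1%N e isT e0; exists N => i j Ni Nj.
  by have [_ h] := hN i j Ni Nj; exact: h.
have C'0 : C' [::] = 0.
  apply: norm_cvg_uniq (hC' [::]) _.
  have -> : (fun i => C i [::]) = fun=> 0 by apply/funext => i; exact: C0.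
  exact: norm_cvg_cst.
(* A Cauchy sequence is bounded: from [N] on the norms exceed that of [T N p] by at most 1, and the
   coefficient bounds pass to the limit. *)
have bounds p : (1 <= p)%N -> exists2 c, 0 <= c & bound A' c (r p) /\ bound C' c (r p).
  move=> p1; have [N hN] := cT p 1 p1 ltr01.
  exists (opnorm (T N p) + 1); first by rewrite addr_ge0 ?opnorm_ge0.
  have bi i : (N <= i)%N -> bound (A i) (opnorm (T N p) + 1) (r p) /\
      bound (C i) (opnorm (T N p) + 1) (r p).
    move=> Ni; have [bA bC] := pair_value_bounds a_ge0 a0 a_gt0 (C0 i) (rgt0 p p1) (hT i p p1).
    have le1 : opnorm (T i p) <= opnorm (T N p) + 1.
      rewrite -[T i p](subrK (T N p)) addrC; apply: le_trans (opnormD _ _) _.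
      by rewrite lerD2l ltW// hN.
    by split; apply: coef_bound_le (opnorm_ge0 _) le1 (rgt0 p p1) _.
  split.
    by apply: coef_bound_lim hA' _; exists N => i /bi[].
  by apply: coef_bound_lim hC' _; exists N => i /bi[].
have fh (D : seq 'I_n -> 'B(E)) : (forall p, (1 <= p)%N -> exists2 c, 0 <= c & bound D c (r p)) ->
    free_holomorphic m.+1 a D.
  move=> hD K X [t /andP[t0 t1] [Y dY ->]].
  have [p p1 tp] := radius_gt t1; have [c c0 hc] := hD p p1.
  have [|M _ hM] := @analytic_cvg R n m a a_ge0 a0 a_gt0 E (r p) t; first by rewrite t0.
  by have [S [hS _]] := hM K Y D c dY c0 hc; exists S.
have fhA : free_holomorphic m.+1 a A'.
  by apply: fh => p /bounds[c c0 [hc _]]; exists c.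
have fhC : free_holomorphic m.+1 a C'.
  by apply: fh => p /bounds[c c0 [_ hc]]; exists c.
have [F hF] := radmap_ex H fhA fhC.
have hFv p : (1 <= p)%N -> pair_value (rW (r p)) A' C' (pluri_eval F (rW (r p))).
  move=> p1; apply: (pluri_pair0 C'0).
  apply: (pluri_evalP (ltn0Sn m) a_ge0 a0 a_gt0 infH fhA fhC hF _ (r01' p p1)) => X.
  exact: (pair_pluri0 C'0).
exists F; first exact: represented_Har hF.
(* Coefficient bounds at a radius control values only at strictly smaller ones, so the bounds are
   taken at some r_q > r_p. *)
move=> p p1 e e0; have [q q1 pq] := radius_gt (proj2 (andP (r01 p1))).
have [|M M0 hM] := @pair_value_cvg R n m a E a_ge0 a0 a_gt0 (r q) (r p).
  by rewrite pq ltW// rgt0.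
have M1 : 0 < M + 1 by rewrite ltr_wpDl.
have d0 := divr_gt0 e0 M1.
have [N hN] := diff q _ q1 d0; exists N => j Nj.
(* With j fixed, i tends to infinity in the bounds for A_j - A_i and C_j - C_i. *)
have lim (D : nat -> seq 'I_n -> 'B(E)) D' w : norm_cvg (fun i => D i w) (D' w) ->
    norm_cvg (fun i => D j w - D i w) (D j w - D' w).
  move=> hD; have := norm_cvg_lin (-1) hD (norm_cvg_cst (D j w)).
  by rewrite scaleN1r addrC; under eq_fun do rewrite scaleN1r addrC.
have [||T' [hT' leT']] := hM _ _ (fun w => A j w - A' w) (fun w => C j w - C' w) _
  (@univ_model_Dom _ _ m _ a_ge0 a0 a_gt0) (ltW d0).
- apply: (@coef_bound_lim _ _ _ _ _ (fun i w => A j w - A i w)) => [w|]; first exact: lim.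
  by exists N => i Ni; case: (hN j i Nj Ni).
- apply: (@coef_bound_lim _ _ _ _ _ (fun i w => C j w - C i w)) => [w|]; first exact: lim.
  by exists N => i Ni; case: (hN j i Nj Ni).
have -> : dr (r p) (u j) F = opnorm T'.
  by congr opnorm; apply: pair_value_uniq (pair_valueB (hT j p p1) (hFv p p1)) hT'.
apply: le_lt_trans leT' _.
by rewrite mulrA ltr_pdivrMr// mulrC ltr_pM2l// ltrDl.
Qed.

End completeness.

Theorem theorem3p10 (R : realType) (n m : nat) (hn : (1 <= n)%N) (hm : (1 <= m)%N)
  (E : hilbertType R) (sepE : separable E)
  (H : hilbertType R) (sepH : separable H) (infH : infinite_dimensional H)
  (a : seq 'I_n -> R) (ha : positive_regular a)
  (r : nat -> R)
  (r01 : forall k, (1 <= k)%N -> 0 < r k < 1)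
  (r_incr : forall j k, (1 <= j)%N -> (j <= k)%N -> r j <= r k)
  (r_lim : r k @[k --> \oo] --> (1 : R)) :
  complete_metric_space (Har m a E H) (rho m a E H r).
Proof.
case: m hm => [|p _]; first by rewrite ltnn.
have [a_ge0 a0 a_gt0 _] := ha.
split=> [F G hF hG|F G _ _|F G K _ _ _|u hu cu].
- rewrite rhoE; split; first by apply: rho_ge0 => k; exact: dr_ge0.
  split=> [r0|->]; last by apply: rho_0 => k; rewrite /dr subrr opnorm0.
  apply: (dr_eq0 a_ge0 a0 a_gt0 infH hF hG (r01 1%N isT)).
  by apply: (rho_eq0 _ r0) => // k; exact: dr_ge0.
- have e : (fun k => dr (r k) F G) = (fun k => dr (r k) G F).
    by apply/funext => k; rewrite dr_sym.
  exact: (congr1 (@rho_sum R) e).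
- apply: (@rhoD R (fun k => dr (r k) F K)) => k; [exact: dr_ge0 | exact: dr_ge0 | exact: dr_ge0 |].
  exact: dr_triangle.
have [F hF uF] := Har_complete a_ge0 a0 a_gt0 infH r01 r_lim hu cu.
exists F => //; apply: null_cvg => [k|].
  by rewrite rhoE; apply: rho_ge0 => j; exact: dr_ge0.
by apply: (rho_null (F := fun j k => dr (r k) (u j) F)) => // j k; exact: dr_ge0.
Qed.
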